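(* Let $\pi:M\to B$ be a fiber bundle with $M$ a 5-dimensional manifold with volume form $\Omega$ and $B$ an oriented 2-manifold with area form $\omega$. Let $\gamma$ be an Ehresmann connection on $M$ with horizontal subbundle $\mathbb H=\ker\gamma$, let $\kappa\in C^\infty(M)$ and let $\beta\in\Gamma\mathbb H^{\circ}$ be a vertical 1-form. Then the almost coupling bivector field $$\Pi=\kappa\,\mathrm{hor}^{\gamma}\psi+P_\beta$$ is a Poisson tensor if and only if the triple $(\gamma,\kappa,\beta)$ satisfies the integrability conditions $$d_{0,1}\beta\wedge\beta=0,\qquad \kappa\,(d_{1,0}\beta-\theta\wedge\beta)=0,\qquad d_{0,1}\kappa\wedge\beta-\kappa^{2}\varrho=0.$$
   Context: All objects are smooth. A fiber bundle $\pi:M\to B$ is a surjective submersion; $\mathbb V=\ker d\pi\subset TM$ is the vertical subbundle (rank 3 here). An Ehresmann connection is a bundle morphism $\gamma:TM\to\mathbb V$ with $\gamma|_{\mathbb V}=\mathrm{id}$; $\mathbb H=\ker\gamma$, so $TM=\mathbb H\oplus\mathbb V$ and $T^*M=\mathbb V^\circ\oplus\mathbb H^\circ$ (annihilators). These splittings bigrade multivector fields and forms: a multivector field has bidegree $(p,q)$ if it is a section of $\wedge^p\mathbb H\otimes\wedge^q\mathbb V$, and a form has bidegree $(p,q)$ if it is a section of $\wedge^p\mathbb V^\circ\otimes\wedge^q\mathbb H^\circ$. The exterior differential splits as $d=d_{1,0}+d_{0,1}+d_{2,-1}$, where for a $(p,q)$-form $\alpha$, $d_{i,j}\alpha$ is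 the bidegree $(p+i,q+j)$ component of $d\alpha$ (these operators depend on $\gamma$). For a multivector field $\psi$ on $B$, $\mathrm{hor}^\gamma\psi$ is its $\gamma$-horizontal lift to $M$. A bivector field $\Pi$ is almost coupling (via $\gamma$) if its $(1,1)$ component vanishes; it is a Poisson tensor if its Schouten bracket with itself vanishes. Interior products: $\mathbf i_{X\wedge Y}=\mathbf i_X\circ\mathbf i_Y$ for vector fields acting on forms; similarly $\mathbf i_{\alpha\wedge\alpha'}=\mathbf i_\alpha\circ\mathbf i_{\alpha'}$ for 1-forms acting on multivector fields, with $\mathbf i_\alpha$ inserting $\alpha$ in the first slot. Let $\Omega^{\mathrm H}=\pi^*\omega$ and let $\Omega^{\mathrm V}\in\Gamma\wedge^3\mathbb H^\circ$ be the unique (nowhere vanishing) form with $\Omega=\Omega^{\mathrm H}\wedge\Omega^{\mathrm V}$. Let $Q_{\mathrm H}\in\Gamma\wedge^2\mathbb H$, $Q_{\mathrm V}\in\Gamma\wedge^3\mathbb V$ be determined by $\mathbf i_{Q_{\mathrm H}}\Omega^{\mathrm H}=1$, $\mathbf i_{Q_{\mathrm V}}\Omega^{\mathrm V}=1$. Let $\psi\in\Gamma\wedge^2TB$ be the bivector field with $\mathbf i_\psi\omega=-1$ (so $Q_{\mathrm H}=-\mathrm{hor}^\gamma\psi$). Put $$P_\beta=-\mathbf i_\beta Q_{\mathrm V}\in\Gamma\wedge^2\mathbb V,\qquad \theta=-\mathbf i_{Q_{\mathrm V}}d_{1,0}\Omega^{\mathrm V}\in\Gamma\mathbb V^\circ,\qquad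 \varrho=\mathbf i_{Q_{\mathrm H}}d_{2,-1}\Omega^{\mathrm V}\in\Gamma\wedge^2\mathbb H^\circ;$$ these forms satisfy $d_{1,0}\Omega^{\mathrm V}=\theta\wedge\Omega^{\mathrm V}$ and $d_{2,-1}\Omega^{\mathrm V}=\Omega^{\mathrm H}\wedge\varrho$. *)

(* Defs.v *)
From mathcomp Require Import all_boot all_order all_algebra all_fingroup.
From mathcomp Require Import all_classical all_reals all_analysis.
Set Implicit Arguments.
Unset Strict Implicit.
Unset Printing Implicit Defensive.
Import Order.TTheory GRing.Theory Num.Theory.
Import numFieldNormedType.Exports.
Local Open Scope classical_set_scope.
Local Open Scope ring_scope.

(* [U] is meant to be open; C^k is expressed by the existence and continuity of
   all iterated partial derivatives of order at most k. *)
Fixpoint Ck (R : realType) (n k : nat) (U : set 'rV[R]_n) (f : 'rV[R]_n -> R)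
    : Prop :=
  (forall x, U x -> {for x, continuous f}) /\
  match k with
  | 0%N => True
  | k'.+1 => forall i : 'I_n,
      (forall x, U x -> derivable f x (delta_mx 0 i)) /\
      Ck k' U (fun x => 'D_(delta_mx 0 i) f x)
  end.

Definition smooth_on (R : realType) (n : nat) (U : set 'rV[R]_n)
  (f : 'rV[R]_n -> R) : Prop := forall k, Ck k U f.

Record chart (R : realType) (n : nat) (T : topologicalType) := Chart {
  cdom : set T;
  cmap : T -> 'rV[R]_n;
  cinv : 'rV[R]_n -> T;
  open_cdom : open cdom;
  open_cimg : open (cmap @` cdom);
  cmapK : forall p, cdom p -> cinv (cmap p) = p;
  cmap_cont : forall p, cdom p -> {for p, continuous cmap};
  cinv_cont : forall p, cdom p -> {for cmap p, continuous cinv} }.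

(* [chart_at] singles out, for each point, one chart of the atlas around it;
   it serves to identify every tangent space with R^n (see below). *)
Record manifold (R : realType) (n : nat) := Manifold {
  mpoint :> topologicalType;
  mfd_hausdorff : hausdorff_space mpoint;
  mfd_countable : @second_countable mpoint;
  atlas : set (chart R n mpoint);
  chart_at : mpoint -> chart R n mpoint;
  chart_at_atlas : forall p, atlas (chart_at p);
  chart_at_dom : forall p, cdom (chart_at p) p;
  atlas_compat : forall c d, atlas c -> atlas d -> forall j,
    smooth_on (cmap c @` (cdom c `&` cdom d))
              (fun x => cmap d (cinv c x) 0 j) }.

Definition cimg (R : realType) (n : nat) (T : topologicalType)
  (c : chart R n T) : set 'rV[R]_n := cmap c @` cdom c.

Definition smooth_fun (R : realType) (n : nat) (M : manifold R n)
  (f : M -> R) : Prop :=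
  forall c, atlas c -> smooth_on (cimg c) (fun x => f (cinv c x)).

Definition smooth_map (R : realType) (m n : nat) (M : manifold R m)
  (N : manifold R n) (f : M -> N) : Prop :=
  continuous f /\
  forall c d, atlas c -> atlas d -> forall j,
    smooth_on (cmap c @` (cdom c `&` (f @^-1` cdom d)))
              (fun x => cmap d (f (cinv c x)) 0 j).

(* A tangent vector at [p] is given by its row of components in the chart
   [chart_at p], so that T_p M is 'rV[R]_n, and a covector at [p] by its column
   of components, so that T*_p M is 'cV[R]_n; the pairing is [v *m xi], and
   linear maps act on rows from the right, on columns (by transposition) from
   the left. *)

(* The matrix taking components at [p] in the chart [c] to components in
   [chart_at p], and its inverse; [jacobian] is transposed, that is, it acts on
   rows. *)
Definition from_chart (R : realType) (n : nat) (M : manifold R n)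
  (c : chart R n M) (p : M) : 'M[R]_n :=
  jacobian (fun x => cmap (chart_at p) (cinv c x)) (cmap c p).

Definition to_chart (R : realType) (n : nat) (M : manifold R n)
  (c : chart R n M) (p : M) : 'M[R]_n :=
  jacobian (fun x => cmap c (cinv (chart_at p) x)) (cmap (chart_at p) p).

Definition tangent_map (R : realType) (m n : nat) (M : manifold R m)
  (N : manifold R n) (f : M -> N) (p : M) : 'M[R]_(m, n) :=
  jacobian (fun x => cmap (chart_at (f p)) (f (cinv (chart_at p) x)))
           (cmap (chart_at p) p).

Definition alt_multilinear (R : realType) (V : lmodType R) (k : nat)
  (f : ('I_k -> V) -> R) : Prop :=
  (forall (v : 'I_k -> V) (i : 'I_k) (a : R) (x y : V),
     f (dfwith v i (a *: x + y)) = a * f (dfwith v i x) + f (dfwith v i y)) /\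
  (forall (v : 'I_k -> V) (i j : 'I_k), i != j -> v i = v j -> f v = 0).

(* Normalised so that
   (f /\ g) (v, w) = f v * g w - f w * g v when k = l = 1. *)
Definition wedge (R : realType) (V : lmodType R) (k l : nat)
  (f : ('I_k -> V) -> R) (g : ('I_l -> V) -> R) (v : 'I_(k + l) -> V) : R :=
  (k`!%:R * l`!%:R)^-1 *
  \sum_(s : 'S_(k + l)) (-1) ^+ s * f (fun i => v (s (lshift l i)))
                                  * g (fun j => v (s (rshift k j))).

Definition insert (R : realType) (V : lmodType R) (k : nat) (x : V)
  (f : ('I_k.+1 -> V) -> R) (v : 'I_k -> V) : R :=
  f (fun i => if unlift ord0 i is Some j then v j else x).

(* Interior product of a form by a [k]-vector [Q], the latter being seen as an
   alternating map on covectors. Since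
     Q = 1/k! \sum_I Q(e^I_1, .., e^I_k) e_I_1 /\ .. /\ e_I_k
   and i_(X_1 /\ .. /\ X_k) = i_X_1 o .. o i_X_k, the vectors are inserted in
   the form in reverse order. *)
Definition mvec_iprod (R : realType) (n k l : nat)
  (Q : ('I_k -> 'cV[R]_n) -> R) (f : ('I_(k + l) -> 'rV[R]_n) -> R)
  (v : 'I_l -> 'rV[R]_n) : R :=
  (k`!%:R)^-1 *
  \sum_(I : {ffun 'I_k -> 'I_n})
     Q (fun j => delta_mx (I j) 0) *
     f (fun i => match fintype.split i with
                 | inl j => delta_mx 0 (I (rev_ord j))
                 | inr j => v j
                 end).

(* The component of [f] with [a] arguments of type [h] and the remaining ones
   of type [g], where [h] and [g] are complementary projections. *)
Definition bicomp (R : realType) (V : lmodType R) (k : nat) (h g : V -> V)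
  (a : nat) (f : ('I_k -> V) -> R) (v : 'I_k -> V) : R :=
  \sum_(S : {set 'I_k} | #|S| == a)
     f (fun i => if i \in S then h (v i) else g (v i)).

Definition dform (R : realType) (n : nat) (M : manifold R n) (k : nat) :=
  M -> ('I_k -> 'rV[R]_n) -> R.

Definition mvec (R : realType) (n : nat) (M : manifold R n) (k : nat) :=
  M -> ('I_k -> 'cV[R]_n) -> R.

Definition form_loc (R : realType) (n : nat) (M : manifold R n) (k : nat)
  (c : chart R n M) (al : dform M k) (x : 'rV[R]_n) (v : 'I_k -> 'rV[R]_n) : R :=
  al (cinv c x) (fun i => v i *m from_chart c (cinv c x)).

Definition mvec_loc (R : realType) (n : nat) (M : manifold R n) (k : nat)
  (c : chart R n M) (Q : mvec M k) (x : 'rV[R]_n) (xi : 'I_k -> 'cV[R]_n) : R :=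
  Q (cinv c x) (fun i => to_chart c (cinv c x) *m xi i).

Definition smooth_form (R : realType) (n : nat) (M : manifold R n) (k : nat)
  (al : dform M k) : Prop :=
  (forall p, alt_multilinear (al p)) /\
  forall c, atlas c -> forall v, smooth_on (cimg c) (fun x => form_loc c al x v).

Definition smooth_mvec (R : realType) (n : nat) (M : manifold R n) (k : nat)
  (Q : mvec M k) : Prop :=
  (forall p, alt_multilinear (Q p)) /\
  forall c, atlas c -> forall xi,
    smooth_on (cimg c) (fun x => mvec_loc c Q x xi).

Definition volume_form (R : realType) (n : nat) (M : manifold R n)
  (om : dform M n) : Prop :=
  smooth_form om /\ forall p, exists v, om p v != 0.

(* The value at [p] is computed in the chart [chart_at p], with the vectors
   [v i] extended to fields that are constant in that chart. *)
Definition ext_deriv (R : realType) (n : nat) (M : manifold R n) (k : nat)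
  (al : dform M k) : dform M k.+1 := fun p v =>
  \sum_(i < k.+1) (-1) ^+ i *
    'D_(v i) (fun x => form_loc (chart_at p) al x (fun j => v (lift i j)))
             (cmap (chart_at p) p).

Definition pullback (R : realType) (m n : nat) (M : manifold R m)
  (N : manifold R n) (f : M -> N) (k : nat) (al : dform N k) : dform M k :=
  fun p v => al (f p) (fun i => v i *m tangent_map f p).

Lemma schouten_deg (a b : nat) : (a + b.+1 = b + a.+1)%N.
Proof. by rewrite !addnS addnC. Qed.

Definition mvec_partial (R : realType) (n : nat) (M : manifold R n) (k : nat)
  (l : 'I_n) (Q : mvec M k) : mvec M k := fun p xi =>
  'D_(delta_mx 0 l) (fun x => mvec_loc (chart_at p) Q x xi)
                    (cmap (chart_at p) p).

(* The Schouten bracket in local coordinates,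
     [P, Q] = \sum_l  (-1)^a i_(dx^l) P /\ d_l Q
                      - (-1)^(a b) (-1)^b i_(dx^l) Q /\ d_l P,
   which is the Lie bracket for a = b = 0 and in general satisfies
     [X_1 /\ .. /\ X_k, Y_1 /\ .. /\ Y_m]
       = \sum_(i, j) (-1)^(i + j) [X_i, Y_j] /\ X_1 /\ (omit X_i) /\ X_k
                                             /\ Y_1 /\ (omit Y_j) /\ Y_m. *)
Definition schouten (R : realType) (n : nat) (M : manifold R n) (a b : nat)
  (P : mvec M a.+1) (Q : mvec M b.+1) : mvec M (a + b.+1) := fun p xi =>
  \sum_(l < n)
    ((-1) ^+ a * wedge (insert (delta_mx l 0) (P p)) (mvec_partial l Q p) xi
     - (-1) ^+ (a * b + b) *
       wedge (insert (delta_mx l 0) (Q p)) (mvec_partial l P p)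
             (fun i => xi (cast_ord (esym (schouten_deg a b)) i))).

Definition poisson (R : realType) (n : nat) (M : manifold R n)
  (P : mvec M 2) : Prop := forall p xi, schouten P P p xi = 0.

(* Turns the value of a 1-form at a point into an element of T*_p M. *)
Definition covec (R : realType) (n : nat) (al : ('I_1 -> 'rV[R]_n) -> R)
  : 'cV[R]_n := \col_i al (fun=> delta_mx 0 i).

Definition fiber_bundle (R : realType) (m n : nat) (M : manifold R m)
  (B : manifold R n) (pi : M -> B) : Prop :=
  [/\ smooth_map pi, forall b, exists p, pi p = b &
      forall p, row_full (tangent_map pi p)].

Definition vertical (R : realType) (m n : nat) (M : manifold R m)
  (B : manifold R n) (pi : M -> B) (p : M) (v : 'rV[R]_m) : Prop :=
  v *m tangent_map pi p = 0.

(* The endomorphism of T_p M is [v |-> v *m gam p]. *)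
Definition ehresmann (R : realType) (m n : nat) (M : manifold R m)
  (B : manifold R n) (pi : M -> B) (gam : M -> 'M[R]_m) : Prop :=
  [/\ forall c, atlas c -> forall i j, smooth_on (cimg c) (fun x =>
        (from_chart c (cinv c x) *m gam (cinv c x) *m to_chart c (cinv c x)) i j),
      forall p v, vertical pi p (v *m gam p) &
      forall p v, vertical pi p v -> v *m gam p = v].

Definition horizontal (R : realType) (m : nat) (M : manifold R m)
  (gam : M -> 'M[R]_m) (p : M) (v : 'rV[R]_m) : Prop := v *m gam p = 0.

(* The component of bidegree (a, k - a). *)
Definition form_comp (R : realType) (m : nat) (M : manifold R m)
  (gam : M -> 'M[R]_m) (k a : nat) (al : dform M k) : dform M k := fun p =>
  bicomp (fun v => v *m (1%:M - gam p)) (fun v => v *m gam p) a (al p).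

Definition mvec_comp (R : realType) (m : nat) (M : manifold R m)
  (gam : M -> 'M[R]_m) (k a : nat) (Q : mvec M k) : mvec M k := fun p =>
  bicomp (fun xi => (1%:M - gam p) *m xi) (fun xi => gam p *m xi) a (Q p).

Definition form_bidegree (R : realType) (m : nat) (M : manifold R m)
  (gam : M -> 'M[R]_m) (a b : nat) (al : dform M (a + b)) : Prop :=
  forall p v, form_comp gam a al p v = al p v.

Definition mvec_bidegree (R : realType) (m : nat) (M : manifold R m)
  (gam : M -> 'M[R]_m) (a b : nat) (Q : mvec M (a + b)) : Prop :=
  forall p xi, mvec_comp gam a Q p xi = Q p xi.

(* The components of d on forms of bidegree (a, k - a). *)
Definition d10 (R : realType) (m : nat) (M : manifold R m)
  (gam : M -> 'M[R]_m) (k a : nat) (al : dform M k) : dform M k.+1 :=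
  form_comp gam a.+1 (ext_deriv al).

Definition d01 (R : realType) (m : nat) (M : manifold R m)
  (gam : M -> 'M[R]_m) (k a : nat) (al : dform M k) : dform M k.+1 :=
  form_comp gam a (ext_deriv al).

Definition d2m1 (R : realType) (m : nat) (M : manifold R m)
  (gam : M -> 'M[R]_m) (k a : nat) (al : dform M k) : dform M k.+1 :=
  form_comp gam a.+2 (ext_deriv al).

(* The horizontal lift of a tangent vector of [B] to [p]: take any preimage
   under the (surjective) tangent map of [pi], then its horizontal part. *)
Definition hor_lift (R : realType) (m n : nat) (M : manifold R m)
  (B : manifold R n) (pi : M -> B) (gam : M -> 'M[R]_m) (p : M)
  : 'M[R]_(n, m) := pinvmx (tangent_map pi p) *m (1%:M - gam p).

Definition hor (R : realType) (m n : nat) (M : manifold R m)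
  (B : manifold R n) (pi : M -> B) (gam : M -> 'M[R]_m) (k : nat)
  (Q : mvec B k) : mvec M k := fun p xi =>
  Q (pi p) (fun i => hor_lift pi gam p *m xi i).

Definition P_ (R : realType) (M : manifold R 5) (QV : mvec M 3)
  (bet : dform M 1) : mvec M 2 := fun p xi =>
  - insert (covec (bet p)) (QV p) xi.

Definition theta (R : realType) (M : manifold R 5) (gam : M -> 'M[R]_5)
  (OmV : dform M 3) (QV : mvec M 3) : dform M 1 := fun p v =>
  - @mvec_iprod R 5 3 1 (QV p) (d10 gam 0 OmV p) v.

Definition varrho (R : realType) (M : manifold R 5) (gam : M -> 'M[R]_5)
  (OmV : dform M 3) (QH : mvec M 2) : dform M 2 :=
  fun p => @mvec_iprod R 5 2 2 (QH p) (d2m1 gam 0 OmV p).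

(* Main.v *)
From HB Require Import structures.
Require Import Defs.
From mathcomp Require Import all_boot all_order all_algebra all_fingroup.
From mathcomp Require Import all_classical all_reals all_analysis.
From mathcomp Require Import ring lra.
Set Implicit Arguments.
Unset Strict Implicit.
Unset Printing Implicit Defensive.
Import Order.TTheory GRing.Theory Num.Theory.
Import numFieldNormedType.Exports.
Local Open Scope classical_set_scope.
Local Open Scope ring_scope.

(* Fix a point and a frame of its tangent space adapted to the splitting into
   horizontal and vertical vectors, and extend it by constants in the chart.
   The bigradings of beta, Omega^V, Q_V, Q_H, the identity G d(pi) = 0 and the
   normalisations of Q_V, Q_H are polynomial identities between the components
   of these fields that hold near the point; differentiating them once expresses
   the first derivatives of the bivector Pi through those of beta, kappa, gamma
   and Omega^V. The second derivatives of pi that enter are symmetric, which is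
   where integrability of the vertical bundle and closedness of Omega^H come in.
   The components of the Jacobiator are then, up to nonzero factors, those of the
   three conditions: type (0,3) gives the first, (1,2) the second and (2,1) the
   third, while (3,0) vanishes because B is a surface. *)

(** A coordinate frame can stay adapted to the splitting on a neighbourhood only if the curvature
    vanishes. The frame is therefore adapted at one point only. Being constant in the chart, it has
    no Lie brackets, so that Schouten bracket and exterior derivative are plain sums of partial
    derivatives. The price is that components excluded by bidegree vanish at the point while their
    derivatives do not: these are given by the derivative [g] of [gam]. The horizontal antisymmetric
    part of [g] is the curvature and produces varrho; its vertical trace, with the logarithmic
    derivative of Omega^V, produces theta; its entries from vertical to horizontal are minus second
    derivatives of pi and have to cancel. Since the bracket at a point depends only on the values
    and first derivatives of the components, the equivalence becomes a finite identity between
    arrays over an ordered field. The factors [s * q] and [q ^+ 2] in front of the conditions are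
    invertible because the normalisations read [f * q = -1] and [s * w = -1]. *)

(** * Differentiability from continuous partial derivatives, and symmetry of second derivatives *)

Section DifferentialCalculus.
Variable R : realType.

Lemma is_derive_line (V : normedModType R) (f : V -> R) (a v : V) (s : R) :
  derivable f (s *: v + a) v ->
  is_derive s (1 : R) (fun t : R => f (t *: v + a)) ('D_v f (s *: v + a)).
Proof.
move=> df.
have E : (fun h : R => h^-1 *: (((fun t : R => f (t *: v + a)) \o shift s) (h *: (1 : R))
            - f (s *: v + a))) =
         (fun h : R => h^-1 *: ((f \o shift (s *: v + a)) (h *: v) - f (s *: v + a))).
  by apply/funext => h /=; rewrite [h%:A]mulr1 scalerDl addrA.
by apply: DeriveDef; rewrite /derivable /derive E.
Qed.

(** The sign of [b] is free: the cases [0 <= b] and [b <= 0] of the mean value theorem are merged,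
    and of the intermediate point only the bound [|c| <= |b|] is kept, which is all the estimates
    below use. *)
Lemma MVT0 (g dg : R -> R) (b : R) :
  (forall s, `|s| <= `|b| -> is_derive s (1 : R) g (dg s)) ->
  exists2 c, `|c| <= `|b| & g b - g 0 = dg c * b.
Proof.
move=> dgP.
have cont (x y : R) : (forall s, x <= s <= y -> `|s| <= `|b|) ->
    {within `[x, y], continuous g}.
  move=> H; apply: derivable_within_continuous => s.
  by rewrite in_itv /= => /H/dgP[].
have [b0|/ltW b0] := leP 0 b.
  have H s : 0 <= s <= b -> `|s| <= `|b|.
    by case/andP=> s0 sb; rewrite !ger0_norm.
  have [|//||c] := @MVT_segment R g dg 0 b; rewrite ?b0//.
  - by move=> s /subset_itv_oo_cc; rewrite in_itv /= => /H/dgP.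
  - exact: cont.
  - by rewrite in_itv /= subr0 => /H ? ?; exists c.
have H s : b <= s <= 0 -> `|s| <= `|b|.
  by case/andP=> s0 sb; rewrite !ler0_norm// lerN2.
have [|//||c] := @MVT_segment R g dg b 0; rewrite ?b0//.
- by move=> s /subset_itv_oo_cc; rewrite in_itv /= => /H/dgP.
- exact: cont.
- rewrite in_itv /= sub0r => /H ? E; exists c => //.
  by apply: oppr_inj; rewrite opprB E mulrN.
Qed.

Lemma mx_norm_leP (m n : nat) (A : 'M[R]_(m, n)) (e : R) : 0 <= e ->
  (forall i j, `|A i j| <= e) -> `|A| <= e.
Proof.
move=> e0 H; rewrite [leLHS]/Num.Def.normr/= mx_normrE.
by apply: bigmax_le => // -[i j] _; exact: H.
Qed.

Lemma ler_mx_coord (m n : nat) (A : 'M[R]_(m, n)) i j : `|A i j| <= `|A|.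
Proof.
rewrite [leRHS]/Num.Def.normr/= mx_normrE.
exact: (@le_bigmax _ _ _ (0 : R) (fun ij : 'I_m * 'I_n => `|A ij.1 ij.2|) (i, j)).
Qed.

(* Telescoping along the coordinate directions, with the mean value theorem on
   each segment. *)
Lemma differentiable_C1 n (f : 'rV[R]_n -> R) (x : 'rV[R]_n) :
  (\forall y \near x, forall i, derivable f y (delta_mx 0 i)) ->
  (forall i, {for x, continuous (fun y => 'D_(delta_mx 0 i) f y)}) ->
  differentiable f x.
Proof.
move=> df cdf.
pose D i y := 'D_(delta_mx 0 i) f y.
pose A : 'M[R]_(n, 1) := \col_i D i x.
pose dl : 'rV[R]_n -> R := fun v => (v *m A) 0 0.
have dlE v : dl v = \sum_i v 0 i * D i x.
  by rewrite /dl mxE; apply: eq_bigr => i _; rewrite mxE.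
have dl_lin : linear dl by move=> a u v; rewrite /dl mulmxDl -scalemxAl !mxE.
pose df' : {linear 'rV[R]_n -> R} :=
  HB.pack dl (GRing.isLinear.Build R 'rV[R]_n R _ dl dl_lin).
have df'c : continuous df'.
  have -> : (df' : _ -> _) = fun v : 'rV[R]_n => \sum_i v 0 i * D i x.
    by apply/funext => v; exact: dlE.
  have -> : (fun v : 'rV[R]_n => \sum_i v 0 i * D i x) =
            \sum_i (fun v : 'rV[R]_n => v 0 i * D i x).
    by apply/funext => v; rewrite fct_sumE.
  move=> v; apply: differentiable_continuous; apply: differentiable_sum => i.
  exact: (differentiableM (differentiable_coord _ _ _) (differentiable_cst _ _)).
suff E : f \o shift x = cst (f x) + df' +o_ (0 : 'rV[R]_n) id.
  by apply/diff_locallyP; rewrite (diff_unique df'c E).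
apply/eqaddoP => _ /posnumP[e].
(* Each of the [n] coordinate steps may cost [e / (n + 1) * |h|]; taking [n + 1] covers the case
   [n = 0]. *)
have e'0 : 0 < e%:num / n.+1%:R :> R by rewrite divr_gt0.
have : \forall y \near x, forall i, derivable f y (delta_mx 0 i) /\
    `|D i x - D i y| <= e%:num / n.+1%:R.
  near=> y => i; split; move: i; near: y => //.
  by apply: filter_forall => i; exact: (cvgrPdist_le _ _).1 (cdf i) _ e'0.
case/nbhs_ballP => d /= d0 Hd.
apply/nbhs_ballP; exists d => //= h; rewrite -ball_normE /= sub0r normrN => hd.
change (`|f (h + x) - (f x + dl h)| <= e%:num * `|h|); rewrite dlE.
clear df'c df' dl_lin dlE dl A.
(* [t k] keeps the first [k] coordinates of [h]: it leads from 0 to [h], changing one coordinate at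
   a time. *)
pose t k : 'rV[R]_n := \row_i (if (i < k)%N then h 0 i else 0).
have t0 : t 0%N = 0 by apply/rowP => i; rewrite !mxE.
have tn : t n = h by apply/rowP => i; rewrite !mxE ltn_ord.
suff H k : (k <= n)%N ->
    `|f (t k + x) - (f x + \sum_(i < n | (i < k)%N) h 0 i * D i x)|
       <= k%:R * (e%:num / n.+1%:R) * `|h|.
  have := H n (leqnn n); rewrite tn (eq_bigl xpredT) => [|i]; last by rewrite ltn_ord.
  move=> /le_trans; apply.
  rewrite ler_wpM2r// mulrCA ler_piMr// ler_pdivrMr// mul1r ler_nat.
  exact: leqnSn.
elim: k => [_|k IH kn].
  rewrite t0 add0r big_pred0// addr0 subrr normr0 !mul0r//.
have {IH} := IH (ltnW kn).
pose K := Ordinal kn.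
have tS : t k.+1 = h 0 K *: delta_mx 0 K + t k.
  apply/rowP => i; rewrite !mxE ltnS /= leq_eqVlt -val_eqE /=.
  by case: ltngtP => //= ik; rewrite ?mulr0 ?mulr1 ?add0r ?addr0 ?mul0r//;
     congr (h _ _); apply: val_inj.
have -> : \sum_(i < n | (i < k.+1)%N) h 0 i * D i x =
    h 0 K * D K x + \sum_(i < n | (i < k)%N) h 0 i * D i x.
  rewrite (bigD1 K)//=; congr (_ + _); apply: eq_bigl => i.
  by rewrite ltnS -val_eqE /= leq_eqVlt; case: ltngtP.
(* The norm is the maximum of the coordinates, so the points of the segment are no farther from [x]
   than [h + x] and remain in the ball given by [Hd]. *)
have near_s s : `|s| <= `|h 0 K| -> forall i,
    derivable f (s *: delta_mx 0 K + (t k + x)) (delta_mx 0 i) /\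
    `|D i x - D i (s *: delta_mx 0 K + (t k + x))| <= e%:num / n.+1%:R.
  move=> sh; apply: Hd; rewrite -ball_normE /= addrA opprD addrCA subrr addr0 normrN.
  apply: le_lt_trans hd; apply: mx_norm_leP => // i j; rewrite ord1 !mxE eqxx /=.
  have hj := ler_mx_coord h 0 j.
  case: (eqVneq j K) => [->|jK] /=.
    by rewrite ltnn mulr1 addr0 (le_trans sh)// ler_mx_coord.
  by rewrite mulr0 add0r; case: ifP; rewrite ?normr0.
have [s sh sE] := @MVT0 (fun s : R => f (s *: delta_mx 0 K + (t k + x)))
   (fun s => D K (s *: delta_mx 0 K + (t k + x))) (h 0 K)
   (fun s sh => is_derive_line (near_s s sh K).1).
move: sE; rewrite scale0r add0r addrA -tS => sE.
have {near_s} [_ ns] := near_s s sh K.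
set a := \sum_(i < n | _) _ => IH.
have -> : f (t k.+1 + x) - (f x + (h 0 K * D K x + a)) =
   (f (t k + x) - (f x + a)) - h 0 K * (D K x - D K (s *: delta_mx 0 K + (t k + x))).
  have -> : f (t k.+1 + x) = (f (t k.+1 + x) - f (t k + x)) + f (t k + x).
    by rewrite subrK.
  by rewrite sE; ring.
rewrite (le_trans (ler_normB _ _))// -natr1 2!mulrDl mul1r lerD// normrM mulrC.
by apply: ler_pM => //; exact: ler_mx_coord.
Unshelve. all: by end_near. Qed.

Lemma deriveDv (V : normedModType R) (f : V -> R) (x u v : V) (a : R) :
  differentiable f x -> 'D_(a *: u + v) f x = a * 'D_u f x + 'D_v f x.
Proof. by move=> df; rewrite !deriveE// linearP. Qed.

(** The mean value theorem in direction [u], applied to the increment of [f] along [t *: v], yields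
    an increment of ['D_u f], which is then expanded to first order at [x]. *)
Lemma second_difference (V : normedModType R) (f : V -> R) (x u v : V) :
  (\forall y \near x, derivable f y u) ->
  differentiable ('D_u f) x ->
  (fun t : R => t^-2 * (f (t *: u + (t *: v + x)) - f (t *: v + x)
                        - f (t *: u + x) + f x)) @ 0^' --> 'D_v ('D_u f) x.
Proof.
move=> du ddu; set F := 'D_u f in ddu *.
have dE := diff_locally ddu.
rewrite deriveE//; set L := 'd F x in dE *.
apply/cvgrPdist_le => _ /posnumP[e].
(* Two remainders, each at most [e / C * |t| * (|u| + |v|)], must add up to at most [e * |t|]: hence
   the 2. The [+ 1] keeps [C] positive when [u] and [v] vanish. *)
pose C : R := 2 * (`|u| + `|v|) + 1.
have C0 : 0 < C by rewrite /C ltr_wpDl// mulr_ge0// addr_ge0.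
have /eqaddoP/(_ _ (divr_gt0 [elaborate gt0 e] C0)) := dE.
case/nbhs_ballP => r /= r0 Hr.
case/nbhs_ballP: du => r' /= r'0 Hr'.
have C10 : 0 < C + 1 by rewrite addr_gt0.
have m0 : 0 < Num.min r r' / (C + 1) by rewrite divr_gt0 // lt_min r0.
near=> t.
have t0 : t != 0 by near: t; exact: nbhs_dnbhs_neq.
have tm : `|t| < Num.min r r' / (C + 1) by near: t; exact: dnbhs0_lt.
have n0 : `|0 : R| <= `|t| by rewrite normr0.
have small s (b : R) : `|s| <= `|t| -> `|b| <= `|t| ->
    `|s *: u + b *: v| < Num.min r r' /\ `|s *: u + b *: v| <= `|t| * (`|u| + `|v|).
  move=> st bt; have H : `|s *: u + b *: v| <= `|t| * (`|u| + `|v|).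
    by rewrite (le_trans (ler_normD _ _))// !normrZ mulrDr lerD// ler_wpM2r.
  split => //; apply: (le_lt_trans H); move: tm; rewrite ltr_pdivlMr//.
  apply: le_lt_trans; rewrite ler_wpM2l// /C.
  by have := normr_ge0 u; have := normr_ge0 v; lra.
pose g s := f (s *: u + (t *: v + x)) - f (s *: u + x).
have dg s : `|s| <= `|t| ->
    is_derive s (1 : R) g (F (s *: u + (t *: v + x)) - F (s *: u + x)).
  move=> st; apply: is_deriveB; apply: is_derive_line; apply: Hr';
    rewrite -ball_normE /=.
    have [+ _] := small s t st (lexx _).
    rewrite lt_min => /andP[_]; rewrite addrA opprD addrCA subrr addr0 normrN//.
  have [+ _] := small s 0 st n0.
  by rewrite lt_min scale0r addr0 => /andP[_]; rewrite opprD addrCA subrr addr0 normrN.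
have [s st] := MVT0 dg.
rewrite /g !scale0r !add0r => gE.
have E1 : f (t *: u + (t *: v + x)) - f (t *: v + x) - f (t *: u + x) + f x =
   (F (s *: u + (t *: v + x)) - F (s *: u + x)) * t.
  by rewrite -gE; ring.
rewrite E1.
have H1 : `|F (s *: u + t *: v + x) - (F x + L (s *: u + t *: v))|
     <= e%:num / C * (`|t| * (`|u| + `|v|)).
  have [a1 a2] := small s t st (lexx _).
  have := Hr (s *: u + t *: v); rewrite -ball_normE /= sub0r normrN /=.
  move: a1; rewrite lt_min => /andP[a1 _] /(_ a1) /le_trans; apply.
  by rewrite ler_wpM2l// divr_ge0// ltW.
have H2 : `|F (s *: u + x) - (F x + L (s *: u))|
     <= e%:num / C * (`|t| * (`|u| + `|v|)).
  have [] := small s 0 st n0; rewrite scale0r addr0 => a1 a2.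
  have := Hr (s *: u); rewrite -ball_normE /= sub0r normrN /=.
  move: a1; rewrite lt_min => /andP[a1 _] /(_ a1) /le_trans; apply.
  by rewrite ler_wpM2l// divr_ge0// ltW.
have -> : L v - t^-2 * ((F (s *: u + (t *: v + x)) - F (s *: u + x)) * t) =
  t^-1 * ((F (s *: u + x) - (F x + L (s *: u))) -
    (F (s *: u + t *: v + x) - (F x + L (s *: u + t *: v)))).
  have -> : L (s *: u + t *: v) = t * L v + L (s *: u) by rewrite addrC linearP.
  by rewrite [s *: u + (t *: v + x)]addrA; field.
rewrite normrM normfV ler_pdivrMl ?normr_gt0//.
rewrite (le_trans (ler_normB _ _))// (le_trans (lerD H2 H1))//.
have -> : e%:num / C * (`|t| * (`|u| + `|v|)) + e%:num / C * (`|t| * (`|u| + `|v|))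
    = `|t| * (e%:num * (2 * (`|u| + `|v|) / C)) by field; rewrite gt_eqF.
rewrite ler_wpM2l// ler_piMr// ler_pdivrMr// mul1r /C.
by rewrite lerDl.
Unshelve. all: by end_near. Qed.

(** The second difference is symmetric in [u] and [v], and both mixed derivatives are its limit. *)
Lemma derive_comm (V : normedModType R) (f : V -> R) (x u v : V) :
  (\forall y \near x, differentiable f y) ->
  differentiable ('D_u f) x -> differentiable ('D_v f) x ->
  'D_v ('D_u f) x = 'D_u ('D_v f) x.
Proof.
move=> df du dv.
have H w : \forall y \near x, derivable f y w.
  by apply: filterS df => y; exact: diff_derivable.
have := @second_difference V f x u v (H u) du.
have -> : (fun t : R => t^-2 * (f (t *: u + (t *: v + x)) - f (t *: v + x)
                        - f (t *: u + x) + f x)) =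
   (fun t : R => t^-2 * (f (t *: v + (t *: u + x)) - f (t *: u + x)
                        - f (t *: v + x) + f x)).
  by apply/funext => t; rewrite addrCA; congr (_ * (_ + _)); rewrite addrAC.
move=> A; have B := @second_difference V f x v u (H v) dv.
exact: cvg_unique A B.
Qed.

End DifferentialCalculus.

(** * Pointwise algebra of the Jacobiator in an adapted frame *)

Definition o50 : 'I_5 := @Ordinal 5 0 isT.
Definition o51 : 'I_5 := @Ordinal 5 1 isT.
Definition o52 : 'I_5 := @Ordinal 5 2 isT.
Definition o53 : 'I_5 := @Ordinal 5 3 isT.
Definition o54 : 'I_5 := @Ordinal 5 4 isT.

Lemma ord5P (P : 'I_5 -> Prop) :
  P o50 -> P o51 -> P o52 -> P o53 -> P o54 -> forall i, P i.
Proof.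
move=> P0 P1 P2 P3 P4 [] [|[|[|[|[|//]]]]] p.
- by rewrite (_ : Ordinal p = o50)//; exact: val_inj.
- by rewrite (_ : Ordinal p = o51)//; exact: val_inj.
- by rewrite (_ : Ordinal p = o52)//; exact: val_inj.
- by rewrite (_ : Ordinal p = o53)//; exact: val_inj.
- by rewrite (_ : Ordinal p = o54)//; exact: val_inj.
Qed.

Lemma sum5 (V : nmodType) (F : 'I_5 -> V) :
  \sum_i F i = F o50 + F o51 + F o52 + F o53 + F o54.
Proof.
rewrite !big_ord_recl big_ord0 addr0 !addrA.
by congr (_ + _ + _ + _ + _); congr F; apply: val_inj.
Qed.

(* Everything below lives in a frame of T_p M whose first two vectors are
   horizontal, project to the chart basis of T_(pi p) B, and whose last three
   are vertical; [vproj_coord] and [pi_coord] are the matrices of [gam] and of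
   the tangent map of [pi] in it. The index [l] of [d..] is the direction of
   differentiation, [h] holds the second derivatives of [pi], [g] the first
   derivatives of [gam]. *)
Section JacobiatorAlgebra.
Variable (R : realFieldType).

Definition vert (i : 'I_5) : bool := (2 <= i)%N.
Definition vproj_coord (i j : 'I_5) : R := ((i == j) && vert i)%:R.
Definition pi_coord (i : 'I_5) (j : 'I_2) : R := (val i == val j)%:R.

(** The Levi-Civita symbol of the vertical indices 2, 3, 4. It vanishes as soon as one index is
    horizontal, so a multiple of it has bidegree (0,3) automatically. *)
Definition eps3 (i j k : 'I_5) : R :=
  match val i, val j, val k with
  | 2, 3, 4 | 3, 4, 2 | 4, 2, 3 => 1%R
  | 2, 4, 3 | 4, 3, 2 | 3, 2, 4 => (- 1)%R
  | _, _, _ => 0%R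
  end%N.

Lemma alt3_eps3 (f : 'I_5 -> 'I_5 -> 'I_5 -> R) :
  (forall i j k, f j i k = - f i j k) -> (forall i j k, f i k j = - f i j k) ->
  forall i j k, vert i -> vert j -> vert k ->
  f i j k = f o52 o53 o54 * eps3 i j k.
Proof.
move=> f12 f23.
have e1 i k : f i i k = 0.
  by have := f12 i i k; lra.
have e2 i k : f i k k = 0.
  by have := f23 i k k; lra.
have e3 i k : f i k i = 0 by rewrite f23 e1 oppr0.
have f132 := f23 o52 o53 o54.
have f213 := f12 o52 o53 o54.
have f231 := f23 o53 o52 o54.
have f312 := f12 o52 o54 o53.
have f321 := f12 o53 o54 o52.
by apply: ord5P => //; apply: ord5P => //; apply: ord5P => // _ _ _;
  rewrite ?(e1, e2, e3) /eps3 /= ?mulr0 ?mulr1 ?mulrN1 //; lra.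
Qed.

(** A component of the Jacobiator; [schouten_frame] identifies it with the Schouten bracket up to
    the factor -2. *)
Definition jacobi3 (P : 'I_5 -> 'I_5 -> R) (dP : 'I_5 -> 'I_5 -> 'I_5 -> R)
    (i j k : 'I_5) : R :=
  \sum_l (P l i * dP l j k + P l j * dP l k i + P l k * dP l i j).

(** The exterior derivative of a 3-form in a frame of constant fields, whose brackets vanish; the
    first index of [dO] is the direction of differentiation. *)
Definition dform4 (dO : 'I_5 -> 'I_5 -> 'I_5 -> 'I_5 -> R) (i j k l : 'I_5) : R :=
  dO i j k l - dO j i k l + dO k i j l - dO l i j k.

Variables (k0 : R) (dk : 'I_5 -> R) (b : 'I_5 -> R) (db : 'I_5 -> 'I_5 -> R)
  (g : 'I_5 -> 'I_5 -> 'I_5 -> R)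
  (O : 'I_5 -> 'I_5 -> 'I_5 -> R) (dO : 'I_5 -> 'I_5 -> 'I_5 -> 'I_5 -> R)
  (Q : 'I_5 -> 'I_5 -> 'I_5 -> R) (dQ : 'I_5 -> 'I_5 -> 'I_5 -> 'I_5 -> R)
  (H : 'I_5 -> 'I_5 -> R) (dH : 'I_5 -> 'I_5 -> 'I_5 -> R)
  (w : R) (dw : 'I_5 -> R) (h : 'I_5 -> 'I_5 -> 'I_2 -> R)
  (P : 'I_5 -> 'I_5 -> R) (dP : 'I_5 -> 'I_5 -> 'I_5 -> R).

Definition det2 (x y : 'I_2 -> R) : R := x 0 * y 1 - x 1 * y 0.

(** [bE] to [HE] are the bidegrees at the point, and [dbE] to [dHE] their Leibniz derivatives; [dDE]
    differentiates G d(pi) = 0. In [QO] and [HW] the numbers 6 and 2 are 3! and 2!, and the reversed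
    indices come from the insertion order in [mvec_iprod]. [dwE] holds because the area density is
    pulled back from [B]. *)
Hypotheses (bE : forall i, b i = \sum_m vproj_coord i m * b m)
  (OE : forall i j k, O i j k = \sum_m vproj_coord i m * O m j k)
  (QE : forall i j k, Q i j k = \sum_m vproj_coord m i * Q m j k)
  (HE : forall i j, \sum_m vproj_coord m i * H m j = 0)
  (dbE : forall l i, db l i = \sum_m (g l i m * b m + vproj_coord i m * db l m))
  (dOE : forall l i j k,
     dO l i j k = \sum_m (g l i m * O m j k + vproj_coord i m * dO l m j k))
  (dQE : forall l i j k,
     dQ l i j k = \sum_m (g l m i * Q m j k + vproj_coord m i * dQ l m j k))
  (dHE : forall l i j, \sum_m (g l m i * H m j + vproj_coord m i * dH l m j) = 0)
  (dDE : forall l i j, \sum_m (g l i m * pi_coord m j + vproj_coord i m * h l m j) = 0)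
  (hC : forall l m j, h l m j = h m l j)
  (O12 : forall i j k, O j i k = - O i j k)
  (O23 : forall i j k, O i k j = - O i j k)
  (Q12 : forall i j k, Q j i k = - Q i j k)
  (Q23 : forall i j k, Q i k j = - Q i j k)
  (H12 : forall i j, H j i = - H i j)
  (dO12 : forall l i j k, dO l j i k = - dO l i j k)
  (dO23 : forall l i j k, dO l i k j = - dO l i j k)
  (dQ12 : forall l i j k, dQ l j i k = - dQ l i j k)
  (dQ23 : forall l i j k, dQ l i k j = - dQ l i j k)
  (dH12 : forall l i j, dH l j i = - dH l i j)
  (QO : \sum_i \sum_j \sum_k Q i j k * O k j i = 6)
  (dQO : forall l,
     \sum_i \sum_j \sum_k (dQ l i j k * O k j i + Q i j k * dO l k j i) = 0)
  (HW : \sum_i \sum_j H i j * (w * det2 (pi_coord j) (pi_coord i)) = 2)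
  (dHW : forall l, \sum_i \sum_j
     (dH l i j * (w * det2 (pi_coord j) (pi_coord i)) +
      H i j * (dw l * det2 (pi_coord j) (pi_coord i) +
               w * (det2 (h l j) (pi_coord i) + det2 (pi_coord j) (h l i)))) = 0)
  (dwE : forall l, vert l -> dw l = 0)
  (PE : forall i j, P i j = - (k0 * H i j + \sum_m b m * Q m i j))
  (dPE : forall l i j, dP l i j = - (dk l * H i j + k0 * dH l i j +
     \sum_m (db l m * Q m i j + b m * dQ l m i j))).

(** The full differential of Omega^V is contracted here instead of its (1,0) part: for horizontal
    [i] the vertical [Q] picks out the same components. *)
Definition theta_coord (i : 'I_5) : R :=
  - (6^-1 * \sum_j \sum_k \sum_l Q j k l * dform4 dO l k j i).

Definition varrho_coord (a c : 'I_5) : R :=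
  2^-1 * \sum_i \sum_j H i j * dform4 dO j i a c.

Let q := Q o52 o53 o54.
Let s := H o50 o51.
Let f := O o52 o53 o54.

Lemma b_hor i : ~~ vert i -> b i = 0.
Proof.
move: i; apply: ord5P => // _; rewrite bE sum5 /vproj_coord /vert /=;
  by rewrite !mul0r !addr0.
Qed.

Lemma O_hor i j k : ~~ vert i -> O i j k = 0.
Proof.
move: i; apply: ord5P => // _; rewrite OE sum5 /vproj_coord /vert /=;
  by rewrite !mul0r !addr0.
Qed.

Lemma Q_hor i j k : ~~ vert i -> Q i j k = 0.
Proof.
move: i; apply: ord5P => // _; rewrite QE sum5 /vproj_coord /vert /=;
  by rewrite !mul0r !addr0.
Qed.

(** Antisymmetry carries a horizontal index to the first slot, where [Q_hor] applies; on vertical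
    indices one component is left. *)
Lemma Qeps i j k : Q i j k = q * eps3 i j k.
Proof.
have [vi|hi] := boolP (vert i); last first.
  by rewrite Q_hor//; move: i hi; apply: ord5P => // _; rewrite /eps3 /= mulr0.
have [vj|hj] := boolP (vert j); last first.
  rewrite Q12 Q_hor// oppr0; move: hj; move: i vi; apply: ord5P => // _;
  by move: j; apply: ord5P => // _; rewrite /eps3 /= mulr0.
have [vk|hk] := boolP (vert k); last first.
  rewrite Q23 Q12 Q_hor// !oppr0; move: hk; move: i vi; apply: ord5P => // _;
  move: j vj; apply: ord5P => // _;
  by move: k; apply: ord5P => // _; rewrite /eps3 /= mulr0.
exact: alt3_eps3.
Qed.

Lemma Oeps i j k : O i j k = f * eps3 i j k.
Proof.
have [vi|hi] := boolP (vert i); last first.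
  by rewrite O_hor//; move: i hi; apply: ord5P => // _; rewrite /eps3 /= mulr0.
have [vj|hj] := boolP (vert j); last first.
  rewrite O12 O_hor// oppr0; move: hj; move: i vi; apply: ord5P => // _;
  by move: j; apply: ord5P => // _; rewrite /eps3 /= mulr0.
have [vk|hk] := boolP (vert k); last first.
  rewrite O23 O12 O_hor// !oppr0; move: hk; move: i vi; apply: ord5P => // _;
  move: j vj; apply: ord5P => // _;
  by move: k; apply: ord5P => // _; rewrite /eps3 /= mulr0.
exact: alt3_eps3.
Qed.

Let dq l := dQ l o52 o53 o54.
Let df l := dO l o52 o53 o54.
Let ds l := dH l o50 o51.

Definition eps2 (i j : 'I_5) : R :=
  match val i, val j with
  | 0, 1 => 1%R
  | 1, 0 => (- 1)%R
  | _, _ => 0%R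
  end%N.

Lemma eps2_vert1 i j : vert i -> eps2 i j = 0.
Proof. by move: i; apply: ord5P. Qed.

Lemma eps2_vert2 i j : vert j -> eps2 i j = 0.
Proof. by move: i j; apply: ord5P => //; apply: ord5P. Qed.

(** Used below with [~~ vert i], so that the correction is present exactly for a vertical index. *)
Let cor (vi : bool) (x : R) : R := if vi then 0 else x.

(** The frame is constant but the splitting moves: a component that vanishes at the point has a
    derivative coming entirely from that of [gam]. *)
Let dQ_hor l i j k : ~~ vert i -> dQ l i j k = q * \sum_m g l m i * eps3 m j k.
Proof.
move: i; apply: ord5P => // _; rewrite dQE !sum5 !Qeps /vproj_coord /vert /=; ring.
Qed.

Let dO_hor l i j k : ~~ vert i -> dO l i j k = f * \sum_m g l i m * eps3 m j k.
Proof.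
move: i; apply: ord5P => // _; rewrite dOE !sum5 !Oeps /vproj_coord /vert /=; ring.
Qed.

Lemma eps3_12 i j k : eps3 j i k = - eps3 i j k.
Proof.
by move: i; apply: ord5P; move: j; apply: ord5P; move: k; apply: ord5P;
  rewrite /eps3 /= ?oppr0 ?opprK.
Qed.

Lemma eps3_23 i j k : eps3 i k j = - eps3 i j k.
Proof.
by move: i; apply: ord5P; move: j; apply: ord5P; move: k; apply: ord5P;
  rewrite /eps3 /= ?oppr0 ?opprK.
Qed.

Lemma eps3_diag i k : eps3 i i k = 0.
Proof. by have := eps3_12 i i k; lra. Qed.

Lemma eps3_hor1 i j k : ~~ vert i -> eps3 i j k = 0.
Proof. by move: i; apply: ord5P. Qed.

Lemma eps3_hor2 i j k : ~~ vert j -> eps3 i j k = 0.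
Proof. by move=> hj; rewrite eps3_12 eps3_hor1// oppr0. Qed.

Lemma eps3_hor3 i j k : ~~ vert k -> eps3 i j k = 0.
Proof. by move=> hk; rewrite eps3_23 eps3_hor2// oppr0. Qed.

Lemma Heps i j : H i j = s * eps2 i j.
Proof.
have H0 i' j' : vert i' -> H i' j' = 0.
  by move: (HE i' j'); move: i'; apply: ord5P => //;
    rewrite sum5 /vproj_coord /vert /= ?mul0r ?mul1r ?add0r ?addr0.
have H1 i' : H i' i' = 0 by have := H12 i' i'; lra.
have H2 i' j' : vert j' -> H i' j' = 0 by move=> vj; rewrite H12 H0// oppr0.
have E := H12 o50 o51.
by move: i; apply: ord5P; move: j; apply: ord5P;
  rewrite /eps2 /= ?mulr0 ?mulr1 ?mulrN1;
  first [exact: H0 | exact: H1 | exact: H2 | exact: E | by []].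
Qed.

(** The counterpart of [dQ_hor] for the horizontal bivector, where the vertical indices are the
    excluded ones; with two of them the right side is 0. *)
Let dHeps l i j : dH l i j = ds l * eps2 i j - s * (
   cor (~~ vert i) (\sum_m g l m i * eps2 m j) +
   cor (~~ vert j) (\sum_m g l m j * eps2 i m)).
Proof.
have dHv i' j' : vert i' -> dH l i' j' = - (s * \sum_m g l m i' * eps2 m j').
  move: (dHE l i' j'); move: i'; apply: ord5P => //;
    rewrite !sum5 !Heps /vproj_coord /vert /=; lra.
have H1 i' : dH l i' i' = 0 by have := dH12 l i' i'; lra.
have e0 := eps2_vert1; have e1 := eps2_vert2.
have e2 i' j' : eps2 j' i' = - eps2 i' j'.
  by move: i'; apply: ord5P; move: j'; apply: ord5P; rewrite /eps2 /= ?oppr0 ?opprK.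
have S0 (u : 'I_5 -> R) (e : 'I_5 -> R) : (forall m, e m = 0) -> \sum_m u m * e m = 0.
  by move=> H0; rewrite big1// => m _; rewrite H0 mulr0.
rewrite /cor; have [vi|hi] /= := boolP (vert i).
  rewrite dHv// e0// mulr0 add0r; congr (- (_ * _)); rewrite -[LHS]addr0.
  by congr (_ + _); case: ifP => //; rewrite S0// => m; rewrite e0.
have [vj|hj] /= := boolP (vert j).
  rewrite dH12 dHv// e1// mulr0 !add0r opprK -mulrN -sumrN; congr (_ * _).
  by apply: eq_bigr => m _; rewrite -mulrN -e2.
rewrite addr0 mulr0 subr0; move: i hi j hj {e0 e1 e2 S0 dHv}.
have := dH12 l o50 o51.
by move=> E; apply: ord5P => // _; apply: ord5P => // _;
  rewrite /eps2 /= ?mulr0 ?mulr1 ?mulrN1.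
Qed.

(** The minus sign is that of the reversal [k j i] of three indices. *)
Let fq : f * q = -1.
Proof. by move: QO; rewrite !sum5 !Oeps !Qeps /eps3 /=; lra. Qed.

Lemma dO_vert l i j k : vert i -> vert j -> vert k ->
  dO l i j k = df l * eps3 i j k.
Proof. exact: alt3_eps3. Qed.

Lemma dQ_vert l i j k : vert i -> vert j -> vert k ->
  dQ l i j k = dq l * eps3 i j k.
Proof. exact: alt3_eps3. Qed.

(** The derivative of [fq]. Derivatives of mixed components do not enter, being multiplied by
    components of [O] or [Q] that vanish at the point. *)
Let dfq l : df l * q + f * dq l = 0.
Proof.
have E i j k : dQ l i j k * O k j i + Q i j k * dO l k j i =
     (df l * q + f * dq l) * (eps3 i j k * eps3 k j i).
  rewrite Oeps Qeps; have [vi|hi] := boolP (vert i); last first.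
    by rewrite (@eps3_hor1 i)// (@eps3_hor3 _ _ i)//; ring.
  have [vj|hj] := boolP (vert j); last by rewrite !(@eps3_hor2 _ j)//; ring.
  have [vk|hk] := boolP (vert k); last first.
    by rewrite (@eps3_hor1 k)// (@eps3_hor3 _ _ k)//; ring.
  by rewrite dO_vert// dQ_vert//; ring.
have := dQO l.
under eq_bigr do (under eq_bigr do (under eq_bigr do rewrite E)).
rewrite !sum5 /eps3 /=; lra.
Qed.

Let sw : s * w = -1.
Proof. by move: HW; rewrite !sum5 !Heps /eps2 /det2 /pi_coord /=; lra. Qed.

(** For horizontal [i] the row of [vproj_coord] is zero, so [dDE] loses its second derivative term
    and [pi_coord] isolates [g l i j]. *)
Let g_hor l i j : ~~ vert i -> ~~ vert j -> g l i j = 0.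
Proof.
have := dDE l i ord0; have := dDE l i (lift ord0 ord0).
move: i; apply: ord5P => //; move: j; apply: ord5P => //;
rewrite !sum5 /pi_coord /vproj_coord /=; lra.
Qed.

(** For vertical [i], the derivative of G d(pi) = 0 trades the derivative of [gam] for a second
    derivative of pi. *)
Let g_h0 l i : vert i -> g l i o50 = - h l i 0.
Proof.
have := dDE l i 0.
by move: i; apply: ord5P => //; rewrite !sum5 /pi_coord /vproj_coord /=; lra.
Qed.

Let g_h1 l i : vert i -> g l i o51 = - h l i 1.
Proof.
have := dDE l i 1.
by move: i; apply: ord5P => //; rewrite !sum5 /pi_coord /vproj_coord /=; lra.
Qed.

Let P_val i j : P i j = - (k0 * s * eps2 i j +
  q * (b o52 * eps3 o52 i j + b o53 * eps3 o53 i j + b o54 * eps3 o54 i j)).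
Proof. by rewrite PE Heps sum5 !Qeps (@b_hor o50)// (@b_hor o51)//; ring. Qed.

(** With two horizontal slots the vertical trivector vanishes to second order, so [beta] does not
    appear. *)
Let dP_HH l : dP l o50 o51 = - (dk l * s + k0 * ds l).
Proof.
rewrite dPE Heps /eps2 /= big1 => [|m _]; first by rewrite /ds; ring.
rewrite Qeps (dQ12 _ o50) dQ_hor// eps3_hor2// big1 => [|n _].
  by ring.
by rewrite eps3_hor3// mulr0.
Qed.

(** Only the motion of the splitting contributes: [P] has no (1,1) part at the point, but the
    derivative of [gam] mixes horizontal and vertical components. *)
Let dP_0V l a : vert a -> dP l o50 a = k0 * s * g l o51 a +
  q * \sum_m g l m o50 * \sum_n b n * eps3 m n a.
Proof.
move=> va; rewrite dPE !Heps dHeps.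
have -> : eps2 o50 a = 0 by move: a va; apply: ord5P.
rewrite va /= !sum5 /cor !Qeps (@b_hor o50)// (@b_hor o51)// !mul0r !add0r.
rewrite (dQ12 _ o50 o52) (dQ12 _ o50 o53) (dQ12 _ o50 o54) !(@dQ_hor _ o50)// !sum5.
rewrite (eps3_12 o53 o52) (eps3_12 o54 o52) (eps3_12 o54 o53).
rewrite !eps3_diag !(@eps3_hor1 o50)// !(@eps3_hor1 o51)// !(@eps3_hor2 _ o50)// /eps2 /=.
ring.
Qed.

Let dP_1V l a : vert a -> dP l o51 a = - (k0 * s * g l o50 a) +
  q * \sum_m g l m o51 * \sum_n b n * eps3 m n a.
Proof.
move=> va; rewrite dPE !Heps dHeps.
have -> : eps2 o51 a = 0 by move: a va; apply: ord5P.
rewrite va /= !sum5 /cor !Qeps (@b_hor o50)// (@b_hor o51)// !mul0r !add0r.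
rewrite (dQ12 _ o51 o52) (dQ12 _ o51 o53) (dQ12 _ o51 o54) !(@dQ_hor _ o51)// !sum5.
rewrite (eps3_12 o53 o52) (eps3_12 o54 o52) (eps3_12 o54 o53).
rewrite !eps3_diag !(@eps3_hor1 o50)// !(@eps3_hor1 o51)// !(@eps3_hor2 _ o51)// /eps2 /=.
ring.
Qed.

Let dP_VV l a c : vert a -> vert c -> dP l a c =
  - (\sum_m (q * db l m + dq l * b m) * eps3 m a c).
Proof.
move=> va vc; rewrite dPE !Heps dHeps.
rewrite va vc /= !sum5 /cor !Qeps.
rewrite (@b_hor o50)// (@b_hor o51)// !(@eps3_hor1 o50)// !(@eps3_hor1 o51)//.
rewrite (@dQ_vert _ o52)// (@dQ_vert _ o53)// (@dQ_vert _ o54)//.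
rewrite !(@eps2_vert1 a)// !(@eps2_vert2 _ c)//.
ring.
Qed.

Let dP12 l i j : dP l j i = - dP l i j.
Proof.
rewrite !dPE H12 dH12 opprK; rewrite (eq_bigr (fun m => - (db l m * Q m i j + b m * dQ l m i j))).
  by rewrite sumrN; ring.
by move=> m _; rewrite Q23 dQ23; ring.
Qed.

Let q0 : q != 0.
Proof. by apply/eqP => q0; move: fq; rewrite q0; lra. Qed.

Let s0 : s != 0.
Proof. by apply/eqP => s0; move: sw; rewrite s0; lra. Qed.

Let fE : f = - q^-1.
Proof. by apply: (mulIf q0); rewrite fq mulNr mulVf. Qed.

Let dfE l : df l = dq l / q ^+ 2.
Proof.
apply: (mulIf q0); have /eqP := dfq l.
by rewrite fE mulNr subr_eq0 => /eqP ->; field; exact: q0.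
Qed.

Lemma sum_eps3 (X : 'I_5 -> 'I_5 -> 'I_5 -> R) :
  \sum_i \sum_j \sum_k eps3 i j k * X i j k =
  X o52 o53 o54 + X o53 o54 o52 + X o54 o52 o53
  - X o52 o54 o53 - X o54 o53 o52 - X o53 o52 o54.
Proof. by rewrite !sum5 /eps3 /=; ring. Qed.

Let sum5_eps1 (u : 'I_5 -> R) j k : \sum_m u m * eps3 m j k =
  u o52 * eps3 o52 j k + u o53 * eps3 o53 j k + u o54 * eps3 o54 j k.
Proof. by rewrite sum5 (@eps3_hor1 o50)// (@eps3_hor1 o51)//; ring. Qed.

(** Here [- dq i / q] is the logarithmic derivative of the density [f] of Omega^V, and the other
    terms are the vertical trace of the derivative of [gam]. *)
Lemma theta_coordE i : ~~ vert i -> theta_coord i = - (dq i / q + (g o52 i o52 + g o53 i o53 + g o54 i o54)).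
Proof.
move=> hi; rewrite /theta_coord.
have E j k l : Q j k l * dform4 dO l k j i = eps3 j k l * (q * dform4 dO l k j i).
  by rewrite Qeps; ring.
under eq_bigr do (under eq_bigr do (under eq_bigr do rewrite E)).
rewrite sum_eps3 /dform4.
(* Moves the horizontal index to the first slot, the one treated by [dO_hor]. *)
have dOc l a c : dO l a c i = dO l i a c by rewrite dO23 dO12 opprK.
rewrite !dOc !(@dO_hor _ i)// !(@dO_vert i)// !sum5_eps1 /eps3 /= fE dfE.
field. exact: q0.
Qed.

(** The antisymmetrised derivative of [gam] in the two horizontal directions is, up to sign, the
    curvature, here contracted with Omega^V. *)
Lemma varrho_coordE a c : vert a -> vert c -> varrho_coord a c =
  s * f * \sum_m (g o51 o50 m - g o50 o51 m) * eps3 m a c.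
Proof.
move=> va vc; rewrite /varrho_coord !sum5 !Heps /eps2 /= /dform4.
have E1 l i : ~~ vert i -> dO l i a c = f * \sum_m g l i m * eps3 m a c by exact: dO_hor.
have E2 i j : ~~ vert i -> ~~ vert j -> dO a i j c = 0.
  move=> hi hj; rewrite dO_hor// big1 ?mulr0// => m _.
  by rewrite (@eps3_hor2 _ j)// mulr0.
have E3 i j : ~~ vert i -> ~~ vert j -> dO c i j a = 0.
  move=> hi hj; rewrite dO_hor// big1 ?mulr0// => m _.
  by rewrite (@eps3_hor2 _ j)// mulr0.
rewrite !(E1 o50 o51)// !(E1 o51 o50)// !(E2 o50 o51)// !(E2 o51 o50)//.
rewrite !(E3 o50 o51)// !(E3 o51 o50)// !sum5_eps1.
by rewrite (@eps3_hor1 o50)// (@eps3_hor1 o51)//; field.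
Qed.

(** Since [w] is constant along the fibres, the vertical derivative of the normalisation leaves only
    the variation of d(pi), a trace of second derivatives. *)
Let dsE l : vert l -> ds l = - s * (h l o50 0 + h l o51 1).
Proof.
move=> vl; apply: (mulIf (x := w)); first by apply/eqP => w0; move: sw; rewrite w0; lra.
have := dHW l; rewrite dwE// !sum5 !Heps /eps2 /det2 /pi_coord /= -/(ds l).
have -> : dH l o51 o50 = - ds l by rewrite dH12.
lra.
Qed.

(** [hC] puts the vertical index first, the form in which [dsE] produces the same second
    derivatives. *)
Let g0V l m : vert m -> g l m o50 = - h m l 0.
Proof. by move=> vm; rewrite g_h0// hC. Qed.

Let g1V l m : vert m -> g l m o51 = - h m l 1.
Proof. by move=> vm; rewrite g_h1// hC. Qed.

Let bE0 := (b_hor (isT : ~~ vert o50), b_hor (isT : ~~ vert o51)).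

Let gE l :=
  (@g_hor l o50 o50 isT isT, @g_hor l o50 o51 isT isT, @g_hor l o51 o50 isT isT,
   @g_hor l o51 o51 isT isT, @g0V l o52 isT, @g0V l o53 isT, @g0V l o54 isT,
   @g1V l o52 isT, @g1V l o53 isT, @g1V l o54 isT).

(** The listed triples have [eps3 a c d = 1]. Through [dsE] the [ds] terms cancel against the second
    derivatives of pi in [dP_0V] and [dP_1V]; what remains of [g] is the antisymmetric pair of
    [varrho_coordE]. *)
Let J_HHV a c d :
  (a, c, d) \in [:: (o52, o53, o54); (o53, o54, o52); (o54, o52, o53)] ->
  jacobi3 P dP o50 o51 a =
  - (s * q * (dk c * b d - dk d * b c - k0 ^+ 2 * varrho_coord c d)).
Proof.
have Sw l a' : dP l a' o50 = - dP l o50 a' by rewrite dP12.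
have Z := (mulr0, mul0r, addr0, add0r, oppr0, mulr1, mul1r, mulrN1).
rewrite !inE => /or3P[]/eqP[-> -> ->]; rewrite varrho_coordE// fE /jacobi3;
  (under eq_bigr do rewrite Sw); rewrite sum5 !P_val /eps2 /eps3 /= !Z;
  rewrite !dP_HH ?dsE// !(dP_0V, dP_1V)// !sum5 !gE ?bE0;
  rewrite /eps3 /= !Z; field; exact: q0.
Qed.

Let db_hor l i : ~~ vert i -> db l i = \sum_m g l i m * b m.
Proof. by move: i; apply: ord5P => // _; rewrite dbE !sum5 /vproj_coord /vert /=; ring. Qed.

(** A normal form for second derivatives in two vertical directions, which lets their symmetric
    contributions cancel in [J_0VV] and [J_1VV]. *)
Let hE j :=
  (hC o53 o52 j, hC o54 o52 j, hC o54 o53 j).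

(** The horizontal bivector pairs slot 0 with direction 1, hence [o51] on the right and the opposite
    sign in [J_1VV]. The terms in [dq] and the trace of [g] combine to [theta_coord]. *)
Let J_0VV a c d :
  (a, c, d) \in [:: (o52, o53, o54); (o53, o54, o52); (o54, o52, o53)] ->
  jacobi3 P dP o50 a c =
  - (s * q * (k0 * (db o51 d - db d o51 - theta_coord o51 * b d))).
Proof.
have Sw l a' : dP l a' o50 = - dP l o50 a' by rewrite dP12.
have Z := (mulr0, mul0r, addr0, add0r, oppr0, mulr1, mul1r, mulrN1).
rewrite !inE => /or3P[]/eqP[-> -> ->]; rewrite theta_coordE// /jacobi3;
  (under eq_bigr do rewrite Sw); rewrite sum5 !P_val /eps2 /eps3 /= !Z;
  rewrite !dP_0V// !dP_VV// !(db_hor _ (isT : ~~ vert o51)) !sum5 !gE !bE0;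
  rewrite /eps3 /= !hE; field; exact: q0.
Qed.

Let J_1VV a c d :
  (a, c, d) \in [:: (o52, o53, o54); (o53, o54, o52); (o54, o52, o53)] ->
  jacobi3 P dP o51 a c =
  s * q * (k0 * (db o50 d - db d o50 - theta_coord o50 * b d)).
Proof.
have Sw l a' : dP l a' o51 = - dP l o51 a' by rewrite dP12.
have Z := (mulr0, mul0r, addr0, add0r, oppr0, mulr1, mul1r, mulrN1).
rewrite !inE => /or3P[]/eqP[-> -> ->]; rewrite theta_coordE// /jacobi3;
  (under eq_bigr do rewrite Sw); rewrite sum5 !P_val /eps2 /eps3 /= !Z;
  rewrite !dP_1V// !dP_VV// !(db_hor _ (isT : ~~ vert o50)) !sum5 !gE !bE0;
  rewrite /eps3 /= !hE; field; exact: q0.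
Qed.

(** The terms in [dq] cancel because they carry two antisymmetrised factors [b]. *)
Let J_VVV : jacobi3 P dP o52 o53 o54 =
  q ^+ 2 * ((db o52 o53 - db o53 o52) * b o54 + (db o53 o54 - db o54 o53) * b o52
          + (db o54 o52 - db o52 o54) * b o53).
Proof.
have Z := (mulr0, mul0r, addr0, add0r, oppr0, mulr1, mul1r, mulrN1).
rewrite /jacobi3 sum5 !P_val /eps2 /eps3 /= !Z.
rewrite !dP_VV// !sum5 !bE0 /eps3 /=; ring.
Qed.

Lemma jacobi3_12 i j k : jacobi3 P dP j i k = - jacobi3 P dP i j k.
Proof.
rewrite /jacobi3 -sumrN; apply: eq_bigr => l _.
by rewrite (dP12 l k i) (dP12 l k j) (dP12 l j i); ring.
Qed.

Lemma jacobi3_23 i j k : jacobi3 P dP i k j = - jacobi3 P dP i j k.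
Proof.
rewrite /jacobi3 -sumrN; apply: eq_bigr => l _.
by rewrite (dP12 l k i) (dP12 l k j) (dP12 l j i); ring.
Qed.

Lemma jacobi3_eq0 : (forall i j k, jacobi3 P dP i j k = 0) <->
  [/\ (db o52 o53 - db o53 o52) * b o54 + (db o53 o54 - db o54 o53) * b o52
          + (db o54 o52 - db o52 o54) * b o53 = 0,
      forall i a, ~~ vert i -> vert a ->
        k0 * (db i a - db a i - theta_coord i * b a) = 0 &
      forall a c, vert a -> vert c ->
        dk a * b c - dk c * b a - k0 ^+ 2 * varrho_coord a c = 0].
Proof.
have sq0 : s * q != 0 by rewrite mulf_neq0.
split=> [J0|[c1 c2 c3]].
  split.
  - apply: (@mulfI _ (q ^+ 2)); first by rewrite expf_neq0.
    by rewrite -J_VVV J0 mulr0.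
  - move=> i a; move: i a; apply: ord5P => //; apply: ord5P => // _ _;
    apply: (mulfI sq0); rewrite mulr0.
    + by rewrite -(@J_1VV o53 o54)// J0.
    + by rewrite -(@J_1VV o54 o52)// J0.
    + by rewrite -(@J_1VV o52 o53)// J0.
    + by apply: oppr_inj; rewrite -(@J_0VV o53 o54)// J0 oppr0.
    + by apply: oppr_inj; rewrite -(@J_0VV o54 o52)// J0 oppr0.
    + by apply: oppr_inj; rewrite -(@J_0VV o52 o53)// J0 oppr0.
  - have C a c d : (a, c, d) \in [:: (o52, o53, o54); (o53, o54, o52); (o54, o52, o53)] ->
        dk c * b d - dk d * b c - k0 ^+ 2 * varrho_coord c d = 0.
      move=> acd; apply: (mulfI sq0); rewrite mulr0; apply: oppr_inj.
      by rewrite -(J_HHV acd) J0 oppr0.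
    have rhoA a c : vert a -> vert c -> varrho_coord c a = - varrho_coord a c.
      move=> va vc; rewrite !varrho_coordE// -mulrN -sumrN; congr (_ * _).
      by apply: eq_bigr => m _; rewrite eps3_23 mulrN.
    have S a c : vert a -> vert c -> dk a * b c - dk c * b a - k0 ^+ 2 * varrho_coord a c = 0 ->
        dk c * b a - dk a * b c - k0 ^+ 2 * varrho_coord c a = 0.
      by move=> va vc; rewrite (rhoA a c)//; lra.
    have S0 a : vert a -> dk a * b a - dk a * b a - k0 ^+ 2 * varrho_coord a a = 0.
      by move=> va; have := rhoA a a va va => E; have -> : varrho_coord a a = 0 by [lra]; ring.
    have := C o54 o52 o53 isT; have := C o52 o53 o54 isT; have := C o53 o54 o52 isT.
    move=> e1 e2 e3; apply: ord5P => //; apply: ord5P => // _ _;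
    by [exact: S0 | exact: e1 | exact: e2 | exact: e3 | exact: S].
have Z a c d : (a, c, d) \in [:: (o52, o53, o54); (o53, o54, o52); (o54, o52, o53)] ->
    [/\ jacobi3 P dP o50 o51 a = 0, jacobi3 P dP o50 a c = 0 & jacobi3 P dP o51 a c = 0].
  move=> acd; have [va vc vd] : [/\ vert a, vert c & vert d].
    by move: acd; rewrite !inE => /or3P[]/eqP[-> -> ->].
  by rewrite (J_HHV acd) (J_0VV acd) (J_1VV acd) c3// !c2// !mulr0 oppr0.
have [a1 a2 a3] := Z o52 o53 o54 isT.
have [b1 b2 b3] := Z o53 o54 o52 isT.
have [d1 d2 d3] := Z o54 o52 o53 isT.
have vvv : jacobi3 P dP o52 o53 o54 = 0 by rewrite J_VVV c1 mulr0.
have D1 i k : jacobi3 P dP i i k = 0 by have := jacobi3_12 i i k; lra.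
have D2 i k : jacobi3 P dP i k k = 0 by have := jacobi3_23 i k k; lra.
have D3 i k : jacobi3 P dP i k i = 0 by rewrite jacobi3_23 D1 oppr0.
(* The ten components with distinct indices, up to order, are known to vanish; [T] spreads this to
   all orderings. *)
have T i j k : jacobi3 P dP i j k = 0 ->
  [/\ jacobi3 P dP j i k = 0, jacobi3 P dP i k j = 0, jacobi3 P dP j k i = 0,
      jacobi3 P dP k i j = 0 & jacobi3 P dP k j i = 0].
  move=> E; have e1 : jacobi3 P dP j i k = 0 by rewrite jacobi3_12 E oppr0.
  have e2 : jacobi3 P dP i k j = 0 by rewrite jacobi3_23 E oppr0.
  have e3 : jacobi3 P dP j k i = 0 by rewrite jacobi3_23 e1 oppr0.
  have e4 : jacobi3 P dP k i j = 0 by rewrite jacobi3_12 e2 oppr0.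
  by split=> //; rewrite jacobi3_12 e3 oppr0.
have [? ? ? ? ?] := T _ _ _ a1; have [? ? ? ? ?] := T _ _ _ a2.
have [? ? ? ? ?] := T _ _ _ a3; have [? ? ? ? ?] := T _ _ _ b1.
have [? ? ? ? ?] := T _ _ _ b2; have [? ? ? ? ?] := T _ _ _ b3.
have [? ? ? ? ?] := T _ _ _ d1; have [? ? ? ? ?] := T _ _ _ d2.
have [? ? ? ? ?] := T _ _ _ d3; have [? ? ? ? ?] := T _ _ _ vvv.
by do 3 (apply: ord5P) => //; first [exact: D1 | exact: D2 | exact: D3].
Qed.
End JacobiatorAlgebra.

(** * Multilinear maps, wedge and interior products on explicit lists of arguments *)

Section Multilinear.
Variable R : realType.

Definition multilinear (V : lmodType R) (k : nat) (f : ('I_k -> V) -> R) : Prop :=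
  forall (v : 'I_k -> V) (i : 'I_k) (a : R) (x y : V),
    f (dfwith v i (a *: x + y)) = a * f (dfwith v i x) + f (dfwith v i y).

(** Argument families as lists, read as 0 past the end; this default is compatible with maps that
    preserve 0. *)
Definition tup (V : nmodType) (k : nat) (s : seq V) : 'I_k -> V := fun i => s`_i.

Lemma dfwithE (V : Type) (k : nat) (v : 'I_k -> V) (i : 'I_k) (x : V) j :
  dfwith v i x j = if j == i then x else v j.
Proof.
have [->|ji] := eqVneq j i; first by rewrite dfwithin.
by rewrite dfwithout// eq_sym.
Qed.

Lemma dfwith_id (V : Type) (k : nat) (v : 'I_k -> V) (i : 'I_k) :
  dfwith v i (v i) = v.
Proof. by apply/funext => j; rewrite dfwithE; case: eqP => // ->. Qed.

Section Basic.
Variables (V : lmodType R) (k : nat).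
Implicit Types (f g : ('I_k -> V) -> R) (v : 'I_k -> V).

Lemma multilinear0 f v i : multilinear f -> v i = 0 -> f v = 0.
Proof.
move=> fl vi; have := fl v i (-1) 0 0.
by rewrite scaler0 addr0 -vi dfwith_id mulN1r addNr.
Qed.

Lemma multilinear_lincomb f v i n (c : 'I_n -> R) (x : 'I_n -> V) : multilinear f ->
  f (dfwith v i (\sum_m c m *: x m)) = \sum_m c m * f (dfwith v i (x m)).
Proof.
move=> fl; elim/big_rec2: _ => [|m y1 y2 _ IH].
  by apply: (@multilinear0 _ _ i) => //; rewrite dfwithin.
by rewrite fl IH.
Qed.

Lemma multilinearZ c f : multilinear f -> multilinear (fun v => c * f v).
Proof. by move=> fl v i a x y; rewrite fl mulrDr mulrCA. Qed.

Lemma multilinearB f g : multilinear f -> multilinear g -> multilinear (fun v => f v - g v).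
Proof.
by move=> fl gl v i a x y; rewrite fl gl mulrBr opprD addrACA.
Qed.

Lemma multilinear_sum (I : Type) (r : seq I) (P : pred I) (F : I -> ('I_k -> V) -> R) :
  (forall i, P i -> multilinear (F i)) -> multilinear (fun v => \sum_(i <- r | P i) F i v).
Proof.
move=> Fl v i a x y; rewrite mulr_sumr -big_split; apply: eq_bigr => j Pj.
exact: Fl.
Qed.

Lemma multilinear_frame f n (e : 'I_n -> V) : multilinear f ->
  (forall u, exists c, u = \sum_m c m *: e m) ->
  (forall I : 'I_k -> 'I_n, f (fun j => e (I j)) = 0) -> forall v, f v = 0.
Proof.
move=> fl span f0.
(* Induction on the number [m] of leading slots that may still hold arbitrary vectors; each step
   expands the last of them in the frame. *)
suff H m v : (m <= k)%N -> (forall j : 'I_k, (m <= j)%N -> exists i, v j = e i) -> f v = 0.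
  by move=> v; apply: (H k) => // j; rewrite leqNgt ltn_ord.
elim: m v => [v _ vE|m IH v mk vE].
  have /choice[I IE] : forall j : 'I_k, exists i, v j = e i by move=> j; exact: vE.
  by rewrite (_ : v = fun j => e (I j)) ?f0//; apply/funext.
pose j0 := Ordinal mk; have [c cE] := span (v j0).
rewrite -(dfwith_id v j0) cE multilinear_lincomb// big1// => i _.
rewrite IH ?mulr0//; first exact: ltnW.
move=> j mj; rewrite dfwithE; case: eqVneq => [_|jj0]; first by exists i.
by apply: vE; rewrite ltn_neqAle mj andbT eq_sym.
Qed.

Lemma multilinear_comp (W : lmodType R) f (h : 'I_k -> W -> V) :
  multilinear f -> (forall j, linear (h j)) ->
  multilinear (fun v : 'I_k -> W => f (fun j => h j (v j))).
Proof.
move=> fl hl v i a x y.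
have E z : (fun j => h j (dfwith v i z j)) = dfwith (fun j => h j (v j)) i (h i z).
  by apply/funext => j; rewrite !dfwithE; case: eqP => // ->.
by rewrite !E hl fl.
Qed.

Lemma multilinear_bicomp (h g : V -> V) a f : linear h -> linear g -> multilinear f ->
  multilinear (bicomp h g a f).
Proof.
move=> hl gl fl; apply: multilinear_sum => S _.
have := @multilinear_comp _ f (fun j => if j \in S then h else g) fl.
move=> H; have -> : (fun v : 'I_k -> V => f (fun i => if i \in S then h (v i) else g (v i)))
  = (fun v => f (fun j => (if j \in S then h else g) (v j))).
  by apply/funext => v; congr f; apply/funext => j; case: ifP.
by apply: H => j; case: ifP.
Qed.

(** A set [S] other than [A] applies the wrong projection in some slot and puts a zero there, so
    only the summand [S = A] survives. *)
Lemma bicomp_pure (h g : V -> V) a f v (A : {set 'I_k}) : multilinear f ->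
  (forall i, i \in A -> h (v i) = v i /\ g (v i) = 0) ->
  (forall i, i \notin A -> h (v i) = 0 /\ g (v i) = v i) ->
  bicomp h g a f v = if #|A| == a then f v else 0.
Proof.
move=> fl hA gA; rewrite /bicomp.
have E (S : {set 'I_k}) :
    f (fun i => if i \in S then h (v i) else g (v i)) = if S == A then f v else 0.
  case: eqP => [->|/eqP SA].
    congr f; apply/funext => i; case: ifP => iA; first by case: (hA i iA).
    by case: (gA i (negbT iA)).
  have [i iSA] : exists i, (i \in S) != (i \in A).
    apply: contrapT => H; move/eqP: SA; apply; apply/setP => i; apply/eqP.
    by apply: contrapT => /negP iSA; apply: H; exists i.
  apply: (@multilinear0 _ _ i) => //; move: iSA.
  case: ifP => iS; case: (boolP (i \in A)) => iA //= _.
    by case: (gA i iA).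
  by case: (hA i iA).
under eq_bigr do rewrite E.
rewrite -big_mkcondr /=; case: ifP => cA.
  by rewrite (big_pred1 A)// => S; rewrite andbC /=; case: eqP => //= ->.
by rewrite big_pred0// => S; apply/negP => /andP[/eqP cS /eqP SA]; rewrite -cS SA eqxx in cA.
Qed.

End Basic.

(** Changing slot [i] changes one reindexed slot if [i] is in the image of [phi], and none
    otherwise. *)
Lemma multilinear_reindex (V : lmodType R) (m n : nat)
    (phi : 'I_m -> 'I_n) (v : 'I_n -> V) (i : 'I_n) : injective phi ->
  (exists2 j, phi j = i & forall x,
     (fun j => dfwith v i x (phi j)) = dfwith (v \o phi) j x) \/
  (forall j, phi j != i) /\ (forall x, (fun j => dfwith v i x (phi j)) = v \o phi).
Proof.
move=> phii; have [[j ji]|nj] := pselect (exists j, phi j = i).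
  left; exists j => // x; apply/funext => j'; rewrite !dfwithE /= -ji.
  by rewrite (inj_eq phii).
have nj' j : phi j != i by apply/eqP => ji; apply: nj; exists j.
by right; split=> // x; apply/funext => j; rewrite dfwithE (negPf (nj' j)).
Qed.

Lemma multilinear_wedge (V : lmodType R) k l (f : ('I_k -> V) -> R) (g : ('I_l -> V) -> R) :
  multilinear f -> multilinear g -> multilinear (wedge f g).
Proof.
move=> fl gl; apply: multilinearZ; apply: multilinear_sum => s _ v i a x y /=.
pose phi := fun j => s (lshift l j); pose psi := fun j => s (rshift k j).
have phii : injective phi by move=> j j' /perm_inj/lshift_inj.
have psii : injective psi by move=> j j' /perm_inj/rshift_inj.
(* Each permutation sends the varied slot to exactly one of the two factors; the product is linear
   through that factor while the other is constant. *)
have bilin_aux (F G : V -> R) (c : R) :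
    (F (a *: x + y) = a * F x + F y /\ G (a *: x + y) = G y /\ G x = G y) \/
    (G (a *: x + y) = a * G x + G y /\ F (a *: x + y) = F y /\ F x = F y) ->
    c * F (a *: x + y) * G (a *: x + y) = a * (c * F x * G x) + c * F y * G y.
  by move=> [[-> [-> ->]]|[-> [-> ->]]]; ring.
have dis j j' : phi j != psi j'.
  by apply/negP => /eqP/perm_inj/eqP; rewrite eq_lrshift.
have [[j ji jE]|[nj njE]] := multilinear_reindex v i phii.
  have [[j' ji' _]|[_ nj'E]] := multilinear_reindex v i psii.
    by move: (dis j j'); rewrite ji ji' eqxx.
  have E1 z : f (fun j => dfwith v i z (s (lshift l j))) = f (dfwith (v \o phi) j z).
    by rewrite -(jE z).
  have E2 z : g (fun j => dfwith v i z (s (rshift k j))) = g (v \o psi).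
    by rewrite -(nj'E z).
  apply: (@bilin_aux (fun z => f (fun j => dfwith v i z (s (lshift l j))))
    (fun z => g (fun j => dfwith v i z (s (rshift k j))))); left.
  split; last by split; exact: etrans (E2 _) (esym (E2 _)).
  exact: etrans (E1 _) (etrans (fl _ _ _ _ _)
    (congr2 (fun p q => a * p + q) (esym (E1 x)) (esym (E1 y)))).
have [[j' ji' jE]|[nj' _]] := multilinear_reindex v i psii.
  have E1 z : f (fun j => dfwith v i z (s (lshift l j))) = f (v \o phi).
    by rewrite -(njE z).
  have E2 z : g (fun j => dfwith v i z (s (rshift k j))) = g (dfwith (v \o psi) j' z).
    by rewrite -(jE z).
  apply: (@bilin_aux (fun z => f (fun j => dfwith v i z (s (lshift l j))))
    (fun z => g (fun j => dfwith v i z (s (rshift k j))))); right.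
  split; last by split; exact: etrans (E1 _) (esym (E1 _)).
  exact: etrans (E2 _) (etrans (gl _ _ _ _ _)
    (congr2 (fun p q => a * p + q) (esym (E2 x)) (esym (E2 y)))).
have si j : s^-1%g i = j -> s j = i by move=> <-; rewrite permKV.
case: (split_ordP (s^-1%g i)) => j /si ji.
  by have := nj j; rewrite /phi ji eqxx.
by have := nj' j; rewrite /psi ji eqxx.
Qed.

Definition i20 : 'I_2 := @Ordinal 2 0 isT.
Definition i21 : 'I_2 := @Ordinal 2 1 isT.
Definition i30 : 'I_3 := @Ordinal 3 0 isT.
Definition i31 : 'I_3 := @Ordinal 3 1 isT.
Definition i32 : 'I_3 := @Ordinal 3 2 isT.

(** A duplicate-free list of the right length exhausts the type; this expands sums over
    permutations. *)
Lemma sum_uniq_list (V : nmodType) (T : finType) (L : seq T) (F : T -> V) :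
  uniq L -> size L = #|T| -> \sum_x F x = \sum_(x <- L) F x.
Proof.
move=> uL sL; apply: perm_big; apply: uniq_perm => //; first exact: index_enum_uniq.
have [|_ E] := @uniq_min_size _ L (index_enum T) uL (fun x _ => mem_index_enum x).
  by rewrite sL cardT enumT.
by move=> x; rewrite E.
Qed.

Lemma sum_S2 (V : nmodType) (F : 'S_2 -> V) :
  \sum_s F s = F 1%g + F (tperm i20 i21).
Proof.
rewrite (@sum_uniq_list _ _ [:: 1%g; tperm i20 i21]).
- by rewrite !big_cons big_nil addr0.
- apply: (@map_uniq _ _ (fun s : 'S_2 => s i20)).
  by rewrite /= perm1 tpermL.
- by rewrite card_Sn.
Qed.

Lemma sum_S3 (V : nmodType) (F : 'S_3 -> V) :
  \sum_s F s = F 1%g + F (tperm i30 i31) + F (tperm i31 i32) + F (tperm i30 i32)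
   + F (tperm i30 i31 * tperm i31 i32)%g + F (tperm i31 i32 * tperm i30 i31)%g.
Proof.
rewrite (@sum_uniq_list _ _ [:: 1; tperm i30 i31; tperm i31 i32; tperm i30 i32;
   tperm i30 i31 * tperm i31 i32; tperm i31 i32 * tperm i30 i31]%g).
- by rewrite !big_cons big_nil addr0 !addrA.
(* The six permutations are told apart by their values on the first two points. *)
- apply: (@map_uniq _ _ (fun s : 'S_3 => (s i30, s i31))).
  by rewrite /= !permM !perm1 !permE.
- by rewrite card_Sn.
Qed.

Lemma wedge11 (V : lmodType R) (f g : ('I_1 -> V) -> R) (v : 'I_(1 + 1) -> V) :
  wedge f g v = f (fun=> v i20) * g (fun=> v i21) - f (fun=> v i21) * g (fun=> v i20).
Proof.
rewrite /wedge !mul1r invr1 mul1r sum_S2 odd_perm1 odd_tperm /=.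
have E (s : 'S_2) a c : s i20 = a -> s i21 = c ->
    (fun i : 'I_1 => v (s (lshift 1 i))) = (fun=> v a) /\
    (fun i : 'I_1 => v (s (rshift 1 i))) = (fun=> v c).
  move=> sa sc; split; apply/funext => i; rewrite ord1.
    by rewrite -sa; congr (v (s _)); apply: val_inj.
  by rewrite -sc; congr (v (s _)); apply: val_inj.
have [-> ->] := E 1%g i20 i21 (perm1 _) (perm1 _).
have [-> ->] := E (tperm i20 i21) i21 i20 (tpermL _ _) (tpermR _ _).
by rewrite expr0 expr1; ring.
Qed.

(** Permutations that differ by a swap inside the second factor contribute equally by [galt], which
    absorbs the factor 1/2! of [wedge]. *)
Lemma wedge12 (V : lmodType R) (f : ('I_1 -> V) -> R) (g : ('I_2 -> V) -> R)
    (v : 'I_(1 + 2) -> V) : (forall x y, g (tup [:: y; x]) = - g (tup [:: x; y])) ->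
  wedge f g v =
    f (tup [:: v i30]) * g (tup [:: v i31; v i32]) +
    f (tup [:: v i31]) * g (tup [:: v i32; v i30]) +
    f (tup [:: v i32]) * g (tup [:: v i30; v i31]).
Proof.
move=> galt; rewrite /wedge sum_S3 !odd_permM odd_perm1 !odd_tperm /=.
have E (s : 'S_3) a c d : s i30 = a -> s i31 = c -> s i32 = d ->
    (fun i : 'I_1 => v (s (lshift 2 i))) = tup [:: v a] /\
    (fun i : 'I_2 => v (s (rshift 1 i))) = tup [:: v c; v d].
  move=> sa sc sd; split; apply/funext => i.
    by rewrite ord1 /tup /= -sa; congr (v (s _)); apply: val_inj.
  case: i => [[|[|//]]] p; rewrite /tup /=.
    by rewrite -sc; congr (v (s _)); apply: val_inj.
  by rewrite -sd; congr (v (s _)); apply: val_inj.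
have [-> ->] := E 1%g i30 i31 i32 (perm1 _) (perm1 _) (perm1 _).
have [|||-> ->] := E (tperm i30 i31) i31 i30 i32; rewrite ?permE//.
have [|||-> ->] := E (tperm i31 i32) i30 i32 i31; rewrite ?permE//.
have [|||-> ->] := E (tperm i30 i32) i32 i31 i30; rewrite ?permE//.
have [|||-> ->] := E (tperm i30 i31 * tperm i31 i32)%g i32 i30 i31; rewrite ?permM ?permE//.
have [|||-> ->] := E (tperm i31 i32 * tperm i30 i31)%g i31 i32 i30; rewrite ?permM ?permE//.
rewrite (galt (v i31) (v i32)) (galt (v i30) (v i31)) (galt (v i32) (v i30)).
rewrite (_ : 1`!%:R * 2`!%:R = 2%:R :> R); last by rewrite mul1r.
by rewrite !expr0 !expr1; field.
Qed.

Lemma wedge21 (V : lmodType R) (f : ('I_2 -> V) -> R) (g : ('I_1 -> V) -> R)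
    (v : 'I_(2 + 1) -> V) : (forall x y, f (tup [:: y; x]) = - f (tup [:: x; y])) ->
  wedge f g v =
    f (tup [:: v i31; v i32]) * g (tup [:: v i30]) +
    f (tup [:: v i32; v i30]) * g (tup [:: v i31]) +
    f (tup [:: v i30; v i31]) * g (tup [:: v i32]).
Proof.
move=> falt; rewrite /wedge sum_S3 !odd_permM odd_perm1 !odd_tperm /=.
have E (s : 'S_3) a c d : s i30 = a -> s i31 = c -> s i32 = d ->
    (fun i : 'I_2 => v (s (lshift 1 i))) = tup [:: v a; v c] /\
    (fun i : 'I_1 => v (s (rshift 2 i))) = tup [:: v d].
  move=> sa sc sd; split; apply/funext => i; last first.
    by rewrite ord1 /tup /= -sd; congr (v (s _)); apply: val_inj.
  case: i => [[|[|//]]] p; rewrite /tup /=.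
    by rewrite -sa; congr (v (s _)); apply: val_inj.
  by rewrite -sc; congr (v (s _)); apply: val_inj.
have [-> ->] := E 1%g i30 i31 i32 (perm1 _) (perm1 _) (perm1 _).
have [|||-> ->] := E (tperm i30 i31) i31 i30 i32; rewrite ?permE//.
have [|||-> ->] := E (tperm i31 i32) i30 i32 i31; rewrite ?permE//.
have [|||-> ->] := E (tperm i30 i32) i32 i31 i30; rewrite ?permE//.
have [|||-> ->] := E (tperm i30 i31 * tperm i31 i32)%g i32 i30 i31; rewrite ?permM ?permE//.
have [|||-> ->] := E (tperm i31 i32 * tperm i30 i31)%g i31 i32 i30; rewrite ?permM ?permE//.
rewrite (falt (v i31) (v i32)) (falt (v i30) (v i31)) (falt (v i32) (v i30)).
rewrite (_ : 2`!%:R * 1`!%:R = 2%:R :> R); last by rewrite mulr1.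
by rewrite !expr0 !expr1; field.
Qed.

Definition linear_form (V : lmodType R) (phi : V -> R) : Prop :=
  forall a x y, phi (a *: x + y) = a * phi x + phi y.

Lemma linear_form_sum (V : lmodType R) (phi : V -> R) n (c : 'I_n -> R) (x : 'I_n -> V) :
  linear_form phi -> phi (\sum_m c m *: x m) = \sum_m c m * phi (x m).
Proof.
move=> pl; elim/big_rec2: _ => [|m y1 y2 _ IH]; last by rewrite pl IH.
by have := pl (-1) 0 0; rewrite scaler0 addr0 mulN1r addNr.
Qed.

(** The entry of [s] at position [i] is a placeholder: uses pass [0] there, or a list that ends just
    before it. *)
Lemma slot_tup (V : lmodType R) k (f : ('I_k -> V) -> R) (s : seq V) (i : 'I_k) :
  multilinear f -> linear_form (fun x => f (tup (set_nth 0 s i x))).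
Proof.
move=> fl a x y.
have E z : tup (set_nth 0 s i z) = dfwith (tup s) i z :> ('I_k -> V).
  by apply/funext => j; rewrite /tup nth_set_nth /= dfwithE.
by rewrite !E fl.
Qed.

Lemma trace_mx m n (A : 'M[R]_(m, n)) (phi : 'cV[R]_m -> R) (psi : 'rV[R]_n -> R) :
  linear_form phi -> linear_form psi ->
  \sum_i phi (delta_mx i 0) * psi (row i A) =
  \sum_a phi (col a A) * psi (delta_mx 0 a).
Proof.
move=> pl ql.
have rE i : row i A = \sum_a A i a *: delta_mx 0 a.
  by rewrite [LHS]row_sum_delta; apply: eq_bigr => a _; rewrite mxE.
have cE a : col a A = \sum_i A i a *: delta_mx i 0.
  rewrite [LHS]matrix_sum_delta; apply: eq_bigr => i _.
  by rewrite big_ord1 mxE.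
under eq_bigr do rewrite rE linear_form_sum// mulr_sumr.
rewrite exchange_big /=; apply: eq_bigr => a _.
rewrite cE linear_form_sum// mulr_suml; apply: eq_bigr => i _.
by rewrite mulrCA mulrA.
Qed.

(** A contraction may be computed in any pair of dual bases, such as the rows of [E] and the columns
    of its inverse. *)
Lemma trace_frame n (E E' : 'M[R]_n) (phi : 'cV[R]_n -> R) (psi : 'rV[R]_n -> R) :
  E' *m E = 1%:M -> linear_form phi -> linear_form psi ->
  \sum_i phi (delta_mx i 0) * psi (delta_mx 0 i) =
  \sum_a phi (col a E') * psi (row a E).
Proof.
move=> EE pl ql.
have ql' : linear_form (fun u => psi (u *m E)).
  by move=> a x y; rewrite mulmxDl -scalemxAl ql.
transitivity (\sum_i phi (delta_mx i 0) * psi (row i E' *m E)).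
  by apply: eq_bigr => i _; rewrite -row_mul EE row1.
rewrite (trace_mx E' pl ql'); apply: eq_bigr => a _.
by rewrite [row a E]rowE.
Qed.

Lemma sum_ffun2 (T : finType) (F : ('I_2 -> T) -> R) :
  \sum_(I : {ffun 'I_2 -> T}) F I =
  \sum_i \sum_j F (fun k => if val k == 0%N then i else j).
Proof.
rewrite pair_big /=.
rewrite (reindex (fun p : T * T => [ffun k : 'I_2 => if val k == 0%N then p.1 else p.2])) /=.
  by apply: eq_bigr => -[i j] _ /=; congr F; apply/funext => k; rewrite ffunE.
exists (fun I : {ffun 'I_2 -> T} => (I i20, I i21)) => [[i j] _|I _] /=.
  by rewrite !ffunE.
apply/ffunP => -[[|[|//]]] p; rewrite ffunE /=; congr (I _); exact: val_inj.
Qed.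

Lemma sum_ffun3 (T : finType) (F : ('I_3 -> T) -> R) :
  \sum_(I : {ffun 'I_3 -> T}) F I =
  \sum_i \sum_j \sum_l
    F (fun k => if val k == 0%N then i else if val k == 1%N then j else l).
Proof.
under [RHS]eq_bigr do rewrite pair_big /=.
rewrite pair_big /=.
rewrite (reindex (fun p : T * (T * T) => [ffun k : 'I_3 =>
  if val k == 0%N then p.1 else if val k == 1%N then p.2.1 else p.2.2])) /=.
  by apply: eq_bigr => -[i [j l]] _ /=; congr F; apply/funext => k; rewrite ffunE.
exists (fun I : {ffun 'I_3 -> T} => (I i30, (I i31, I i32))) => [[i [j l]] _|I _] /=.
  by rewrite !ffunE.
apply/ffunP => -[[|[|[|//]]]] p; rewrite ffunE /=; congr (I _); exact: val_inj.
Qed.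

Lemma tup_cat (V : nmodType) k l (s1 s2 : seq V) : size s1 = k ->
  (fun i : 'I_(k + l) => match fintype.split i with
     | inl j => tup s1 j | inr j => tup s2 j end) = tup (s1 ++ s2).
Proof.
move=> s1k; apply/funext => i; rewrite /tup nth_cat s1k.
by case: splitP => j ->; rewrite ?addKn.
Qed.

Lemma iprod2E n l (Q : ('I_2 -> 'cV[R]_n) -> R) (f : ('I_(2 + l) -> 'rV[R]_n) -> R) s :
  mvec_iprod Q f (tup s) = 2^-1 * \sum_i \sum_j
    Q (tup [:: delta_mx i 0; delta_mx j 0]) *
    f (tup [:: delta_mx 0 j, delta_mx 0 i & s]).
Proof.
rewrite /mvec_iprod.
rewrite (@sum_ffun2 _ (fun I => Q (fun j => delta_mx (I j) 0) *
     f (fun i => match fintype.split i with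
                 | inl j => delta_mx 0 (I (rev_ord j))
                 | inr j => tup s j
                 end))).
congr (_ * _); apply: eq_bigr => i _; apply: eq_bigr => j _.
congr (Q _ * f _); first by apply/funext => -[[|[|//]]].
rewrite -(tup_cat (s1 := [:: delta_mx 0 j; delta_mx 0 i]) l s)//.
by apply/funext => k; case: fintype.split => // -[[|[|//]]].
Qed.

Lemma iprod3E n l (Q : ('I_3 -> 'cV[R]_n) -> R) (f : ('I_(3 + l) -> 'rV[R]_n) -> R) s :
  mvec_iprod Q f (tup s) = 6^-1 * \sum_i \sum_j \sum_k
    Q (tup [:: delta_mx i 0; delta_mx j 0; delta_mx k 0]) *
    f (tup [:: delta_mx 0 k, delta_mx 0 j, delta_mx 0 i & s]).
Proof.
rewrite /mvec_iprod.
rewrite (@sum_ffun3 _ (fun I => Q (fun j => delta_mx (I j) 0) *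
     f (fun i => match fintype.split i with
                 | inl j => delta_mx 0 (I (rev_ord j))
                 | inr j => tup s j
                 end))).
congr (_ * _); apply: eq_bigr => i _; apply: eq_bigr => j _; apply: eq_bigr => k _.
congr (Q _ * f _); first by apply/funext => -[[|[|[|//]]]].
rewrite -(tup_cat (s1 := [:: delta_mx 0 k; delta_mx 0 j; delta_mx 0 i]) l s)//.
by apply/funext => m; case: fintype.split => // -[[|[|[|//]]]].
Qed.

Lemma multilinear_iprod n k l (Q : ('I_k -> 'cV[R]_n) -> R) (f : ('I_(k + l) -> 'rV[R]_n) -> R) :
  multilinear f -> multilinear (mvec_iprod Q f).
Proof.
move=> fl; apply: multilinearZ; apply: multilinear_sum => I _; apply: multilinearZ => v i a x y.
have E z : (fun s => match fintype.split s with
       | inl j => delta_mx 0 (I (rev_ord j)) | inr j => dfwith v i z j end) =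
   dfwith (fun s => match fintype.split s with
       | inl j => delta_mx 0 (I (rev_ord j)) | inr j => v j end) (rshift k i) z.
  apply/funext => s; rewrite dfwithE; case: splitP => j sj.
    by case: eqP => // E; move: (ltn_ord j); rewrite -sj E /= ltnNge leq_addr.
  rewrite dfwithE -!val_eqE /= sj eqn_add2l.
  by case: eqP => // _.
by rewrite !E fl.
Qed.

(** [trace_frame] replaces one contracted pair of slots at a time. *)
Lemma iprod2_frame n l (E E' : 'M[R]_n) (Q : ('I_2 -> 'cV[R]_n) -> R)
    (f : ('I_(2 + l) -> 'rV[R]_n) -> R) s :
  E' *m E = 1%:M -> multilinear Q -> multilinear f ->
  mvec_iprod Q f (tup s) = 2^-1 * \sum_i \sum_j
    Q (tup [:: col i E'; col j E']) * f (tup [:: row j E, row i E & s]).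
Proof.
move=> EE Ql fl; rewrite iprod2E; congr (_ * _).
have T1 i : \sum_j Q (tup [:: delta_mx i 0; delta_mx j 0]) *
    f (tup [:: delta_mx 0 j, delta_mx 0 i & s]) =
  \sum_j Q (tup [:: delta_mx i 0; col j E']) * f (tup [:: row j E, delta_mx 0 i & s]).
  apply: (@trace_frame _ E E' (fun x => Q (tup [:: delta_mx i 0; x]))
    (fun u => f (tup [:: u, delta_mx 0 i & s]))) => //.
    exact: (@slot_tup _ _ _ [:: delta_mx i 0] i21).
  exact: (@slot_tup _ _ _ [:: 0, delta_mx 0 i & s] (lshift l i20)).
under eq_bigr do rewrite T1.
rewrite exchange_big [RHS]exchange_big /=; apply: eq_bigr => j _.
apply: (@trace_frame _ E E' (fun x => Q (tup [:: x; col j E']))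
    (fun u => f (tup [:: row j E, u & s]))) => //.
  exact: (@slot_tup _ _ _ [:: 0; col j E'] i20).
exact: (@slot_tup _ _ _ [:: row j E, 0 & s] (lshift l i21)).
Qed.

Lemma iprod3_frame n l (E E' : 'M[R]_n) (Q : ('I_3 -> 'cV[R]_n) -> R)
    (f : ('I_(3 + l) -> 'rV[R]_n) -> R) s :
  E' *m E = 1%:M -> multilinear Q -> multilinear f ->
  mvec_iprod Q f (tup s) = 6^-1 * \sum_i \sum_j \sum_k
    Q (tup [:: col i E'; col j E'; col k E']) *
    f (tup [:: row k E, row j E, row i E & s]).
Proof.
move=> EE Ql fl; rewrite iprod3E; congr (_ * _).
have T1 i j : \sum_k Q (tup [:: delta_mx i 0; delta_mx j 0; delta_mx k 0]) *
    f (tup [:: delta_mx 0 k, delta_mx 0 j, delta_mx 0 i & s]) =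
  \sum_k Q (tup [:: delta_mx i 0; delta_mx j 0; col k E']) *
    f (tup [:: row k E, delta_mx 0 j, delta_mx 0 i & s]).
  apply: (@trace_frame _ E E' (fun x => Q (tup [:: delta_mx i 0; delta_mx j 0; x]))
    (fun u => f (tup [:: u, delta_mx 0 j, delta_mx 0 i & s]))) => //.
    exact: (@slot_tup _ _ _ [:: delta_mx i 0; delta_mx j 0] i32).
  exact: (@slot_tup _ _ _ [:: 0, delta_mx 0 j, delta_mx 0 i & s] (lshift l i30)).
have T2 i k : \sum_j Q (tup [:: delta_mx i 0; delta_mx j 0; col k E']) *
    f (tup [:: row k E, delta_mx 0 j, delta_mx 0 i & s]) =
  \sum_j Q (tup [:: delta_mx i 0; col j E'; col k E']) *
    f (tup [:: row k E, row j E, delta_mx 0 i & s]).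
  apply: (@trace_frame _ E E' (fun x => Q (tup [:: delta_mx i 0; x; col k E']))
    (fun u => f (tup [:: row k E, u, delta_mx 0 i & s]))) => //.
    exact: (@slot_tup _ _ _ [:: delta_mx i 0; 0; col k E'] i31).
  exact: (@slot_tup _ _ _ [:: row k E, 0, delta_mx 0 i & s] (lshift l i31)).
have T3 j k : \sum_i Q (tup [:: delta_mx i 0; col j E'; col k E']) *
    f (tup [:: row k E, row j E, delta_mx 0 i & s]) =
  \sum_i Q (tup [:: col i E'; col j E'; col k E']) *
    f (tup [:: row k E, row j E, row i E & s]).
  apply: (@trace_frame _ E E' (fun x => Q (tup [:: x; col j E'; col k E']))
    (fun u => f (tup [:: row k E, row j E, u & s]))) => //.
    exact: (@slot_tup _ _ _ [:: 0; col j E'; col k E'] i30).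
  exact: (@slot_tup _ _ _ [:: row k E, row j E, 0 & s] (lshift l i32)).
under eq_bigr do under eq_bigr do rewrite T1.
under eq_bigr do rewrite exchange_big /=.
under eq_bigr do under eq_bigr do rewrite T2.
under eq_bigr do rewrite exchange_big /=.
rewrite exchange_big /= [RHS]exchange_big /=; apply: eq_bigr => j _.
by rewrite exchange_big /= [RHS]exchange_big /=; apply: eq_bigr.
Qed.
End Multilinear.

(** * Jacobians and differentiability of smooth functions *)

Section Jacobian.
Variable R : realType.

Lemma near_eq_differentiable (V W : normedModType R) (f g : V -> W) (x : V) :
  (\forall y \near x, f y = g y) -> differentiable f x -> differentiable g x.
Proof.
move=> fg df; have fx : f x = g x := nbhs_singleton fg.
suff E : g \o shift x = cst (g x) + 'd f x +o_ (0 : V) id.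
  apply/diff_locallyP; rewrite (diff_unique (diff_continuous df) E).
  by split=> //; exact: diff_continuous.
apply/eqaddoP => _ /posnumP[e].
have /eqaddoP/(_ _ [elaborate gt0 e]) := diff_locally df.
have fg0 : \forall h \near (0 : V), f (h + x) = g (h + x).
  by move: fg; rewrite (near_shift 0 x) /=; apply: filterS => h; rewrite subr0.
move=> H; near=> h.
have -> : (g \o shift x - (cst (g x) + 'd f x)) h = (f \o shift x - (cst (f x) + 'd f x)) h.
  change (g (h + x) - (g x + 'd f x h) = f (h + x) - (f x + 'd f x h)).
  by rewrite fx (near fg0 h).
by near: h.
Unshelve. all: by end_near. Qed.

Lemma differentiable_rV (V : normedModType R) n (f : V -> 'rV[R]_n) (x : V) :
  (forall j, differentiable (fun y => f y 0 j) x) -> differentiable f x.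
Proof.
move=> df.
have -> : f = \sum_j (fun y => f y 0 j *: delta_mx 0 j).
  by apply/funext => y; rewrite fct_sumE [LHS]row_sum_delta.
by apply: differentiable_sum => j; apply: differentiableZl.
Qed.

Lemma jacobianE m n (f : 'rV[R]_m -> 'rV[R]_n) x v j : differentiable f x ->
  (v *m jacobian f x) 0 j = 'D_v (fun y => f y 0 j) x.
Proof.
move=> df; rewrite -deriveEjacobian// derive_mx ?mxE//.
exact: diff_derivable.
Qed.

Lemma jacobian_comp m n p (f : 'rV[R]_m -> 'rV[R]_n) (g : 'rV[R]_n -> 'rV[R]_p) x :
  differentiable f x -> differentiable g (f x) ->
  jacobian (fun y => g (f y)) x = jacobian f x *m jacobian g (f x).
Proof.
move=> df dg; apply/row_matrixP => i; rewrite rowE [RHS]rowE mulmxA.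
have dgf : differentiable (g \o f) x by exact: differentiable_comp.
rewrite -[LHS](deriveEjacobian _ dgf) -(deriveEjacobian _ df).
rewrite -(deriveEjacobian _ dg) !deriveE// diff_comp//.
Qed.

Lemma jacobian_near m n (f g : 'rV[R]_m -> 'rV[R]_n) x :
  (\forall y \near x, f y = g y) -> differentiable f x ->
  jacobian f x = jacobian g x.
Proof.
move=> fg df; have dg := near_eq_differentiable fg df.
apply/row_matrixP => i; rewrite [LHS]rowE [RHS]rowE.
rewrite -[LHS](deriveEjacobian _ df) -[RHS](deriveEjacobian _ dg).
exact: near_eq_derive.
Qed.

Lemma jacobian_id n (x : 'rV[R]_n) : jacobian id x = 1%:M.
Proof.
apply/row_matrixP => i; rewrite rowE row1 -[RHS](derive_id x).
by rewrite deriveEjacobian.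
Qed.

(** [Ck] speaks of partial derivatives only; [differentiable_C1] upgrades them once [x] is interior
    to [U]. *)
Lemma smooth_on_near_diff n (U : set 'rV[R]_n) f x : smooth_on U f -> nbhs x U ->
  differentiable f x.
Proof.
move=> /(_ 1%N) [_ /= sf] Ux; apply: differentiable_C1.
  by apply: filterS Ux => y Uy i; exact: (sf i).1.
by move=> i; apply: (sf i).2.1; exact: nbhs_singleton Ux.
Qed.

Lemma smooth_on_partial n (U : set 'rV[R]_n) f i : smooth_on U f ->
  smooth_on U ('D_(delta_mx 0 i) f).
Proof. by move=> sf k; case: (sf k.+1) => _ /(_ i)[]. Qed.

(** Near [x] the directional derivative is a constant combination of partial derivatives, which are
    smooth again. *)
Lemma smooth_on_near_diff_derive n (U : set 'rV[R]_n) f x v : smooth_on U f ->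
  nbhs x U -> differentiable ('D_v f) x.
Proof.
move=> sf Ux; have UU : \forall y \near x, nbhs y U by exact: nbhs_interior.
apply: (@near_eq_differentiable _ _ (fun y => \sum_i v 0 i * 'D_(delta_mx 0 i) f y)).
  apply: filterS UU => y Uy; have df := smooth_on_near_diff sf Uy.
  rewrite [in RHS](row_sum_delta v) deriveE// linear_sum; apply: eq_bigr => i _.
  by rewrite deriveE// linearZ.
have -> : (fun y => \sum_i v 0 i * 'D_(delta_mx 0 i) f y) =
   \sum_i (fun y => v 0 i *: 'D_(delta_mx 0 i) f y).
  by apply/funext => y; rewrite fct_sumE.
apply: differentiable_sum => i; apply: differentiableZ.
exact: smooth_on_near_diff (smooth_on_partial i sf) Ux.
Qed.

End Jacobian.

(** * Charts, the chain rule in coordinates, and tangent maps *)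

Section Charts.
Variable R : realType.

Lemma chart_near n (T : topologicalType) (c : chart R n T) (q : T) (A : set T) :
  cdom c q -> nbhs q A -> \forall x \near cmap c q, cimg c x /\ A (cinv c x).
Proof.
move=> cq qA; near=> x; split; near: x.
  by apply: open_nbhs_nbhs; split; [exact: open_cimg | exists q].
by apply: (cinv_cont cq); rewrite cmapK.
Unshelve. all: by end_near. Qed.

Lemma nbhs_cdom n (T : topologicalType) (c : chart R n T) (q : T) :
  cdom c q -> nbhs q (cdom c).
Proof. by move=> cq; apply: open_nbhs_nbhs; split => //; exact: open_cdom. Qed.

Lemma cimgP n (T : topologicalType) (c : chart R n T) x : cimg c x ->
  cdom c (cinv c x) /\ cmap c (cinv c x) = x.
Proof. by move=> [q cq <-]; rewrite cmapK. Qed.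

(** [from_chart], [to_chart] and [tangent_map] are all instances, so the single chain rule
    [loc_jac_comp] covers changes of chart and tangent maps. *)
Definition loc_jac m n (M : manifold R m) (N : manifold R n) (f : M -> N)
    (c : chart R m M) (d : chart R n N) (q : M) : 'M[R]_(m, n) :=
  jacobian (fun x => cmap d (f (cinv c x))) (cmap c q).

Section Maps.
Variables (m n : nat) (M : manifold R m) (N : manifold R n) (f : M -> N).
Hypothesis fs : smooth_map f.
Variables (c : chart R m M) (d : chart R n N) (q : M).
Hypotheses (ca : atlas c) (da : atlas d) (cq : cdom c q) (dq : cdom d (f q)).

Lemma smooth_map_nbhs :
  nbhs (cmap c q) (cmap c @` (cdom c `&` (f @^-1` cdom d))).
Proof.
have fq : nbhs q (f @^-1` cdom d) by apply: fs.1; exact: nbhs_cdom.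
apply: filterS (chart_near cq fq) => x [cx fx].
by have [? ?] := cimgP cx; exists (cinv c x).
Qed.

Lemma smooth_map_diff : differentiable (fun x => cmap d (f (cinv c x))) (cmap c q).
Proof.
apply: differentiable_rV => j.
exact: smooth_on_near_diff (fs.2 c d ca da j) smooth_map_nbhs.
Qed.

End Maps.

Lemma loc_jac_comp m n k (M : manifold R m) (N : manifold R n) (P : manifold R k)
    (f : M -> N) (g : N -> P) c d e q :
  smooth_map f -> smooth_map g -> atlas c -> atlas d -> atlas e ->
  cdom c q -> cdom d (f q) -> cdom e (g (f q)) ->
  loc_jac (fun p => g (f p)) c e q = loc_jac f c d q *m loc_jac g d e (f q).
Proof.
move=> fs gs ca da ea cq dq eq.
have df := smooth_map_diff fs ca da cq dq.
have dg := smooth_map_diff gs da ea dq eq.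
pose F x := cmap d (f (cinv c x)); pose G y := cmap e (g (cinv d y)).
have fq : F (cmap c q) = cmap d (f q) by rewrite /F cmapK.
have dg' : differentiable G (F (cmap c q)) by rewrite fq.
transitivity (jacobian (fun y => G (F y)) (cmap c q)).
  (* [cinv d] undoes [cmap d] only on the domain of [d], so the two coordinate maps are compared
     near the point. *)
  apply/esym/(@jacobian_near _ _ _ (fun y => G (F y))).
    have fN : nbhs q (f @^-1` cdom d) by apply: fs.1; exact: nbhs_cdom.
    by apply: filterS (chart_near cq fN) => x [_ fx]; rewrite /G /F cmapK.
  exact: differentiable_comp df dg'.
by rewrite (@jacobian_comp _ _ _ _ F G _ df dg') fq.
Qed.

Lemma smooth_map_id m (M : manifold R m) : smooth_map (id : M -> M).
Proof. split; first by move=> x; exact: cvg_id.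
by move=> c d ca da j; exact: atlas_compat. Qed.

Lemma loc_jac_id m (M : manifold R m) (c : chart R m M) q : cdom c q ->
  loc_jac (id : M -> M) c c q = 1%:M.
Proof.
move=> cq; rewrite /loc_jac -(jacobian_id (cmap c q)).
apply/esym/jacobian_near => //.
by apply: filterS (chart_near cq (nbhs_cdom cq)) => x [/cimgP[]].
Qed.

Section ChartChange.
Variables (m : nat) (M : manifold R m) (c : chart R m M) (q : M).
Hypotheses (ca : atlas c) (cq : cdom c q).

Lemma from_chartK : from_chart c q *m to_chart c q = 1%:M.
Proof.
have := @loc_jac_comp _ _ _ M M M id id c (chart_at q) c q
  (smooth_map_id M) (smooth_map_id M) ca (chart_at_atlas q) ca cq (chart_at_dom q) cq.
by move=> <-; exact: loc_jac_id.
Qed.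

Lemma to_chartK : to_chart c q *m from_chart c q = 1%:M.
Proof. exact: (mulmx1C from_chartK). Qed.

(** Both sides are the Jacobian of [f] from [c] to [chart_at (f q)], factored through a change of
    chart at the source or at the target. *)
Lemma tangent_map_loc n (N : manifold R n) (f : M -> N) (d : chart R n N) :
  smooth_map f -> atlas d -> cdom d (f q) ->
  from_chart c q *m tangent_map f q = loc_jac f c d q *m from_chart d (f q).
Proof.
move=> fs da dq.
rewrite -[LHS](@loc_jac_comp _ _ _ M M N id f c (chart_at q) (chart_at (f q)) q
  (smooth_map_id M) fs ca (chart_at_atlas q) (chart_at_atlas (f q)) cq
  (chart_at_dom q) (chart_at_dom (f q))).
rewrite -[RHS](@loc_jac_comp _ _ _ M N N f id c d (chart_at (f q)) q
  fs (smooth_map_id N) ca da (chart_at_atlas (f q)) cq dq (chart_at_dom (f q))).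
by [].
Qed.

End ChartChange.

Lemma from_chart_at m (M : manifold R m) (p : M) : from_chart (chart_at p) p = 1%:M.
Proof. exact: (loc_jac_id (chart_at_dom p)). Qed.

Lemma to_chart_at m (M : manifold R m) (p : M) : to_chart (chart_at p) p = 1%:M.
Proof. exact: (loc_jac_id (chart_at_dom p)). Qed.

End Charts.

(** * Existence of an adapted frame at a point *)

Section Frame.
Variable R : realType.

(** The rows of [E] are the horizontal lifts of the chart basis of the base, followed by a basis of
    the kernel of [T]. *)
Lemma adapted_frame (T : 'M[R]_(5, 2)) (gam : 'M[R]_5) :
  row_full T -> gam *m T = 0 -> (forall v : 'rV_5, v *m T = 0 -> v *m gam = v) ->
  exists E E' : 'M[R]_5, [/\ E *m E' = 1%:M,
    forall i j, (E *m T) i j = pi_coord R i j &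
    forall i j, (E *m gam *m E') i j = vproj_coord R i j].
Proof.
move=> Tf gT gv.
(* Removing the vertical part of the lift [pinvmx T] makes it horizontal and keeps its image under
   [T]. *)
pose H := pinvmx T *m (1%:M - gam).
have HT : H *m T = 1%:M.
  by rewrite -mulmxA mulmxBl gT subr0 mul1mx mulVpmx.
have gg : gam *m gam = gam.
  by apply/row_matrixP => i; rewrite row_mul gv// -row_mul gT row0.
have Hg : H *m gam = 0 by rewrite -mulmxA mulmxBl gg mul1mx subrr mulmx0.
clearbody H.
have rk : \rank (kermx T) = 3%N by rewrite mxrank_ker (eqP Tf).
have [K [KT Kf]] : exists K : 'M[R]_(3, 5), K *m T = 0 /\ row_free K.
  have bT : row_base (kermx T) *m T = 0 by apply/sub_kermxP; rewrite eq_row_base.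
  have := conj bT (row_base_free (kermx T)).
  by move: (row_base (kermx T)); rewrite rk => K KP; exists K.
have Kg : K *m gam = K.
  by apply/row_matrixP => i; rewrite row_mul gv// -row_mul KT row0.
pose E : 'M[R]_(2 + 3, 5) := col_mx H K.
(* If [u *m E = 0], applying [T] kills the vertical rows and shows that the horizontal coefficients
   vanish; freeness of [K] settles the others. *)
have Eu : E \in unitmx.
  rewrite -row_free_unit; apply/row_freeP.
  apply/row_freeP; rewrite -kermx_eq0; apply/eqP/row_matrixP => i.
  set u := row i _; have uE : u *m E = 0.
    by rewrite /u -row_mul mulmx_ker row0.
  rewrite row0 -[u]hsubmxK; move: uE; rewrite -{1}[u]hsubmxK mul_row_col => uE.
  have a0 : lsubmx u = 0.
    have := congr1 (mulmxr T) uE.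
    by rewrite /= mulmxDl -!mulmxA HT KT mulmx0 addr0 mulmx1 mul0mx.
  have b0 : rsubmx u = 0.
    by apply: (row_free_inj Kf); rewrite mul0mx -uE a0 mul0mx add0r.
  by rewrite a0 b0 row_mx0.
exists E, (invmx E); split; first by rewrite mulmxV.
- have v1 (a : 'I_2) : vert (lshift 3 a) = false by rewrite /vert leqNgt /= ltn_ord.
  have v2 (a : 'I_3) : vert (rshift 2 a) by [].
  have ET : E *m T = col_mx 1%:M 0 by rewrite /E mul_col_mx HT KT.
  move=> i j; rewrite ET.
  case: (@split_ordP 2 3 i) => a ->.
    by rewrite (col_mxEu (1%:M : 'M[R]_2) (0 : 'M[R]_(3, 2)) a j) mxE.
  rewrite (col_mxEd (1%:M : 'M[R]_2) (0 : 'M[R]_(3, 2)) a j) mxE /pi_coord /=.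
  by rewrite gtn_eqF// (leq_trans (ltn_ord j))// leq_addr.
- pose Dg : 'M[R]_(2 + 3) := block_mx 0 0 0 1%:M.
  have Eg : E *m gam = Dg *m E.
    by rewrite /E /Dg mul_block_col !mul0mx !add0r mul1mx mul_col_mx Hg Kg.
  move=> i j; rewrite Eg -mulmxA mulmxV// mulmx1 /Dg /vproj_coord /vert.
  case: (@split_ordP 2 3 i) => a ->; case: (@split_ordP 2 3 j) => b ->.
  + by rewrite (block_mxEul (0 : 'M[R]_2) (0 : 'M[R]_(2, 3)) (0 : 'M[R]_(3, 2)) (1%:M : 'M[R]_3) a b) mxE leqNgt /= ltn_ord andbF.
  + by rewrite (block_mxEur (0 : 'M[R]_2) (0 : 'M[R]_(2, 3)) (0 : 'M[R]_(3, 2)) (1%:M : 'M[R]_3) a b) mxE leqNgt /= ltn_ord andbF.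
  + by rewrite (block_mxEdl (0 : 'M[R]_2) (0 : 'M[R]_(2, 3)) (0 : 'M[R]_(3, 2)) (1%:M : 'M[R]_3) a b) mxE -val_eqE /= gtn_eqF// (leq_trans (ltn_ord b))// leq_addr.
  + by rewrite (block_mxEdr (0 : 'M[R]_2) (0 : 'M[R]_(2, 3)) (0 : 'M[R]_(3, 2)) (1%:M : 'M[R]_3) a b) mxE /= andbT -[RHS]/((2 + a == 2 + b)%N%:R) eqn_add2l.
Qed.
End Frame.

(** * Rules of differentiation for functions written pointwise *)

Section Derivation.
Variables (R : realType) (V : normedModType R).
Implicit Types (f g : V -> R) (x v : V).

Lemma derive_mul f g x v : differentiable f x -> differentiable g x ->
  'D_v (fun y => f y * g y) x = 'D_v f x * g x + f x * 'D_v g x.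
Proof.
move=> df dg; have := deriveM (diff_derivable (v := v) df) (diff_derivable (v := v) dg).
by move=> E; rewrite -[LHS]/('D_v (f * g) x) E addrC -[_ *: _]/(g x * _) mulrC.
Qed.

Lemma derive_add f g x v : differentiable f x -> differentiable g x ->
  'D_v (fun y => f y + g y) x = 'D_v f x + 'D_v g x.
Proof. by move=> df dg; exact: deriveD (diff_derivable (v := v) df) (diff_derivable (v := v) dg). Qed.

Lemma derive_opp f x v : differentiable f x -> 'D_v (fun y => - f y) x = - 'D_v f x.
Proof. by move=> df; exact: deriveN (diff_derivable (v := v) df). Qed.

Lemma derive_scale f x v c : differentiable f x -> 'D_v (fun y => c * f y) x = c * 'D_v f x.
Proof. by move=> df; exact: deriveZ (diff_derivable (v := v) df). Qed.

Lemma derive_big n (F : 'I_n -> V -> R) x v : (forall i, differentiable (F i) x) ->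
  'D_v (fun y => \sum_i F i y) x = \sum_i 'D_v (F i) x.
Proof.
move=> dF; rewrite -derive_sum; last by move=> i; exact: diff_derivable.
by congr ('D_v _ x); apply/funext => y; rewrite fct_sumE.
Qed.

Lemma differentiable_big n (F : 'I_n -> V -> R) x : (forall i, differentiable (F i) x) ->
  differentiable (fun y => \sum_i F i y) x.
Proof.
move=> dF; have -> : (fun y => \sum_i F i y) = \sum_i F i.
  by apply/funext => y; rewrite fct_sumE.
exact: differentiable_sum.
Qed.

Lemma differentiable_mul f g x : differentiable f x -> differentiable g x ->
  differentiable (fun y => f y * g y) x.
Proof. by move=> df dg; exact: differentiableM. Qed.

Lemma differentiable_add f g x : differentiable f x -> differentiable g x ->
  differentiable (fun y => f y + g y) x.
Proof. by move=> df dg; exact: differentiableD. Qed.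

Lemma differentiable_opp f x : differentiable f x -> differentiable (fun y => - f y) x.
Proof. by move=> df; exact: differentiableN. Qed.

Lemma differentiable_const (c : R) x : differentiable (fun _ : V => c) x.
Proof. exact: differentiable_cst. Qed.

Lemma derive_big_mul n (a b : 'I_n -> V -> R) x v :
  (forall i, differentiable (a i) x) -> (forall i, differentiable (b i) x) ->
  'D_v (fun y => \sum_i a i y * b i y) x =
  \sum_i ('D_v (a i) x * b i x + a i x * 'D_v (b i) x).
Proof.
move=> da db; rewrite derive_big; last by move=> i; exact: differentiable_mul.
by apply: eq_bigr => i _; rewrite derive_mul.
Qed.

Lemma derive_near f g x v : (\forall y \near x, f y = g y) -> 'D_v f x = 'D_v g x.
Proof. exact: near_eq_derive. Qed.

End Derivation.

(** * Antisymmetry of alternating maps *)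

Section AlternatingForms.
Variables (R : realType) (V : lmodType R).

(** Polarisation: [f] vanishes with [v i + v j] in both slots, and the expansion leaves the two
    mixed terms. *)
Lemma alt_swap k (f : ('I_k -> V) -> R) (v : 'I_k -> V) (i j : 'I_k) :
  alt_multilinear f -> i != j ->
  f (dfwith (dfwith v i (v j)) j (v i)) = - f v.
Proof.
move=> [fl fa] ij; have ji : j != i by rewrite eq_sym.
pose w x y := dfwith (dfwith v i x) j y.
have wi x y : w x y i = x by rewrite /w dfwithE (negPf ij) dfwithin.
have wj x y : w x y j = y by rewrite /w dfwithin.
have wC x y : w x y = dfwith (dfwith v j y) i x.
  by apply/funext => k'; rewrite /w !dfwithE; case: (eqVneq k' i) => [->|//]; rewrite (negPf ij).
have D1 x x' y : f (w (x + x') y) = f (w x y) + f (w x' y).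
  by rewrite !wC -[x]scale1r fl scale1r mul1r.
have D2 x y y' : f (w x (y + y')) = f (w x y) + f (w x y').
  by rewrite /w -[y]scale1r fl scale1r mul1r.
have Z x : f (w x x) = 0 by apply: (fa _ i j) => //; rewrite wi wj.
have := Z (v i + v j); rewrite D1 !D2 !Z add0r addr0.
have -> : w (v i) (v j) = v by rewrite /w dfwith_id dfwith_id.
by move=> /eqP; rewrite addrC addr_eq0 => /eqP.
Qed.

Lemma alt_tup2 (f : ('I_2 -> V) -> R) x y : alt_multilinear f ->
  f (tup [:: y; x]) = - f (tup [:: x; y]).
Proof.
move=> fa; rewrite -(@alt_swap _ _ _ i20 i21)//; congr f.
by apply/funext => -[[|[|//]]] p; rewrite !dfwithE.
Qed.

Lemma alt_tup3_12 (f : ('I_3 -> V) -> R) x y z : alt_multilinear f ->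
  f (tup [:: y; x; z]) = - f (tup [:: x; y; z]).
Proof.
move=> fa; rewrite -(@alt_swap _ _ _ i30 i31)//; congr f.
by apply/funext => -[[|[|[|//]]]] p; rewrite !dfwithE.
Qed.

Lemma alt_tup3_23 (f : ('I_3 -> V) -> R) x y z : alt_multilinear f ->
  f (tup [:: x; z; y]) = - f (tup [:: x; y; z]).
Proof.
move=> fa; rewrite -(@alt_swap _ _ _ i31 i32)//; congr f.
by apply/funext => -[[|[|[|//]]]] p; rewrite !dfwithE.
Qed.

End AlternatingForms.

(** * Lists of arguments under linear maps; alternating forms in the plane *)

Section TupleArguments.
Variable R : realType.

Lemma tup_map (V W : nmodType) k (h : V -> W) (s : seq V) : h 0 = 0 ->
  (fun i : 'I_k => h (tup s i)) = tup (map h s).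
Proof.
move=> h0; apply/funext => i; rewrite /tup.
have [si|si] := ltnP i (size s); first by rewrite (nth_map 0).
by rewrite !nth_default ?size_map.
Qed.

Lemma tup_map_lin m n k (A : 'M[R]_(m, n)) (s : seq 'rV[R]_m) :
  (fun i : 'I_k => tup s i *m A) = tup (map (mulmx^~ A) s).
Proof. by rewrite (tup_map k (h := mulmx^~ A)) ?mul0mx. Qed.

Lemma tup_map_linl m n k (A : 'M[R]_(m, n)) (s : seq 'cV[R]_n) :
  (fun i : 'I_k => A *m tup s i) = tup (map (mulmx A) s).
Proof. by rewrite (tup_map k (h := mulmx A)) ?mulmx0. Qed.

Lemma tup_lift (V : nmodType) k (s : seq V) (i : 'I_k.+1) : size s = k.+1 ->
  (fun j : 'I_k => tup s (lift i j)) = tup (take i s ++ drop i.+1 s).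
Proof.
move=> sk; apply/funext => j; rewrite /tup nth_cat size_takel; last first.
  by rewrite sk ltnW.
rewrite /= /bump leqNgt; case: ltnP => ij /=; first by rewrite add0n nth_take.
by rewrite nth_drop add1n addSn subnKC.
Qed.

Lemma tup_const (V : nmodType) (x : V) : (fun=> x) = tup [:: x] :> ('I_1 -> V).
Proof. by apply/funext => i; rewrite ord1. Qed.

Lemma tup_frame2 (V : nmodType) n (e : 'I_n -> V) (I : 'I_2 -> 'I_n) :
  (fun s => e (I s)) = tup [:: e (I i20); e (I i21)].
Proof.
by apply/funext => -[[|[|//]]] p; rewrite /tup /=; congr (e (I _)); apply: val_inj.
Qed.

Lemma tup_frame3 (V : nmodType) n (e : 'I_n -> V) (I : 'I_3 -> 'I_n) :
  (fun s => e (I s)) = tup [:: e (I i30); e (I i31); e (I i32)].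
Proof.
by apply/funext => -[[|[|[|//]]]] p; rewrite /tup /=; congr (e (I _)); apply: val_inj.
Qed.

Lemma row_mulE m n p (A : 'M[R]_(m, n)) (B : 'M[R]_(n, p)) i :
  row i (A *m B) = \sum_k A i k *: row k B.
Proof. by rewrite row_mul mulmx_sum_row; apply: eq_bigr => k _; rewrite mxE. Qed.

Lemma col_mulE m n p (A : 'M[R]_(m, n)) (B : 'M[R]_(n, p)) j :
  col j (A *m B) = \sum_k B k j *: col k A.
Proof.
apply/colP => i; rewrite !mxE summxE; apply: eq_bigr => k _.
by rewrite !mxE mulrC.
Qed.

Lemma alt2_det (f : ('I_2 -> 'rV[R]_2) -> R) u v : alt_multilinear f ->
  f (tup [:: u; v]) =
  (u 0 0 * v 0 1 - u 0 1 * v 0 0) * f (tup [:: delta_mx 0 0; delta_mx 0 1]).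
Proof.
move=> fa; have fl := fa.1.
have L1 : linear_form (fun x => f (tup [:: x; v])) by exact: (@slot_tup _ _ _ _ [:: 0; v] i20).
have L2 w : linear_form (fun x => f (tup [:: w; x])) by exact: (@slot_tup _ _ _ _ [:: w; 0] i21).
have Z w : f (tup [:: w; w]) = 0 by have := alt_tup2 w w fa; lra.
have uE : u = u 0 0 *: delta_mx 0 0 + u 0 1 *: delta_mx 0 1.
  rewrite [LHS]row_sum_delta !big_ord_recl big_ord0 addr0.
  by rewrite (_ : lift ord0 ord0 = 1)//; exact: val_inj.
have vE : v = v 0 0 *: delta_mx 0 0 + v 0 1 *: delta_mx 0 1.
  rewrite [LHS]row_sum_delta !big_ord_recl big_ord0 addr0.
  by rewrite (_ : lift ord0 ord0 = 1)//; exact: val_inj.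
have lZ (phi : 'rV[R]_2 -> R) (a c : R) x y : linear_form phi ->
    phi (a *: x + c *: y) = a * phi x + c * phi y.
  move=> pl; rewrite pl -[c *: y]addr0 pl.
  by have := pl (-1) 0 0; rewrite scaler0 addr0 => E; rewrite (_ : phi 0 = 0); [ring|lra].
transitivity (f (tup [:: u 0 0 *: delta_mx 0 0 + u 0 1 *: delta_mx 0 1; v])).
  by rewrite -uE.
rewrite (lZ _ _ _ _ _ L1).
have E w : f (tup [:: w; v]) =
    v 0 0 * f (tup [:: w; delta_mx 0 0]) + v 0 1 * f (tup [:: w; delta_mx 0 1]).
  by rewrite {1}vE (lZ _ _ _ _ _ (L2 w)).
rewrite !E !Z (alt_tup2 (delta_mx 0 0) (delta_mx 0 1) fa); ring.
Qed.

End TupleArguments.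

(** * Multilinearity and low-degree formulas for the exterior derivative *)

Section ExteriorDerivative.
Variables (R : realType) (n : nat) (M : manifold R n).

Lemma multilinear_form_loc k (c : chart R n M) (al : dform M k) x :
  (forall q, multilinear (al q)) -> multilinear (form_loc c al x).
Proof.
move=> al_lin.
apply: (@multilinear_comp _ _ _ _ _ (fun _ u => u *m from_chart c (cinv c x))) => // _ a u w.
by rewrite mulmxDl -scalemxAl.
Qed.

Lemma multilinear_mvec_loc k (c : chart R n M) (Q : mvec M k) x :
  (forall q, multilinear (Q q)) -> multilinear (mvec_loc c Q x).
Proof.
move=> Q_lin.
apply: (@multilinear_comp _ _ _ _ _ (fun _ u => to_chart c (cinv c x) *m u)) => // _ a u w.
by rewrite mulmxDr -scalemxAr.
Qed.

Lemma multilinear_ext_deriv k (al : dform M k) p :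
  (forall q, multilinear (al q)) ->
  (forall v, differentiable (fun x => form_loc (chart_at p) al x v)
                            (cmap (chart_at p) p)) ->
  multilinear (ext_deriv al p).
Proof.
move=> al_lin dal; rewrite /ext_deriv; apply: multilinear_sum => i _.
apply: multilinearZ => v i0 a x y.
(* In summand [i] the varied slot is either the direction of differentiation or an argument of the
   form; differentiability makes the derivative linear in both. *)
have [->|ne] := eqVneq i0 i.
  have E z : (fun j => dfwith v i z (lift i j)) = (fun j => v (lift i j)).
    by apply/funext => j; rewrite dfwithE eq_sym (negPf (neq_lift _ _)).
  by rewrite !E !dfwithin deriveDv.
case: (unliftP i i0) ne => [j0 -> _|->]; last by rewrite eqxx.
have E z : (fun j => dfwith v (lift i j0) z (lift i j)) =
    dfwith (fun j => v (lift i j)) j0 z.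
  by apply/funext => j; rewrite !dfwithE (inj_eq lift_inj).
have D z : dfwith v (lift i j0) z i = v i.
  by rewrite dfwithE (negPf (neq_lift _ _)).
rewrite !E !D.
have L q := multilinear_form_loc (chart_at p) q al_lin (fun j => v (lift i j)) j0 a x y.
have -> : (fun q => form_loc (chart_at p) al q
      (dfwith (fun j => v (lift i j)) j0 (a *: x + y))) =
   (fun q => a * form_loc (chart_at p) al q (dfwith (fun j => v (lift i j)) j0 x) +
      form_loc (chart_at p) al q (dfwith (fun j => v (lift i j)) j0 y)).
  by apply/funext => q; exact: L.
rewrite derive_add//; first by rewrite derive_scale.
by apply: differentiable_mul => //; exact: differentiable_const.
Qed.

Lemma multilinear_mvec_partial k (Q : mvec M k) l p :
  (forall q, multilinear (Q q)) ->
  (forall v, differentiable (fun x => mvec_loc (chart_at p) Q x v)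
                            (cmap (chart_at p) p)) ->
  multilinear (mvec_partial l Q p).
Proof.
move=> Q_lin dQ v i a x y; rewrite /mvec_partial.
have -> : (fun q => mvec_loc (chart_at p) Q q (dfwith v i (a *: x + y))) =
   (fun q => a * mvec_loc (chart_at p) Q q (dfwith v i x) +
      mvec_loc (chart_at p) Q q (dfwith v i y)).
  by apply/funext => q; exact: multilinear_mvec_loc.
rewrite derive_add//; first by rewrite derive_scale.
by apply: differentiable_mul => //; exact: differentiable_const.
Qed.

Lemma ext_deriv0E (al : dform M 0) p u : ext_deriv al p (tup [:: u]) =
  'D_u (fun x => form_loc (chart_at p) al x (tup [::])) (cmap (chart_at p) p).
Proof.
rewrite /ext_deriv big_ord1 expr0 mul1r.
by rewrite tup_lift.
Qed.

Lemma ext_deriv1E (al : dform M 1) p u v : ext_deriv al p (tup [:: u; v]) =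
  'D_u (fun x => form_loc (chart_at p) al x (tup [:: v])) (cmap (chart_at p) p) -
  'D_v (fun x => form_loc (chart_at p) al x (tup [:: u])) (cmap (chart_at p) p).
Proof.
rewrite /ext_deriv !big_ord_recl big_ord0 addr0 /= expr0 mul1r expr1 mulN1r.
by rewrite !tup_lift.
Qed.

Lemma ext_deriv3E (al : dform M 3) p u1 u2 u3 u4 :
  let L u v w := fun x => form_loc (chart_at p) al x (tup [:: u; v; w]) in
  let x0 := cmap (chart_at p) p in
  ext_deriv al p (tup [:: u1; u2; u3; u4]) =
  'D_u1 (L u2 u3 u4) x0 - 'D_u2 (L u1 u3 u4) x0 +
  'D_u3 (L u1 u2 u4) x0 - 'D_u4 (L u1 u2 u3) x0.
Proof.
move=> L x0; rewrite /ext_deriv !big_ord_recl big_ord0 addr0 /=.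
rewrite expr0 mul1r expr1 mulN1r /bump /= expr2 mulrNN !mul1r exprS expr2 mulrNN mul1r mulr1 mulN1r !addrA.
by rewrite !tup_lift.
Qed.

End ExteriorDerivative.

(** * Auxiliary identities for bidegree components and for matrices in a frame *)

Lemma bicomp0 (R : realType) (V : lmodType R) k (h g : V -> V) (f : ('I_k -> V) -> R) v :
  bicomp h g 0 f v = f (fun i => g (v i)).
Proof.
rewrite /bicomp (big_pred1 (finset.set0 : {set 'I_k})) => [|S]; last by rewrite cards_eq0.
by congr f; apply/funext => i; rewrite inE.
Qed.

Lemma bicompT (R : realType) (V : lmodType R) k (h g : V -> V) (f : ('I_k -> V) -> R) v :
  bicomp h g k f v = f (fun i => h (v i)).
Proof.
rewrite /bicomp (big_pred1 (finset.setT : {set 'I_k})) => [|S].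
  by congr f; apply/funext => i; rewrite inE.
rewrite /= eqEcard finset.subsetT cardsT [X in (X <= _)%N]card_ord eqn_leq.
by have := max_card S; rewrite card_ord => ->.
Qed.

Lemma alt_form_loc (R : realType) n (M : manifold R n) k (c : chart R n M)
    (al : dform M k) x :
  (forall q, alt_multilinear (al q)) -> alt_multilinear (form_loc c al x).
Proof.
move=> ala; split; first by apply: multilinear_form_loc => q; exact: (ala q).1.
move=> v i j ij vij; apply: ((ala (cinv c x)).2 _ i j ij) => /=.
by rewrite vij.
Qed.

Lemma derive_bwedge (R : realType) (V : normedModType R) (v x : V) (a b : V -> 'I_2 -> R) :
  (forall j, differentiable (fun y => a y j) x) ->
  (forall j, differentiable (fun y => b y j) x) ->
  'D_v (fun y => det2 (a y) (b y)) x =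
  det2 (fun j => 'D_v (fun y => a y j) x) (b x) +
  det2 (a x) (fun j => 'D_v (fun y => b y j) x).
Proof.
move=> da db; rewrite /det2 derive_add; [|exact: differentiable_mul|by apply: differentiable_opp; exact: differentiable_mul].
rewrite derive_opp; last exact: differentiable_mul.
rewrite (derive_mul _ (da 0) (db 1)) (derive_mul _ (da 1) (db 0)); ring.
Qed.

Lemma multilinear_insert (R : realType) (V : lmodType R) k (u : V) (f : ('I_k.+1 -> V) -> R) :
  multilinear f -> multilinear (insert u f).
Proof.
move=> fl v i a x y.
have F z : insert u f (dfwith v i z) =
   f (dfwith (fun j => if unlift ord0 j is Some k then v k else u) (lift ord0 i) z).
  rewrite /insert; congr f; apply/funext => j; rewrite dfwithE.
  case: unliftP => [k' ->|->]; last by rewrite (negPf (neq_lift _ _)).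
  by rewrite dfwithE (inj_eq lift_inj).
by rewrite !F fl.
Qed.

Lemma sum3_eq (R : nmodType) n (a1 a2 a3 b1 b2 b3 : 'I_n -> R) :
  \sum_l a1 l = \sum_l b1 l -> \sum_l a2 l = \sum_l b2 l -> \sum_l a3 l = \sum_l b3 l ->
  \sum_l (a1 l + a2 l + a3 l) = \sum_l (b1 l + b2 l + b3 l).
Proof. by move=> e1 e2 e3; rewrite !big_split /= e1 e2 e3. Qed.

(** A component of d beta wedge beta, with [db i j] the derivative in direction [i] of the component
    [b j]. *)
Definition cyclic_ext (R : realType) (I : Type) (db : I -> I -> R) (b : I -> R) (i j k : I) : R :=
  (db j k - db k j) * b i + (db k i - db i k) * b j + (db i j - db j i) * b k.

Lemma cyclic_ext12 (R : realType) I (db : I -> I -> R) (b : I -> R) i j k :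
  cyclic_ext db b j i k = - cyclic_ext db b i j k.
Proof. by rewrite /cyclic_ext; ring. Qed.

Lemma cyclic_ext23 (R : realType) I (db : I -> I -> R) (b : I -> R) i j k :
  cyclic_ext db b i k j = - cyclic_ext db b i j k.
Proof. by rewrite /cyclic_ext; ring. Qed.

Lemma cyclic_extE (R : realType) I (db : I -> I -> R) (b : I -> R) i j k :
  cyclic_ext db b i j k =
  (db i j - db j i) * b k + (db j k - db k j) * b i + (db k i - db i k) * b j.
Proof. by rewrite /cyclic_ext; ring. Qed.

(** The (1,1) part of d beta - theta wedge beta: [vi] and [vj] tell which arguments are vertical;
    theta vanishes on vertical arguments, beta on horizontal ones. *)
Lemma mixed_cases (R : realType) (vi vj : bool) (Bij Bji ti tj bi bj : R) :
  Bij = - Bji -> (~~ vi -> bi = 0) -> (~~ vj -> bj = 0) ->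
  (if vi (+) vj then Bij else 0) -
    ((if vi then 0 else ti) * bj - (if vj then 0 else tj) * bi) =
  if vi then (if vj then 0 else - (Bji - tj * bi))
  else (if vj then Bij - ti * bj else 0).
Proof.
move=> ->; case: vi; case: vj => //= hi hj; try rewrite (hi isT);
  try rewrite (hj isT); ring.
Qed.

Lemma vertical_cases (R : realType) (vi vj : bool) (di dj bi bj k r : R) :
  (~~ vi -> bi = 0) -> (~~ vj -> bj = 0) ->
  (if vi then di else 0) * bj - (if vj then dj else 0) * bi
     - k * (if vi && vj then r else 0) =
  if vi && vj then di * bj - dj * bi - k * r else 0.
Proof.
case: vi; case: vj => //= hi hj; try rewrite (hi isT); try rewrite (hj isT); ring.
Qed.

Lemma multilinearN (R : realType) (V : lmodType R) k (f : ('I_k -> V) -> R) :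
  multilinear f -> multilinear (fun v => - f v).
Proof. by move=> fl v i a x y; rewrite fl; ring. Qed.

Lemma row_mul_entry (R : realType) m n p (A : 'M[R]_(m, n)) (C : 'M[R]_(n, p)) i j :
  (row i A *m C) 0 j = (A *m C) i j.
Proof. by rewrite -row_mul mxE. Qed.

Lemma chain_inverse (R : realType) m n (F F' : 'M[R]_m) (T J : 'M[R]_(m, n)) (D D' : 'M[R]_n) :
  F' *m F = 1%:M -> F *m T = J *m D -> D *m D' = 1%:M -> F' *m J = T *m D'.
Proof. by move=> FF FT DD; rewrite -[J]mulmx1 -DD (mulmxA J) -FT !mulmxA FF mul1mx. Qed.

Lemma frame_conj_eq0 (R : realType) m n (E E' F G F' : 'M[R]_m) (J : 'M[R]_(m, n)) :
  E' *m E = 1%:M -> G *m (F' *m J) = 0 ->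
  (E *m (F *m G *m F') *m E') *m (E *m J) = 0.
Proof.
by move=> EE GJ; rewrite mulmxA -(mulmxA _ E') EE mulmx1 -!mulmxA GJ !mulmx0.
Qed.

Lemma row_chain (R : realType) m n (E F : 'M[R]_m) (T J : 'M[R]_(m, n)) (D : 'M[R]_n) i :
  F *m T = J *m D -> row i (E *m F) *m T = row i (E *m J) *m D.
Proof. by move=> FT; rewrite -!row_mul -!mulmxA FT. Qed.

Lemma frame_conj_row (R : realType) n (E E' F F' G : 'M[R]_n) :
  E' *m E = 1%:M -> F' *m F = 1%:M ->
  E *m F *m G = (E *m (F *m G *m F') *m E') *m (E *m F).
Proof.
move=> EE FF; rewrite -!mulmxA; congr (_ *m (_ *m _)).
by rewrite (mulmxA E' E) EE mul1mx FF mulmx1.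
Qed.

Lemma frame_conj_col (R : realType) n (E E' F F' G : 'M[R]_n) :
  E' *m E = 1%:M -> F' *m F = 1%:M ->
  G *m (F' *m E') = (F' *m E') *m (E *m (F *m G *m F') *m E').
Proof.
move=> EE FF; rewrite !mulmxA; congr (_ *m _ *m _).
by rewrite -(mulmxA F' E') EE mulmx1 FF mul1mx.
Qed.

(** * The geometric data: bidegrees as identities in one slot, and the coupling bivector *)

Section CouplingBivector.
Variables (R : realType) (M : manifold R 5) (B : manifold R 2)
  (pi : M -> B) (om : dform B 2)
  (gam : M -> 'M[R]_5) (kap : M -> R) (bet : dform M 1)
  (OmV : dform M 3) (QH : mvec M 2) (QV : mvec M 3) (psi : mvec B 2).
Hypotheses (pi_fib : fiber_bundle pi) (om_vol : volume_form om)
  (gam_ehr : ehresmann pi gam) (kap_smooth : smooth_fun kap)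
  (bet_smooth : smooth_form bet)
  (bet_vert : forall p v, horizontal gam p v -> bet p (fun=> v) = 0)
  (OmV_smooth : smooth_form OmV) (OmV_bideg : form_bidegree gam (a := 0) (b := 3) OmV)
  (QH_smooth : smooth_mvec QH) (QH_bideg : mvec_bidegree gam (a := 2) (b := 0) QH)
  (QH_norm : forall p v, mvec_iprod (l := 0) (QH p) (pullback pi om p) v = 1)
  (QV_smooth : smooth_mvec QV) (QV_bideg : mvec_bidegree gam (a := 0) (b := 3) QV)
  (QV_norm : forall p v, mvec_iprod (l := 0) (QV p) (OmV p) v = 1)
  (psi_smooth : smooth_mvec psi)
  (psi_norm : forall b v, mvec_iprod (l := 0) (psi b) (om b) v = -1).

Let T (q : M) : 'M[R]_(5, 2) := tangent_map pi q.

Lemma gamT q : gam q *m T q = 0.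
Proof.
apply/row_matrixP => i; rewrite row0 rowE mulmxA.
by have [_ H _] := gam_ehr; exact: H.
Qed.

Lemma gam_fix q (v : 'rV[R]_5) : v *m T q = 0 -> v *m gam q = v.
Proof. by have [_ _ H] := gam_ehr; exact: H. Qed.

Lemma gam_fix_mx q m (W : 'M[R]_(m, 5)) : W *m T q = 0 -> W *m gam q = W.
Proof.
by move=> WT; apply/row_matrixP => i; rewrite row_mul gam_fix// -row_mul WT row0.
Qed.

Lemma gam_idem q : gam q *m gam q = gam q.
Proof. exact: gam_fix_mx (gamT q). Qed.

(** Bidegree (0,3) inserts [gam] in all three slots. Idempotence reduces this to one slot, giving an
    identity linear in [gam] that is simple to differentiate. *)
Lemma OmV_slot q u v w : OmV q (tup [:: u *m gam q; v; w]) = OmV q (tup [:: u; v; w]).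
Proof.
have E x : OmV q (tup [:: x; v; w]) = OmV q (tup [:: x *m gam q; v *m gam q; w *m gam q]).
  by rewrite -OmV_bideg /form_comp bicomp0 tup_map_lin.
by rewrite E [RHS]E -mulmxA gam_idem.
Qed.

Lemma QV_slot q x y z : QV q (tup [:: gam q *m x; y; z]) = QV q (tup [:: x; y; z]).
Proof.
have E x' : QV q (tup [:: x'; y; z]) = QV q (tup [:: gam q *m x'; gam q *m y; gam q *m z]).
  by rewrite -QV_bideg /mvec_comp bicomp0 tup_map_linl.
by rewrite E [RHS]E mulmxA gam_idem.
Qed.

Lemma QH_proj q x y : QH q (tup [:: x; y]) =
  QH q (tup [:: (1%:M - gam q) *m x; (1%:M - gam q) *m y]).
Proof. by rewrite -QH_bideg /mvec_comp bicompT tup_map_linl. Qed.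

Lemma QH_slot q x y : QH q (tup [:: gam q *m x; y]) = 0.
Proof.
rewrite QH_proj mulmxA mulmxBl mul1mx gam_idem subrr mul0mx.
by apply: (@multilinear0 _ _ _ _ _ i20); first exact: (QH_smooth.1 q).1.
Qed.

Lemma bet_slot q u : bet q (tup [:: u *m gam q]) = bet q (tup [:: u]).
Proof.
have L : linear_form (fun x => bet q (tup [:: x])).
  exact: (@slot_tup _ _ _ _ [:: 0] ord0 (bet_smooth.1 q).1).
have hz : horizontal gam q ((-1) *: (u *m gam q) + u).
  by rewrite /horizontal mulmxDl -scalemxAl -mulmxA gam_idem scaleN1r addNr.
by have := bet_vert hz; rewrite tup_const L; lra.
Qed.

Lemma hor_psi q xi : hor pi gam psi q xi = - QH q xi.
Proof.
have Tf : row_full (T q) by have [_ _ H] := pi_fib; exact: H.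
set L := hor_lift pi gam q.
have LT : L *m T q = 1%:M.
  by rewrite /L /hor_lift -mulmxA mulmxBl mul1mx gamT subr0 mulVpmx.
(* The horizontal projection factors through the tangent plane of the base, so [QH] is determined by
   a bivector of that plane. *)
have TL : 1%:M - gam q = T q *m L.
  rewrite /L /hor_lift mulmxA -[LHS]mul1mx.
  apply/eqP; rewrite -subr_eq0 -mulmxBl; apply/eqP.
  rewrite mulmxBr mulmx1 gam_fix_mx ?subrr//.
  by rewrite mulmxBl -mulmxA mulVpmx// mul1mx mulmx1 subrr.
have xiE : xi = tup [:: xi i20; xi i21].
  by apply/funext => -[[|[|//]]] p; rewrite /tup /=; congr xi; apply: val_inj.
have QHa := QH_smooth.1 q; have psia := psi_smooth.1 (pi q).
have oma := om_vol.1.1 (pi q).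
have dup (n : nat) (f : ('I_2 -> 'cV[R]_n) -> R) u : alt_multilinear f -> f (tup [:: u; u]) = 0.
  by move=> fa; have := alt_tup2 u u fa; lra.
(* Both bivectors come from the plane T_(pi q) B, where they are proportional
   and normalised by the same area form. *)
have det2_basis (f : ('I_2 -> 'cV[R]_2) -> R) u v : alt_multilinear f ->
  f (tup [:: u; v]) = (u 0 0 * v 1 0 - u 1 0 * v 0 0) *
     f (tup [:: delta_mx 0 0; delta_mx 1 0]).
  (* [alt2_det] concerns rows; transposition brings columns under it. *)
  move=> fa; pose g (w : 'I_2 -> 'rV[R]_2) := f (fun i => (w i)^T).
  have ga : alt_multilinear g.
    split=> [w i a x y|w i j ij wij]; last by apply: (fa.2 _ i j ij); rewrite wij.
    have E z : (fun k => (dfwith w i z k)^T) = dfwith (fun k => (w k)^T) i z^T.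
      by apply/funext => k; rewrite !dfwithE; case: eqP.
    by rewrite /g !E linearP fa.1.
  have E x y : f (tup [:: x; y]) = g (tup [:: x^T; y^T]).
    by rewrite /g; congr f; apply/funext => -[[|[|//]]] ?; rewrite /tup /= trmxK.
  by rewrite E (alt2_det _ _ ga) !mxE E !trmx_delta.
pose g (w : 'I_2 -> 'cV[R]_2) := QH q (fun i => T q *m w i).
have ga : alt_multilinear g.
  split=> [w i a x y|w i j ij wij]; last by apply: (QHa.2 _ i j ij); rewrite wij.
  have E z : (fun k => T q *m dfwith w i z k) = dfwith (fun k => T q *m w k) i (T q *m z).
    by apply/funext => k; rewrite !dfwithE; case: eqP => // ->.
  by rewrite /g !E mulmxDr -scalemxAr QHa.1.
have QHE : QH q xi = g (tup [:: L *m xi i20; L *m xi i21]).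
  by rewrite xiE QH_proj TL /g tup_map_linl /= !mulmxA.
have horE : hor pi gam psi q xi = psi (pi q) (tup [:: L *m xi i20; L *m xi i21]).
  by rewrite /hor {1}xiE tup_map_linl.
rewrite horE QHE (det2_basis _ _ _ psia) (det2_basis _ _ _ ga).
set w := om (pi q) (tup [:: delta_mx 0 0; delta_mx 0 1]).
(* The sign is opposite to that of [psi_norm] because the interior product inserts vectors in
   reverse order. *)
have n1 : psi (pi q) (tup [:: delta_mx 0 0; delta_mx 1 0]) * w = 1.
  have := psi_norm (pi q) (tup [::]); rewrite iprod2E !big_ord_recl !big_ord0 /=.
  rewrite (_ : lift ord0 ord0 = 1); last exact: val_inj.
  rewrite -[ord0]/(0 : 'I_2) !dup// (alt_tup2 (delta_mx 0 0) (delta_mx 1 0) psia).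
  rewrite (alt_tup2 (delta_mx 0 0) (delta_mx 0 1) oma) -/w; lra.
have n2 : g (tup [:: delta_mx 0 0; delta_mx 1 0]) * w = -1.
  have := QH_norm q (tup [::]); rewrite iprod2E.
  have fl (k : nat) (V : lmodType R) (f : ('I_k -> V) -> R) : alt_multilinear f -> multilinear f.
    by case.
  have T1 i : \sum_j QH q (tup [:: delta_mx i 0; delta_mx j 0]) *
      pullback pi om q (tup [:: delta_mx 0 j; delta_mx 0 i]) =
    \sum_a QH q (tup [:: delta_mx i 0; col a (T q)]) *
      om (pi q) (tup [:: delta_mx 0 a; row i (T q)]).
    rewrite -(@trace_mx _ _ _ (T q) (fun x => QH q (tup [:: delta_mx i 0; x]))
      (fun u => om (pi q) (tup [:: u; row i (T q)]))).
    - by apply: eq_bigr => j _; rewrite /pullback tup_map_lin /= -!rowE.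
    - exact: (@slot_tup _ _ _ _ [:: delta_mx i 0] i21 (fl _ _ _ QHa)).
    - exact: (@slot_tup _ _ _ _ [:: 0; row i (T q)] i20 (fl _ _ _ oma)).
  under eq_bigr do rewrite T1.
  rewrite exchange_big /=.
  have T2 a : \sum_i QH q (tup [:: delta_mx i 0; col a (T q)]) *
      om (pi q) (tup [:: delta_mx 0 a; row i (T q)]) =
    \sum_c QH q (tup [:: col c (T q); col a (T q)]) *
      om (pi q) (tup [:: delta_mx 0 a; delta_mx 0 c]).
    rewrite -(@trace_mx _ _ _ (T q) (fun x => QH q (tup [:: x; col a (T q)]))
      (fun u => om (pi q) (tup [:: delta_mx 0 a; u])))//.
    - exact: (@slot_tup _ _ _ _ [:: 0; col a (T q)] i20 (fl _ _ _ QHa)).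
    - exact: (@slot_tup _ _ _ _ [:: delta_mx 0 a; 0] i21 (fl _ _ _ oma)).
  under eq_bigr do rewrite T2.
  have gE a c : QH q (tup [:: col c (T q); col a (T q)]) =
      g (tup [:: delta_mx c 0; delta_mx a 0]).
    by rewrite /g tup_map_linl /= -!colE.
  under eq_bigr do under eq_bigr do rewrite gE.
  rewrite !big_ord_recl !big_ord0 /=.
  rewrite (_ : lift ord0 ord0 = 1); last exact: val_inj.
  rewrite -[ord0]/(0 : 'I_2) !dup// (alt_tup2 (delta_mx 0 0) (delta_mx 1 0) ga).
  rewrite (alt_tup2 (delta_mx 0 0) (delta_mx 0 1) oma) -/w; lra.
have w0 : w != 0 by apply/eqP => w0; move: n2; rewrite w0; lra.
suff -> : psi (pi q) (tup [:: delta_mx 0 0; delta_mx 1 0]) =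
    - g (tup [:: delta_mx 0 0; delta_mx 1 0]) by rewrite mulrN.
by apply: (mulIf w0); lra.
Qed.

Definition coupling_bivector : mvec M 2 := fun p xi => kap p * hor pi gam psi p xi + P_ QV bet p xi.

Lemma insert1 (V : lmodType R) (f : ('I_3 -> V) -> R) x y z :
  insert x f (tup [:: y; z]) = f (tup [:: x; y; z]).
Proof.
rewrite /insert; congr f; apply/funext => i; by case: unliftP => [j ->|->].
Qed.

Lemma coupling_bivectorE q x y : coupling_bivector q (tup [:: x; y]) =
  - (kap q * QH q (tup [:: x; y]) + QV q (tup [:: covec (bet q); x; y])).
Proof. by rewrite /coupling_bivector hor_psi /P_ insert1 mulrN opprD. Qed.

Lemma coupling_bivector_multilinear q : multilinear (coupling_bivector q).
Proof.
have E xi : coupling_bivector q xi = - (kap q * QH q xi + insert (covec (bet q)) (QV q) xi).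
  by rewrite /coupling_bivector hor_psi /P_ mulrN opprD.
move=> v i a x y.
rewrite !E (QH_smooth.1 q).1 (multilinear_insert (covec (bet q)) (QV_smooth.1 q).1).
ring.
Qed.

Lemma coupling_bivector_alt q x y : coupling_bivector q (tup [:: y; x]) = - coupling_bivector q (tup [:: x; y]).
Proof.
rewrite !coupling_bivectorE (alt_tup2 x y (QH_smooth.1 q)) (alt_tup3_23 _ x y (QV_smooth.1 q)).
by rewrite mulrN -opprD opprK.
Qed.

(** * Component functions near a fixed point, and the relations between them *)

Section AtPoint.
Variables (p : M) (E E' : 'M[R]_5).
Hypotheses (EE : E *m E' = 1%:M)
  (ET : forall i j, (E *m tangent_map pi p) i j = pi_coord R i j)
  (Eg : forall i j, (E *m gam p *m E') i j = vproj_coord R i j).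

Let c := chart_at p.
Let d := chart_at (pi p).
Let x0 := cmap c p.
Let e (i : 'I_5) : 'rV[R]_5 := row i E.
Let e' (i : 'I_5) : 'cV[R]_5 := col i E'.
Let pl (x : 'rV[R]_5) : 'rV[R]_2 := cmap d (pi (cinv c x)).

Let Gm (x : 'rV[R]_5) : 'M[R]_5 :=
  from_chart c (cinv c x) *m gam (cinv c x) *m to_chart c (cinv c x).
Let Gf x i j : R := (E *m Gm x *m E') i j.
Let bf x i : R := form_loc c bet x (tup [:: e i]).
Let Of x i j k : R := form_loc c OmV x (tup [:: e i; e j; e k]).
Let Qf x i j k : R := mvec_loc c QV x (tup [:: e' i; e' j; e' k]).
Let Hf x i j : R := mvec_loc c QH x (tup [:: e' i; e' j]).
(** Given as a directional derivative, so that [h] below is an iterated one to which [derive_comm]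
    applies. *)
Let Df x i (j : 'I_2) : R := 'D_(e i) (fun y => pl y 0 j) x.
Let wf x : R := form_loc d om (pl x) (tup [:: delta_mx 0 0; delta_mx 0 1]).
Let kf x : R := kap (cinv c x).
Let Pf x i j : R := mvec_loc c coupling_bivector x (tup [:: e' i; e' j]).

(** Coordinates of the points where both charts are usable; the relations to be differentiated hold
    on this set. *)
Let N x := cimg c x /\ cdom d (pi (cinv c x)).

Let pi_smooth : smooth_map pi. Proof. by case: pi_fib. Qed.

Let nearN : \forall x \near x0, N x.
Proof.
apply: (chart_near (chart_at_dom p) (A := pi @^-1` cdom d)).
by apply: pi_smooth.1; apply: nbhs_cdom; exact: chart_at_dom.
Qed.

Let ca : atlas c := chart_at_atlas p.
Let da : atlas d := chart_at_atlas (pi p).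

Let E'E : E' *m E = 1%:M. Proof. exact: mulmx1C. Qed.

Section Near.
Variable x : 'rV[R]_5.
Hypothesis Nx : N x.
Let q := cinv c x.
Let F := from_chart c q.
Let F' := to_chart c q.

Let cq : cdom c q. Proof. by case: (cimgP Nx.1). Qed.
Let qE : cmap c q = x. Proof. by case: (cimgP Nx.1). Qed.
Let F'F : F' *m F = 1%:M. Proof. exact: to_chartK. Qed.
(** When the tangent space at [q] is identified through [chart_at q], the constant frame becomes the
    rows of [E *m F], and its dual frame the columns of [F' *m E']. *)
Let frame_inv : (F' *m E') *m (E *m F) = 1%:M.
Proof. by rewrite mulmxA -(mulmxA F') E'E mulmx1. Qed.

Let rowF i : e i *m F = row i (E *m F). Proof. by rewrite row_mul. Qed.
Let colF i : F' *m e' i = col i (F' *m E').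
Proof. by rewrite [e' i]colE [RHS]colE mulmxA. Qed.

Let OmVl : multilinear (OmV q). Proof. exact: (OmV_smooth.1 q).1. Qed.
Let QVl : multilinear (QV q). Proof. exact: (QV_smooth.1 q).1. Qed.
Let QHl : multilinear (QH q). Proof. exact: (QH_smooth.1 q).1. Qed.
Let betl : multilinear (bet q). Proof. exact: (bet_smooth.1 q).1. Qed.

Let OfE i j k : Of x i j k =
  OmV q (tup [:: row i (E *m F); row j (E *m F); row k (E *m F)]).
Proof. by rewrite /Of /form_loc tup_map_lin /= !rowF. Qed.

Let bfE i : bf x i = bet q (tup [:: row i (E *m F)]).
Proof. by rewrite /bf /form_loc tup_map_lin /= !rowF. Qed.

Let QfE i j k : Qf x i j k =
  QV q (tup [:: col i (F' *m E'); col j (F' *m E'); col k (F' *m E')]).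
Proof. by rewrite /Qf /mvec_loc tup_map_linl /= !colF. Qed.

Let HfE i j : Hf x i j = QH q (tup [:: col i (F' *m E'); col j (F' *m E')]).
Proof. by rewrite /Hf /mvec_loc tup_map_linl /= !colF. Qed.

Let GF : E *m F *m gam q = (E *m Gm x *m E') *m (E *m F).
Proof. exact: frame_conj_row. Qed.

Let FG : gam q *m (F' *m E') = (F' *m E') *m (E *m Gm x *m E').
Proof. exact: frame_conj_col. Qed.

Let rowG i : row i (E *m F) *m gam q = \sum_m Gf x i m *: row m (E *m F).
Proof. by rewrite -row_mul GF row_mulE. Qed.

Let colG i : gam q *m col i (F' *m E') = \sum_m Gf x m i *: col m (F' *m E').
Proof. by rewrite [col _ _]colE mulmxA -colE FG col_mulE. Qed.

Lemma OmV_frame_vertical i j k : Of x i j k = \sum_m Gf x i m * Of x m j k.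
Proof.
rewrite OfE -OmV_slot rowG.
rewrite (linear_form_sum _ _ (@slot_tup _ _ _ _ [:: 0; row j (E *m F); row k (E *m F)] i30 OmVl)).
by apply: eq_bigr => m _; rewrite OfE.
Qed.

Lemma QV_frame_vertical i j k : Qf x i j k = \sum_m Gf x m i * Qf x m j k.
Proof.
rewrite QfE -QV_slot colG.
rewrite (linear_form_sum _ _ (@slot_tup _ _ _ _ [:: 0; col j (F' *m E'); col k (F' *m E')] i30 QVl)).
by apply: eq_bigr => m _; rewrite QfE.
Qed.

Lemma QH_frame_horizontal i j : \sum_m Gf x m i * Hf x m j = 0.
Proof.
rewrite -[RHS](QH_slot q (col i (F' *m E')) (col j (F' *m E'))) colG.
rewrite (linear_form_sum _ _ (@slot_tup _ _ _ _ [:: 0; col j (F' *m E')] i20 QHl)).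
by apply: eq_bigr => m _; rewrite HfE.
Qed.

Lemma bet_frame_vertical i : bf x i = \sum_m Gf x i m * bf x m.
Proof.
rewrite bfE -bet_slot rowG.
rewrite (linear_form_sum _ _ (@slot_tup _ _ _ _ [:: 0] ord0 betl)).
by apply: eq_bigr => m _; rewrite bfE.
Qed.

Let J := loc_jac pi c d q.

Let dpl : differentiable pl x.
Proof. by have := smooth_map_diff pi_smooth ca da cq Nx.2; rewrite qE. Qed.

Lemma DfE i j : Df x i j = (E *m J) i j.
Proof.
have JE : J = jacobian pl x by rewrite /J /loc_jac qE.
rewrite -[LHS](jacobianE (e i) j dpl) -JE.
exact: row_mul_entry.
Qed.

Let FT : F *m T q = J *m from_chart d (pi q).
Proof. exact: (tangent_map_loc ca cq pi_smooth da Nx.2). Qed.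

Let GJ : gam q *m (F' *m J) = 0.
Proof.
have -> : F' *m J = T q *m to_chart d (pi q).
  exact: chain_inverse F'F FT (from_chartK da Nx.2).
by rewrite mulmxA gamT mul0mx.
Qed.

Lemma gam_frame_vertical i j : \sum_m Gf x i m * Df x m j = 0.
Proof.
transitivity ((E *m Gm x *m E' *m (E *m J)) i j).
  by rewrite [RHS]mxE; apply: eq_bigr => m _; rewrite DfE.
by rewrite (frame_conj_eq0 F E'E GJ) mxE.
Qed.

Lemma QV_OmV_frame : \sum_i \sum_j \sum_k Qf x i j k * Of x k j i = 6.
Proof.
have := QV_norm q (tup [::]); rewrite (iprod3_frame _ frame_inv)//.
move=> H; apply: (mulfI (x := 6^-1)); first by rewrite invr_eq0 pnatr_eq0.
rewrite mulVf ?pnatr_eq0// -[RHS]H; congr (_ * _).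
apply: eq_bigr => i _; apply: eq_bigr => j _; apply: eq_bigr => k _.
by rewrite QfE OfE.
Qed.

(** The pulled back area form is the density of [om] times a 2 by 2 minor of the Jacobian of pi. *)
Let pullbackE i j : pullback pi om q (tup [:: row j (E *m F); row i (E *m F)]) =
  wf x * det2 (Df x j) (Df x i).
Proof.
rewrite /pullback tup_map_lin /= !(row_chain E _ FT).
have plE : cinv d (pl x) = pi q by rewrite /pl cmapK//; exact: Nx.2.
have -> : om (pi q) (tup [:: row j (E *m J) *m from_chart d (pi q);
     row i (E *m J) *m from_chart d (pi q)]) =
  form_loc d om (pl x) (tup [:: row j (E *m J); row i (E *m J)]).
  by rewrite /form_loc tup_map_lin /= plE.
have fa : alt_multilinear (form_loc d om (pl x)).
  by apply: alt_form_loc => b; exact: om_vol.1.1.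
rewrite (alt2_det _ _ fa) /det2 !DfE !mxE mulrC; congr (_ * _).
Qed.

Lemma QH_om_frame : \sum_i \sum_j Hf x i j * (wf x * det2 (Df x j) (Df x i)) = 2.
Proof.
have pl2 : multilinear (pullback pi om q).
  apply: (@multilinear_comp _ _ _ _ _ (fun _ u => u *m T q) (om_vol.1.1 (pi q)).1) => _ a u w.
  by rewrite mulmxDl -scalemxAl.
have := QH_norm q (tup [::]); rewrite (iprod2_frame _ frame_inv)//.
move=> H; apply: (mulfI (x := 2^-1)); first by rewrite invr_eq0 pnatr_eq0.
rewrite mulVf ?pnatr_eq0// -[RHS]H; congr (_ * _).
apply: eq_bigr => i _; apply: eq_bigr => j _.
by rewrite HfE pullbackE.
Qed.

Let covecE : covec (bet q) = \sum_m bf x m *: col m (F' *m E').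
Proof.
have betE u : bet q (tup [:: u]) = (u *m covec (bet q)) 0 0.
  rewrite {1}[u]row_sum_delta.
  rewrite (linear_form_sum _ _ (@slot_tup _ _ _ _ [:: 0] ord0 betl)) mxE.
  by apply: eq_bigr => m _; rewrite mxE tup_const.
have -> : covec (bet q) = (F' *m E') *m (E *m F *m covec (bet q)).
  by rewrite mulmxA frame_inv mul1mx.
have -> : F' *m E' *m (E *m F *m covec (bet q)) =
   \sum_m (E *m F *m covec (bet q)) m 0 *: col m (F' *m E').
  by rewrite -col_mulE [RHS]colE; apply/colP => a; rewrite !mxE big_ord1 !mxE mulr1.
apply: eq_bigr => m _; congr (_ *: _).
by rewrite bfE betE row_mul_entry.
Qed.

(** Kept general in [u] and [w]: [dif_Pi] needs arbitrary covectors, not just the dual frame. *)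
Lemma Pi_frame u w : mvec_loc c coupling_bivector x (tup [:: u; w]) =
  - (kf x * mvec_loc c QH x (tup [:: u; w]) +
     \sum_m bf x m * mvec_loc c QV x (tup [:: e' m; u; w])).
Proof.
rewrite /mvec_loc !tup_map_linl /= coupling_bivectorE covecE.
rewrite (linear_form_sum _ _ (@slot_tup _ _ _ _ [:: 0; F' *m u; F' *m w] i30 QVl)).
by congr (- (_ + _)); apply: eq_bigr => m _; rewrite /mvec_loc tup_map_linl /= colF.
Qed.

Lemma OmV_frame12 i j k : Of x j i k = - Of x i j k.
Proof. by rewrite !OfE alt_tup3_12//; exact: OmV_smooth.1. Qed.
Lemma OmV_frame23 i j k : Of x i k j = - Of x i j k.
Proof. by rewrite !OfE alt_tup3_23//; exact: OmV_smooth.1. Qed.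
Lemma QV_frame12 i j k : Qf x j i k = - Qf x i j k.
Proof. by rewrite !QfE alt_tup3_12//; exact: QV_smooth.1. Qed.
Lemma QV_frame23 i j k : Qf x i k j = - Qf x i j k.
Proof. by rewrite !QfE alt_tup3_23//; exact: QV_smooth.1. Qed.
Lemma QH_frame12 i j : Hf x j i = - Hf x i j.
Proof. by rewrite !HfE alt_tup2//; exact: QH_smooth.1. Qed.

End Near.

Let x0E : cinv c x0 = p. Proof. exact: cmapK (chart_at_dom p). Qed.
Let N0 : N x0. Proof. exact: nbhs_singleton nearN. Qed.

Let Uc : nbhs x0 (cimg c). Proof. by apply: filterS nearN => x []. Qed.

Let dif_form k (al : dform M k) v : smooth_form al ->
  differentiable (fun x => form_loc c al x v) x0.
Proof. by move=> [_ als]; exact: smooth_on_near_diff (als c ca v) Uc. Qed.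

Let dif_mvec k (Q : mvec M k) v : smooth_mvec Q ->
  differentiable (fun x => mvec_loc c Q x v) x0.
Proof. by move=> [_ Qs]; exact: smooth_on_near_diff (Qs c ca v) Uc. Qed.

Let dif_k : differentiable kf x0.
Proof. exact: smooth_on_near_diff (kap_smooth ca) Uc. Qed.

Let dif_b i : differentiable (fun x => bf x i) x0. Proof. exact: dif_form. Qed.
Let dif_O i j k : differentiable (fun x => Of x i j k) x0. Proof. exact: dif_form. Qed.
Let dif_Q i j k : differentiable (fun x => Qf x i j k) x0. Proof. exact: dif_mvec. Qed.
Let dif_H i j : differentiable (fun x => Hf x i j) x0. Proof. exact: dif_mvec. Qed.

Let dif_G i j : differentiable (fun x => Gf x i j) x0.
Proof.
have -> : (fun x => Gf x i j) = (fun x => \sum_b (\sum_a E i a * Gm x a b) * E' b j).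
  by apply/funext => x; rewrite /Gf mxE; apply: eq_bigr => b _; rewrite mxE.
apply: differentiable_big => b; apply: differentiable_mul; last exact: differentiable_const.
apply: differentiable_big => a; apply: differentiable_mul; first exact: differentiable_const.
have [H _ _] := gam_ehr.
exact: smooth_on_near_diff (H c ca a b) Uc.
Qed.

Let pl_smooth := fun j => pi_smooth.2 c d ca da j.
Let Upl := smooth_map_nbhs pi_smooth (d := d) (chart_at_dom p) (chart_at_dom (pi p)).

Let dif_Df i j : differentiable (fun x => Df x i j) x0.
Proof. exact: smooth_on_near_diff_derive (pl_smooth j) Upl. Qed.

Let dif_pl : differentiable pl x0.
Proof. by have := smooth_map_diff pi_smooth ca da (chart_at_dom p) (chart_at_dom (pi p)). Qed.

Let pl0 : pl x0 = cmap d (pi p). Proof. by rewrite /pl x0E. Qed.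

Let dif_om v : differentiable (fun y => form_loc d om y v) (pl x0).
Proof.
rewrite pl0; apply: smooth_on_near_diff (om_vol.1.2 d da v) _.
have := chart_near (chart_at_dom (pi p)) (nbhs_cdom (chart_at_dom (pi p))).
by apply: filterS => y [].
Qed.

Let dif_w : differentiable wf x0.
Proof. exact: differentiable_comp dif_pl (dif_om _). Qed.

Let dif_Pi v : differentiable (fun x => mvec_loc c coupling_bivector x v) x0.
Proof.
have vE : v = tup [:: v i20; v i21].
  by apply/funext => -[[|[|//]]] ?; rewrite /tup /=; congr v; apply: val_inj.
rewrite vE; apply: (@near_eq_differentiable _ _ _ (fun x =>
  - (kf x * mvec_loc c QH x (tup [:: v i20; v i21]) +
     \sum_m bf x m * mvec_loc c QV x (tup [:: e' m; v i20; v i21])))).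
  by apply: filterS nearN => x Nx; rewrite Pi_frame.
apply: differentiable_opp; apply: differentiable_add; first by apply: differentiable_mul => //; exact: dif_mvec.
by apply: differentiable_big => m; apply: differentiable_mul => //; exact: dif_mvec.
Qed.

Let G0 i j : Gf x0 i j = vproj_coord R i j.
Proof.
by rewrite -Eg /Gf /Gm x0E from_chart_at to_chart_at mul1mx mulmx1.
Qed.

Let D0 i j : Df x0 i j = pi_coord R i j.
Proof. by rewrite (DfE N0) x0E; exact: ET. Qed.

Let D0f i : Df x0 i = pi_coord R i. Proof. by apply/funext => j; exact: D0. Qed.

Let dk l := 'D_(e l) kf x0.
Let db l i := 'D_(e l) (fun x => bf x i) x0.
Let g l i j := 'D_(e l) (fun x => Gf x i j) x0.
Let dO l i j k := 'D_(e l) (fun x => Of x i j k) x0.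
Let dQ l i j k := 'D_(e l) (fun x => Qf x i j k) x0.
Let dH l i j := 'D_(e l) (fun x => Hf x i j) x0.
Let dw l := 'D_(e l) wf x0.
Let h l i j := 'D_(e l) (fun x => Df x i j) x0.
Let dP l i j := 'D_(e l) (fun x => Pf x i j) x0.

(** [wf] factors through [pl], whose derivative kills vertical directions. *)
Lemma area_basic l : vert l -> dw l = 0.
Proof.
move=> vl; rewrite /dw deriveE//.
have -> : wf = (fun y => form_loc d om y (tup [:: delta_mx 0 0; delta_mx 0 1])) \o pl by [].
rewrite diff_comp//= -[X in 'd _ _ X](deriveE _ dif_pl).
have -> : 'D_(e l) pl x0 = 0.
  rewrite deriveEjacobian//; apply/rowP => j; rewrite jacobianE// mxE.
  by rewrite -[LHS]/(Df x0 l j) D0 /pi_coord; move: l vl j;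
    apply: ord5P => // _ -[[|[|//]]].
by rewrite linear0.
Qed.

Lemma pi_hessian_sym l i j : h l i j = h i l j.
Proof.
apply: derive_comm; last 2 first.
- exact: dif_Df.
- exact: dif_Df.
have UU : \forall y \near x0, nbhs y (cmap c @` (cdom c `&` (pi @^-1` cdom d))).
  exact: nbhs_interior Upl.
by apply: filterS UU => y Uy; exact: smooth_on_near_diff (pl_smooth j) Uy.
Qed.

Let derive_near_cst (f : 'rV[R]_5 -> R) (a : R) v : (\forall x \near x0, f x = a) -> 'D_v f x0 = 0.
Proof. by move=> fa; rewrite (@derive_near _ _ _ (cst a))// derive_cst. Qed.

Lemma jacobi_conditions :
  (forall i j k, jacobi3 (Pf x0) dP i j k = 0) <->
  [/\ (db o52 o53 - db o53 o52) * bf x0 o54 + (db o53 o54 - db o54 o53) * bf x0 o52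
          + (db o54 o52 - db o52 o54) * bf x0 o53 = 0,
      forall i a, ~~ vert i -> vert a ->
        kf x0 * (db i a - db a i - theta_coord dO (Qf x0) i * bf x0 a) = 0 &
      forall a c, vert a -> vert c ->
        dk a * bf x0 c - dk c * bf x0 a - kf x0 ^+ 2 * varrho_coord dO (Hf x0) a c = 0].
Proof.
apply: (@jacobi3_eq0 R (kf x0) dk (bf x0) db g (Of x0) dO (Qf x0) dQ (Hf x0) dH
  (wf x0) dw h).
- by move=> i; rewrite {1}(bet_frame_vertical N0); apply: eq_bigr => m _; rewrite G0.
- by move=> i j k; rewrite {1}(OmV_frame_vertical N0); apply: eq_bigr => m _; rewrite G0.
- by move=> i j k; rewrite {1}(QV_frame_vertical N0); apply: eq_bigr => m _; rewrite G0.
- by move=> i j; rewrite -[RHS](QH_frame_horizontal N0 i j); apply: eq_bigr => m _; rewrite G0.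
(* The relation holds on a neighbourhood and may be differentiated; [G0] then evaluates [gam] at the
   point. The next cases follow the same pattern. *)
- move=> l i; rewrite {1}/db (@derive_near _ _ _ (fun x => \sum_m Gf x i m * bf x m)).
    by rewrite derive_big_mul//; apply: eq_bigr => m _; rewrite G0.
  by apply: filterS nearN => x Nx; exact: bet_frame_vertical.
- move=> l i j k; rewrite {1}/dO (@derive_near _ _ _ (fun x => \sum_m Gf x i m * Of x m j k)).
    by rewrite derive_big_mul//; apply: eq_bigr => m _; rewrite G0.
  by apply: filterS nearN => x Nx; exact: OmV_frame_vertical.
- move=> l i j k; rewrite {1}/dQ (@derive_near _ _ _ (fun x => \sum_m Gf x m i * Qf x m j k)).
    by rewrite derive_big_mul//; apply: eq_bigr => m _; rewrite G0.
  by apply: filterS nearN => x Nx; exact: QV_frame_vertical.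
(* The 0 on the right is rewritten as the derivative of a function that is constant near [x0]. *)
- move=> l i j; rewrite -[RHS](@derive_near_cst (fun x => \sum_m Gf x m i * Hf x m j) 0 (e l)).
    by rewrite derive_big_mul//; apply: eq_bigr => m _; rewrite G0.
  by apply: filterS nearN => x Nx; exact: QH_frame_horizontal.
- move=> l i j; rewrite -[RHS](@derive_near_cst (fun x => \sum_m Gf x i m * Df x m j) 0 (e l)).
    by rewrite derive_big_mul//; apply: eq_bigr => m _; rewrite G0 D0.
  by apply: filterS nearN => x Nx; exact: gam_frame_vertical.
- exact: pi_hessian_sym.
- exact: OmV_frame12.
- exact: OmV_frame23.
- exact: QV_frame12.
- exact: QV_frame23.
- exact: QH_frame12.
- move=> l i j k; rewrite -derive_opp//; apply: derive_near.
  by apply: filterS nearN => x Nx; exact: OmV_frame12.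
- move=> l i j k; rewrite -derive_opp//; apply: derive_near.
  by apply: filterS nearN => x Nx; exact: OmV_frame23.
- move=> l i j k; rewrite -derive_opp//; apply: derive_near.
  by apply: filterS nearN => x Nx; exact: QV_frame12.
- move=> l i j k; rewrite -derive_opp//; apply: derive_near.
  by apply: filterS nearN => x Nx; exact: QV_frame23.
- move=> l i j; rewrite -derive_opp//; apply: derive_near.
  by apply: filterS nearN => x Nx; exact: QH_frame12.
- exact: QV_OmV_frame.
- move=> l; rewrite -[RHS](@derive_near_cst
    (fun x => \sum_i \sum_j \sum_k Qf x i j k * Of x k j i) 6 (e l)); last first.
    by apply: filterS nearN => x Nx; exact: QV_OmV_frame.
  have dif1 i j : differentiable (fun x => \sum_k Qf x i j k * Of x k j i) x0.
    by apply: differentiable_big => k; exact: differentiable_mul.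
  rewrite derive_big; last by move=> i; exact: differentiable_big.
  apply: eq_bigr => i _; rewrite derive_big//; apply: eq_bigr => j _.
  by rewrite derive_big_mul.
- rewrite -(QH_om_frame N0); apply: eq_bigr => i _; apply: eq_bigr => j _.
  by rewrite !D0f.
- move=> l; rewrite -[RHS](@derive_near_cst
    (fun x => \sum_i \sum_j Hf x i j * (wf x * det2 (Df x j) (Df x i))) 2 (e l)); last first.
    by apply: filterS nearN => x Nx; exact: QH_om_frame.
  have difb i j : differentiable (fun x => det2 (Df x j) (Df x i)) x0.
    by apply: differentiable_add; [|apply: differentiable_opp]; apply: differentiable_mul.
  have difwb i j : differentiable (fun x => wf x * det2 (Df x j) (Df x i)) x0.
    exact: differentiable_mul.
  rewrite derive_big => [|i]; last by apply: differentiable_big => j; apply: differentiable_mul.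
  apply: eq_bigr => i _; rewrite derive_big_mul//; apply: eq_bigr => j _.
  rewrite !D0f derive_mul// !D0f; congr (_ + _ * (_ + _ * _)).
  have := @derive_bwedge R _ (e l) x0 (fun x => Df x j) (fun x => Df x i)
    (dif_Df j) (dif_Df i).
  by rewrite !D0f.
- exact: area_basic.
- move=> i j; exact: Pi_frame N0 (e' i) (e' j).
- move=> l i j; rewrite {1}/dP (@derive_near _ _ _ (fun x =>
    - (kf x * Hf x i j + \sum_m bf x m * Qf x m i j))); last first.
    by apply: filterS nearN => x Nx; exact: Pi_frame.
  have difs : differentiable (fun x => \sum_m bf x m * Qf x m i j) x0.
    by apply: differentiable_big => m; exact: differentiable_mul.
  rewrite derive_opp; last by apply: differentiable_add => //; exact: differentiable_mul.
  by rewrite derive_add//; [rewrite derive_mul// derive_big_mul | exact: differentiable_mul].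
Qed.

(** * The Schouten bracket at the point as a Jacobiator in the frame *)

Lemma schouten_coupling xi : schouten coupling_bivector coupling_bivector p xi = - 2 * \sum_l
  (coupling_bivector p (tup [:: delta_mx l 0; xi i30]) * mvec_partial l coupling_bivector p (tup [:: xi i31; xi i32]) +
   coupling_bivector p (tup [:: delta_mx l 0; xi i31]) * mvec_partial l coupling_bivector p (tup [:: xi i32; xi i30]) +
   coupling_bivector p (tup [:: delta_mx l 0; xi i32]) * mvec_partial l coupling_bivector p (tup [:: xi i30; xi i31])).
Proof.
have pa l x y : mvec_partial l coupling_bivector p (tup [:: y; x]) = - mvec_partial l coupling_bivector p (tup [:: x; y]).
  rewrite /mvec_partial -derive_opp; last exact: dif_Pi.
  congr ('D_ _ _ _); apply/funext => z.
  by rewrite /mvec_loc !tup_map_linl /= coupling_bivector_alt.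
have ins x y : insert x (coupling_bivector p) (tup [:: y]) = coupling_bivector p (tup [:: x; y]).
  rewrite /insert; congr (coupling_bivector p); apply/funext => j.
  by case: unliftP => [k ->|->] //; rewrite ord1.
rewrite /schouten mulr_sumr; apply: eq_bigr => l _.
have -> : (fun i => xi (cast_ord (esym (schouten_deg 1 1)) i)) = xi.
  by apply/funext => i; congr xi; apply: val_inj.
rewrite (wedge12 _ _ (pa l)) !ins.
(* For [a = b = 1] the sign powers are -1 and +1, and the two halves of the bracket add up to the
   factor -2. *)
by rewrite expr1 (_ : (1 * 1 + 1)%N = 2%N)// expr2 mulrNN mulr1; ring.
Qed.

(** The index [l] of the bracket is a contraction, so by [trace_frame] it may run over the adapted
    frame instead of the chart basis. *)
Lemma schouten_frame i j k : schouten coupling_bivector coupling_bivector p (tup [:: e' i; e' j; e' k]) =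
  - 2 * jacobi3 (Pf x0) dP i j k.
Proof.
have Pl := coupling_bivector_multilinear p.
have P0 a b : coupling_bivector p (tup [:: e' a; e' b]) = Pf x0 a b.
  by rewrite /Pf /mvec_loc tup_map_linl /= x0E to_chart_at !mul1mx.
have T1 a b m : \sum_l coupling_bivector p (tup [:: delta_mx l 0; e' a]) *
    mvec_partial l coupling_bivector p (tup [:: e' b; e' m]) = \sum_l Pf x0 l a * dP l b m.
  pose phi (u : 'cV[R]_5) := coupling_bivector p (tup [:: u; e' a]).
  pose psi' (v : 'rV[R]_5) := 'D_v (fun x => mvec_loc c coupling_bivector x (tup [:: e' b; e' m])) x0.
  have lphi : linear_form phi by exact: (@slot_tup _ _ _ _ [:: 0; e' a] i20).
  have lpsi : linear_form psi' by move=> r u v; apply: deriveDv; exact: dif_Pi.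
  transitivity (\sum_l phi (delta_mx l 0) * psi' (delta_mx 0 l)); first by [].
  refine (etrans (trace_frame E'E lphi lpsi) _).
  apply: eq_bigr => l _; congr (_ * _).
  exact: P0.
refine (etrans (schouten_coupling _) (congr1 ( *%R (- 2)) _)).
exact: (sum3_eq (T1 i j k) (T1 j k i) (T1 k i j)).
Qed.

Lemma poisson_at :
  (forall xi, schouten coupling_bivector coupling_bivector p xi = 0) <-> forall i j k, jacobi3 (Pf x0) dP i j k = 0.
Proof.
split=> [H0 i j k|H0].
  have := H0 (tup [:: e' i; e' j; e' k]); rewrite schouten_frame => /eqP.
  by rewrite mulf_eq0 oppr_eq0 pnatr_eq0 /= => /eqP.
have Pl := coupling_bivector_multilinear p.
apply: (@multilinear_frame _ _ _ _ _ e').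
- have Sl l : multilinear (wedge (insert (delta_mx l 0) (coupling_bivector p)) (mvec_partial l coupling_bivector p)).
    apply: multilinear_wedge; first exact: multilinear_insert.
    by apply: multilinear_mvec_partial => //; exact: coupling_bivector_multilinear.
  apply: multilinear_sum => l _; apply: multilinearB; apply: multilinearZ => //.
  (* Here the cast of indices is the identity. *)
  have -> : (fun xi : 'I_(1 + 2) -> 'cV[R]_5 =>
      wedge (insert (delta_mx l 0) (coupling_bivector p)) (mvec_partial l coupling_bivector p)
         (fun i => xi (cast_ord (esym (schouten_deg 1 1)) i))) =
     wedge (insert (delta_mx l 0) (coupling_bivector p)) (mvec_partial l coupling_bivector p).
    by apply/funext => xi; congr (wedge _ _ _); apply/funext => i; congr xi; apply: val_inj.
  exact: Sl.
- move=> u; exists (fun i => (E *m u) i 0); rewrite -{1}[u]mul1mx -E'E -mulmxA.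
  by rewrite -[LHS]mulmx1; apply/colP => a; rewrite mulmx1 !mxE summxE; apply: eq_bigr => i _; rewrite !mxE mulrC.
- by move=> I; rewrite tup_frame3 schouten_frame H0 mulr0.
Qed.

(** * Frame components of the three integrability conditions *)

Let span u : exists a, u = \sum_m a m *: e m.
Proof.
exists (fun m => (u *m E') 0 m); rewrite -mulmx_sum_row -mulmxA E'E.
by rewrite mulmx1.
Qed.

Let gam_e i : e i *m gam p = if vert i then e i else 0.
Proof.
have -> : e i *m gam p = row i ((E *m gam p *m E') *m E).
  by rewrite -(mulmxA _ E') E'E mulmx1 [RHS]row_mul.
rewrite row_mulE; case: ifP => vi.
  rewrite (bigD1 i)//= Eg /vproj_coord eqxx vi scale1r big1 ?addr0// => m mi.
  by rewrite Eg /vproj_coord eq_sym (negPf mi) scale0r.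
by rewrite big1// => m _; rewrite Eg /vproj_coord vi andbF scale0r.
Qed.

(** Frame vectors are purely horizontal or purely vertical, so by [bicomp_pure] taking a component
    amounts to counting horizontal indices. *)
Lemma form_comp_frame k a (al : dform M k) (s : seq 'I_5) : multilinear (al p) ->
  size s = k -> form_comp gam a al p (tup (map e s)) =
  if (count (fun i => ~~ vert i) s == a)%N then al p (tup (map e s)) else 0.
Proof.
move=> all sk; rewrite /form_comp.
pose I (j : 'I_k) := nth o50 s j.
have vE : tup (map e s) = fun j : 'I_k => e (I j).
  by apply/funext => j; rewrite /tup (nth_map o50)// sk.
pose A : {set 'I_k} := finset (fun j => ~~ vert (I j)).
rewrite (bicomp_pure _ (A := A)) => //.
- have -> // : #|A| = count (fun i => ~~ vert i) s.
  rewrite -sum1_card -sum1_count (big_nth o50) big_mkord sk.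
  by apply: eq_bigl => j; rewrite inE.
- move=> j; rewrite inE vE mulmxBr mulmx1 gam_e => /negPf ->.
  by rewrite subr0.
- move=> j; rewrite inE negbK vE mulmxBr mulmx1 gam_e => ->.
  by rewrite subrr.
Qed.

Let bet_e k : bet p (tup [:: e k]) = bf x0 k.
Proof. by rewrite /bf /form_loc tup_map_lin /= x0E from_chart_at mulmx1. Qed.

Let bf_hor k : ~~ vert k -> bf x0 k = 0.
Proof. by apply: b_hor => i; rewrite {1}(bet_frame_vertical N0); apply: eq_bigr => m _; rewrite G0. Qed.

Let QE0 i j k : Qf x0 i j k = \sum_m vproj_coord R m i * Qf x0 m j k.
Proof. by rewrite {1}(QV_frame_vertical N0); apply: eq_bigr => m _; rewrite G0. Qed.

Let Qf_hor i j k : ~~ [&& vert i, vert j & vert k] -> Qf x0 i j k = 0.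
Proof.
rewrite !negb_and => /or3P[hi|hi|hi].
- exact: Q_hor QE0 _ _ _ hi.
- by rewrite -[LHS]opprK -QV_frame12 (Q_hor QE0)// oppr0.
- by rewrite -[LHS]opprK -QV_frame23 -QV_frame12 (Q_hor QE0).
Qed.

Let Hf_vert i j : vert i || vert j -> Hf x0 i j = 0.
Proof.
have H0 i' j' : vert i' -> Hf x0 i' j' = 0.
  move=> vi; have := QH_frame_horizontal N0 i' j'.
  rewrite (bigD1 i')//= G0 /vproj_coord eqxx vi mul1r big1 ?addr0// => m mi.
  by rewrite G0 /vproj_coord (negPf mi) mul0r.
by case/orP => v; [exact: H0 | rewrite -[LHS]opprK -QH_frame12 H0// oppr0].
Qed.

Let betl : multilinear (bet p). Proof. exact: (bet_smooth.1 p).1. Qed.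

Let dbetl : multilinear (ext_deriv bet p).
Proof.
apply: multilinear_ext_deriv => [q|v]; first exact: (bet_smooth.1 q).1.
exact: dif_form.
Qed.

Let dOmVl : multilinear (ext_deriv OmV p).
Proof.
apply: multilinear_ext_deriv => [q|v]; first exact: (OmV_smooth.1 q).1.
exact: dif_form.
Qed.

Let kap_form : dform M 0 := fun q _ => kap q.

Let dkapl : multilinear (ext_deriv kap_form p).
Proof.
apply: multilinear_ext_deriv => [q v []//|v].
exact: dif_k.
Qed.

Let comp_lin k a (al : dform M k) : multilinear (al p) -> multilinear (form_comp gam a al p).
Proof.
by apply: multilinear_bicomp => r u v; rewrite mulmxDl -scalemxAl.
Qed.

Let BB i j : R := db i j - db j i.

Let dbet_e i j : ext_deriv bet p (tup [:: e i; e j]) = BB i j.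
Proof. exact: ext_deriv1E. Qed.

Let dOmV_e i j k l : ext_deriv OmV p (tup [:: e i; e j; e k; e l]) = dform4 dO i j k l.
Proof. exact: ext_deriv3E. Qed.

Let dkap_e i : ext_deriv kap_form p (tup [:: e i]) = dk i.
Proof. exact: ext_deriv0E. Qed.

Let d01bet_e i j : d01 gam 0 bet p (tup [:: e i; e j]) =
  if vert i && vert j then BB i j else 0.
Proof.
rewrite /d01 -[[:: e i; e j]]/(map e [:: i; j]) form_comp_frame//= dbet_e.
by case: (vert i); case: (vert j).
Qed.

Let d10bet_e i j : d10 gam 0 bet p (tup [:: e i; e j]) =
  if vert i (+) vert j then BB i j else 0.
Proof.
rewrite /d10 -[[:: e i; e j]]/(map e [:: i; j]) form_comp_frame//= dbet_e.
by case: (vert i); case: (vert j).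
Qed.

Let d01kap_e i : d01 gam 0 kap_form p (tup [:: e i]) = if vert i then dk i else 0.
Proof.
rewrite /d01 -[[:: e i]]/(map e [:: i]) form_comp_frame//= dkap_e.
by case: (vert i).
Qed.

(** [QV] leaves only vertical triples; with a horizontal fourth argument the (1,0) truncation keeps
    the term, with a vertical one it removes it. *)
Let theta_e i : theta gam OmV QV p (tup [:: e i]) =
  if vert i then 0 else theta_coord dO (Qf x0) i.
Proof.
rewrite /theta (iprod3_frame _ E'E) //; last first.
- exact: comp_lin.
- exact: (QV_smooth.1 p).1.
have S a b m : QV p (tup [:: col a E'; col b E'; col m E']) *
    d10 gam 0 OmV p (tup [:: row m E, row b E, row a E & [:: e i]]) =
  if vert i then 0 else Qf x0 a b m * dform4 dO m b a i.
  have -> : QV p (tup [:: col a E'; col b E'; col m E']) = Qf x0 a b m.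
    by rewrite /Qf /mvec_loc tup_map_linl /= x0E to_chart_at !mul1mx.
  have [/and3P[va vb vm]|hv] := boolP [&& vert a, vert b & vert m]; last first.
    by rewrite Qf_hor// !mul0r if_same.
  rewrite /d10 -[[:: row m E, row b E, row a E & [:: e i]]]/(map e [:: m; b; a; i]).
  rewrite form_comp_frame//= dOmV_e va vb vm.
  by case: (vert i); rewrite ?mulr0.
under eq_bigr do under eq_bigr do under eq_bigr do rewrite S.
rewrite /theta_coord; case: (vert i) => //.
by rewrite big1 ?mulr0 ?oppr0// => a _; rewrite big1// => b _; rewrite big1.
Qed.

(** [QH] supplies two horizontal arguments, so the (2,-1) truncation keeps exactly the terms in
    which both others are vertical. *)
Let varrho_e a b : varrho gam OmV QH p (tup [:: e a; e b]) =
  if vert a && vert b then varrho_coord dO (Hf x0) a b else 0.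
Proof.
rewrite /varrho (iprod2_frame _ E'E) //; last first.
- exact: comp_lin.
- exact: (QH_smooth.1 p).1.
have S i j : QH p (tup [:: col i E'; col j E']) *
    d2m1 gam 0 OmV p (tup [:: row j E, row i E & [:: e a; e b]]) =
  if vert a && vert b then Hf x0 i j * dform4 dO j i a b else 0.
  have -> : QH p (tup [:: col i E'; col j E']) = Hf x0 i j.
    by rewrite /Hf /mvec_loc tup_map_linl /= x0E to_chart_at !mul1mx.
  have [vij|] := boolP (vert i || vert j).
    by rewrite Hf_vert// !mul0r if_same.
  rewrite negb_or => /andP[hi hj].
  rewrite /d2m1 -[[:: row j E, row i E & [:: e a; e b]]]/(map e [:: j; i; a; b]).
  rewrite form_comp_frame//= dOmV_e hi hj.
  by case: (vert a); case: (vert b); rewrite ?mulr0.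
under eq_bigr do under eq_bigr do rewrite S.
rewrite /varrho_coord; case: (vert a && vert b) => //.
by rewrite big1 ?mulr0// => i _; rewrite big1.
Qed.

(** With three vertical directions a form of bidegree (0,3) has a single component. *)
Lemma condition1_at :
  (forall v, wedge (d01 gam 0 bet p) (bet p) v = 0) <->
  (db o52 o53 - db o53 o52) * bf x0 o54 + (db o53 o54 - db o54 o53) * bf x0 o52
          + (db o54 o52 - db o52 o54) * bf x0 o53 = 0.
Proof.
have d01A x y : d01 gam 0 bet p (tup [:: y; x]) = - d01 gam 0 bet p (tup [:: x; y]).
  by rewrite /d01 /form_comp !bicomp0 !tup_map_lin /= !ext_deriv1E opprB.
pose W := cyclic_ext db (bf x0).
have WE i j k : wedge (d01 gam 0 bet p) (bet p) (tup [:: e i; e j; e k]) =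
    if [&& vert i, vert j & vert k] then W i j k else 0.
  refine (etrans (wedge21 _ _ d01A) _).
  change (d01 gam 0 bet p (tup [:: e j; e k]) * bet p (tup [:: e i]) +
    d01 gam 0 bet p (tup [:: e k; e i]) * bet p (tup [:: e j]) +
    d01 gam 0 bet p (tup [:: e i; e j]) * bet p (tup [:: e k]) =
    if [&& vert i, vert j & vert k] then W i j k else 0).
  rewrite !d01bet_e !bet_e /W /cyclic_ext -/(BB _ _) -/(BB _ _) -/(BB _ _).
  have := @bf_hor i; have := @bf_hor j; have := @bf_hor k.
  case: (vert i); case: (vert j); case: (vert k) => //= bk bj bi;
    try rewrite (bk isT); try rewrite (bj isT); try rewrite (bi isT); ring.
have W12 : forall i j k, W j i k = - W i j k by exact: cyclic_ext12.
have W23 : forall i j k, W i k j = - W i j k by exact: cyclic_ext23.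
have W0 : W o52 o53 o54 = (db o52 o53 - db o53 o52) * bf x0 o54
    + (db o53 o54 - db o54 o53) * bf x0 o52 + (db o54 o52 - db o52 o54) * bf x0 o53.
  exact: cyclic_extE.
rewrite -W0; split=> [H0|H0].
  by have := H0 (tup [:: e o52; e o53; e o54]); rewrite WE.
apply: (@multilinear_frame _ _ _ _ _ e) => //.
  by apply: multilinear_wedge => //; exact: comp_lin.
move=> I; rewrite tup_frame3 WE; case: ifP => // /and3P[v1 v2 v3].
by rewrite (alt3_eps3 W12 W23)// H0 mul0r.
Qed.

Lemma condition2_at :
  (forall v, kap p * (d10 gam 0 bet p v - wedge (theta gam OmV QV p) (bet p) v) = 0) <->
  (forall i a, ~~ vert i -> vert a ->
        kf x0 * (db i a - db a i - theta_coord dO (Qf x0) i * bf x0 a) = 0).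
Proof.
have thl : multilinear (theta gam OmV QV p).
  exact: multilinearN (multilinear_iprod (QV p) (comp_lin 1 dOmVl)).
have k0 : kf x0 = kap p by rewrite /kf x0E.
have WE i j : d10 gam 0 bet p (tup [:: e i; e j]) -
      wedge (theta gam OmV QV p) (bet p) (tup [:: e i; e j]) =
    if vert i then (if vert j then 0 else - (BB j i - theta_coord dO (Qf x0) j * bf x0 i))
    else (if vert j then BB i j - theta_coord dO (Qf x0) i * bf x0 j else 0).
  rewrite d10bet_e wedge11 !tup_const.
  change ((if vert i (+) vert j then BB i j else 0) -
    (theta gam OmV QV p (tup [:: e i]) * bet p (tup [:: e j]) -
     theta gam OmV QV p (tup [:: e j]) * bet p (tup [:: e i])) =
    if vert i then (if vert j then 0 else - (BB j i - theta_coord dO (Qf x0) j * bf x0 i))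
    else (if vert j then BB i j - theta_coord dO (Qf x0) i * bf x0 j else 0)).
  rewrite !theta_e !bet_e; apply: mixed_cases (@bf_hor i) (@bf_hor j).
  exact/esym/opprB.
rewrite k0; split=> [H0 i a hi va|H0].
  by have := H0 (tup [:: e i; e a]); rewrite WE va (negPf hi).
apply: (@multilinear_frame _ _ _ _ _ e) => //.
  apply: multilinearZ; apply: multilinearB; first exact: comp_lin.
  exact: (multilinear_wedge thl betl).
move=> I; rewrite tup_frame2 WE.
have [vi|hi] := boolP (vert (I i20)); have [vj|hj] := boolP (vert (I i21)).
- by rewrite mulr0.
- by rewrite mulrN H0// oppr0.
- exact: H0.
- by rewrite mulr0.
Qed.

Lemma condition3_at :
  (forall v, wedge (d01 gam 0 kap_form p) (bet p) v
     - kap p ^+ 2 * varrho gam OmV QH p v = 0) <->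
  (forall a b, vert a -> vert b ->
     dk a * bf x0 b - dk b * bf x0 a - kf x0 ^+ 2 * varrho_coord dO (Hf x0) a b = 0).
Proof.
have k0 : kf x0 = kap p by rewrite /kf x0E.
have WE i j : wedge (d01 gam 0 kap_form p) (bet p) (tup [:: e i; e j])
     - kap p ^+ 2 * varrho gam OmV QH p (tup [:: e i; e j]) =
    if vert i && vert j
    then dk i * bf x0 j - dk j * bf x0 i - kap p ^+ 2 * varrho_coord dO (Hf x0) i j else 0.
  rewrite varrho_e wedge11 !tup_const.
  change (d01 gam 0 kap_form p (tup [:: e i]) * bet p (tup [:: e j]) -
     d01 gam 0 kap_form p (tup [:: e j]) * bet p (tup [:: e i])
     - kap p ^+ 2 * (if vert i && vert j then varrho_coord dO (Hf x0) i j else 0) =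
    if vert i && vert j
    then dk i * bf x0 j - dk j * bf x0 i - kap p ^+ 2 * varrho_coord dO (Hf x0) i j else 0).
  rewrite !d01kap_e !bet_e; exact: vertical_cases (@bf_hor i) (@bf_hor j).
rewrite k0; split=> [H0 i j vi vj|H0].
  by have := H0 (tup [:: e i; e j]); rewrite WE vi vj.
apply: (@multilinear_frame _ _ _ _ _ e) => //.
  apply: multilinearB; first by apply: multilinear_wedge => //; exact: comp_lin.
  by apply: multilinearZ; apply: multilinear_iprod; exact: comp_lin.
by move=> I; rewrite tup_frame2 WE; case: ifP => // /andP[? ?]; exact: H0.
Qed.

Lemma integrability_at :
  (forall xi, schouten coupling_bivector coupling_bivector p xi = 0) <->
  [/\ forall v, wedge (d01 gam 0 bet p) (bet p) v = 0,
      forall v, kap p * (d10 gam 0 bet p v - wedge (theta gam OmV QV p) (bet p) v) = 0 &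
      forall v, wedge (d01 gam 0 (k := 0) (fun q _ => kap q) p) (bet p) v
        - kap p ^+ 2 * varrho gam OmV QH p v = 0].
Proof.
rewrite poisson_at jacobi_conditions; split=> -[c1 c2 c3]; split.
- exact: condition1_at.2.
- exact: condition2_at.2.
- exact: condition3_at.2.
- exact: condition1_at.1.
- exact: condition2_at.1.
- exact: condition3_at.1.
Qed.

End AtPoint.

Lemma poisson_integrability : poisson coupling_bivector <->
  [/\ forall p v, wedge (d01 gam 0 bet p) (bet p) v = 0,
      forall p v, kap p * (d10 gam 0 bet p v - wedge (theta gam OmV QV p) (bet p) v) = 0 &
      forall p v, wedge (d01 gam 0 (k := 0) (fun q _ => kap q) p) (bet p) v
        - kap p ^+ 2 * varrho gam OmV QH p v = 0].
Proof.
(* Neither side of [integrability_at] mentions the frame, so frames chosen separately at each point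
   suffice. *)
have frame q := adapted_frame (let: And3 _ _ H := pi_fib in H q) (gamT q) (@gam_fix q).
split=> [H0|[c1 c2 c3] p].
  by split=> p; have [E [E' [EE ET Eg]]] := frame p;
    have [c1 c2 c3] := (integrability_at EE ET Eg).1 (H0 p).
have [E [E' [EE ET Eg]]] := frame p.
by apply/(integrability_at EE ET Eg); split.
Qed.

End CouplingBivector.

Theorem theorem4p1 (R : realType) (M : manifold R 5) (B : manifold R 2)
    (pi : M -> B) (Om : dform M 5) (om : dform B 2)
    (gam : M -> 'M[R]_5) (kap : M -> R) (bet : dform M 1)
    (OmV : dform M 3) (QH : mvec M 2) (QV : mvec M 3) (psi : mvec B 2) :
  fiber_bundle pi ->
  volume_form Om ->
  volume_form om ->
  ehresmann pi gam ->
  smooth_fun kap ->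
  (* bet is a section of the annihilator of the horizontal subbundle *)
  smooth_form bet ->
  (forall p v, horizontal gam p v -> bet p (fun=> v) = 0) ->
  (* Om = OmH /\ OmV, where OmH = pi^* om *)
  smooth_form OmV ->
  form_bidegree gam (a := 0) (b := 3) OmV ->
  (forall p v, Om p v = wedge (pullback pi om p) (OmV p) v) ->
  (* i_QH OmH = 1 and i_QV OmV = 1 *)
  smooth_mvec QH ->
  mvec_bidegree gam (a := 2) (b := 0) QH ->
  (forall p v, mvec_iprod (l := 0) (QH p) (pullback pi om p) v = 1) ->
  smooth_mvec QV ->
  mvec_bidegree gam (a := 0) (b := 3) QV ->
  (forall p v, mvec_iprod (l := 0) (QV p) (OmV p) v = 1) ->
  (* i_psi om = -1 *)
  smooth_mvec psi ->
  (forall b v, mvec_iprod (l := 0) (psi b) (om b) v = -1) ->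
  poisson (fun p xi => kap p * hor pi gam psi p xi + P_ QV bet p xi)
  <->
  [/\ forall p v, wedge (d01 gam 0 bet p) (bet p) v = 0,
      forall p v,
        kap p * (d10 gam 0 bet p v - wedge (theta gam OmV QV p) (bet p) v) = 0 &
      forall p v,
        wedge (d01 gam 0 (k := 0) (fun q _ => kap q) p) (bet p) v
        - kap p ^+ 2 * varrho gam OmV QH p v = 0].
Proof.
move=> pi_fib _ om_vol gam_ehr kap_smooth bet_smooth bet_vert OmV_smooth OmV_bideg _.
move=> QH_smooth QH_bideg QH_norm QV_smooth QV_bideg QV_norm psi_smooth psi_norm.
exact: (poisson_integrability pi_fib om_vol gam_ehr kap_smooth bet_smooth bet_vert
  OmV_smooth OmV_bideg QH_smooth QH_bideg QH_norm QV_smooth QV_bideg QV_norm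
  psi_smooth psi_norm).
Qed.
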